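(* For each integer $n\ge1$ there is a constant $c(n)>0$ such that the following holds. Let $1\le k\le n$, let $R$ and $S$ be $n$-dimensional rectangles with dimensions $R_1\le\dots\le R_n$ and $S_1\le\dots\le S_n$, and let $Q_i=S_i/R_i$. Suppose that $U$ is an open set in $R$ and that $\Phi$ is a map of pairs $(U,\partial U)\to(S,\partial S)$ of degree $D>0$. Suppose that $j,l$ are integers with $0\le j<k\le l\le n$. Then $$\mathrm{dil}_k(\Phi)\ge c(n)\,Q_1\cdots Q_j\,(Q_{j+1}\cdots Q_l)^{\frac{k-j}{l-j}}.$$
   Context: An $n$-dimensional rectangle with dimensions $R_1\le\dots\le R_n$ (all positive) is a product of intervals of these lengths in $\mathbb{R}^n$, with the Euclidean metric. A map of pairs $(U,\partial U)\to(S,\partial S)$ means: a continuous map from the closure $\overline U$ (closure and topological boundary $\partial U$ taken in $\mathbb{R}^n$) to the closed rectangle $S$, smooth on $U$, and sending $\partial U$ into $\partial S$. Its degree is the usual one: the signed count of preimages in $U$ of a generic (regular) value in the interior of $S$. The $k$-dilation is $\mathrm{dil}_k(\Phi)=\|\Lambda^k d\Phi\|_{L^\infty}=\sup_{x\in U}|\Lambda^k d\Phi_x|$, with $|\cdot|$ the operator norm; equivalently, the least $\Lambda$ such that every $k$-dimensional surface of volume $v$ has image of volume at most $\Lambda v$. Empty products equal $1$. *)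

(* Defs.v *)
From mathcomp Require Import all_boot all_order all_algebra.
From mathcomp Require Import all_classical all_reals all_analysis.

Set Implicit Arguments.
Unset Strict Implicit.
Unset Printing Implicit Defensive.

Import Order.TTheory GRing.Theory Num.Theory.
Import numFieldNormedType.Exports.

Local Open Scope classical_set_scope.
Local Open Scope ring_scope.

(* R^n is 'rV[R]_n. The library norm on it is the sup norm; it is used here
   only for topology and differentiability. The Euclidean structure enters
   through [enorm]. *)

Definition rect_dims (R : realType) (n : nat) (L : 'I_n -> R) : Prop :=
  (forall i, 0 < L i) /\ (forall i j : 'I_n, (i <= j)%N -> L i <= L j).

(* The closed rectangle with side lengths L and lowest corner a. *)
Definition rectangle (R : realType) (n : nat) (a : 'rV[R]_n) (L : 'I_n -> R) :
    set 'rV[R]_n :=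
  [set x | forall i, a 0 i <= x 0 i <= a 0 i + L i].

Definition boundary (T : topologicalType) (A : set T) : set T :=
  closure A `\` interior A.

(* C^m on the open set U. The derivatives at a point of U depend only on the
   values of f on U. *)
Fixpoint Ck (R : realType) (n p : nat) (U : set 'rV[R]_n) (m : nat)
    (f : 'rV[R]_n -> 'rV[R]_p) : Prop :=
  if m is m'.+1 then
    (forall x, U x -> differentiable f x) /\
    (forall v, Ck U m' (fun x => 'D_v f x))
  else forall x, U x -> {for x, continuous f}.

Definition smooth_on (R : realType) (n p : nat) (U : set 'rV[R]_n)
    (f : 'rV[R]_n -> 'rV[R]_p) : Prop :=
  forall m, Ck U m f.

(* A map of pairs (U, bd U) -> (S, bd S). It is encoded by a total function,
   whose values outside the closure of U play no role. *)
Record map_of_pairs (R : realType) (n : nat) (U S : set 'rV[R]_n)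
    (Phi : 'rV[R]_n -> 'rV[R]_n) : Prop := MapOfPairs {
  mp_continuous : {within closure U, continuous Phi};
  mp_smooth : smooth_on U Phi;
  mp_maps : forall x, closure U x -> S (Phi x);
  mp_boundary : forall x, boundary U x -> boundary S (Phi x) }.

Definition regular_value (R : realType) (n : nat) (U : set 'rV[R]_n)
    (Phi : 'rV[R]_n -> 'rV[R]_n) (y : 'rV[R]_n) : Prop :=
  forall x, U x -> Phi x = y -> \det (jacobian Phi x) != 0.

(* The fibre of a regular value in the interior of S is compact (the boundary
   of U avoids it) and discrete, so the sum is finite. By Sard's theorem almost
   every point of S is a regular value, so at most one D qualifies when S has
   nonempty interior. *)
Definition has_degree (R : realType) (n : nat) (U S : set 'rV[R]_n)
    (Phi : 'rV[R]_n -> 'rV[R]_n) (D : int) : Prop :=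
  forall y, interior S y -> regular_value U Phi y ->
    \sum_(x \in [set x | U x /\ Phi x = y]) sgz (\det (jacobian Phi x)) = D.

Definition enorm (R : realType) (N : nat) (w : 'rV[R]_N) : R :=
  Num.sqrt (\sum_(i < N) w 0 i ^+ 2).

(* Operator norm, for Euclidean norms, of the map w |-> w *m A. *)
Definition opnorm (R : realType) (M N : nat) (A : 'M[R]_(M, N)) : R :=
  sup [set enorm (w *m A) | w in [set w : 'rV[R]_M | enorm w <= 1]].

(* Strictly increasing I : I_1 < ... < I_k, indexing the orthonormal basis
   e_I = e_(I_1) /\ ... /\ e_(I_k) of the k-th exterior power of R^n. *)
Definition multi_index (k n : nat) : finType :=
  {I : {ffun 'I_k -> 'I_n} |
    [forall i : 'I_k, forall j : 'I_k, (i < j)%N ==> (I i < I j)%N]}.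

(* Matrix of the k-th exterior power of A in the bases e_I, e_J: row I holds
   the coordinates of (e_(I_1) A) /\ ... /\ (e_(I_k) A), which are the k x k
   minors of A on the rows I. *)
Definition ext_power (R : realType) (k m n : nat) (A : 'M[R]_(m, n)) :
    'M[R]_(#|{: multi_index k m}|, #|{: multi_index k n}|) :=
  \matrix_(I, J) let I' : multi_index k m := enum_val I in
                 let J' : multi_index k n := enum_val J in
                 \det (mxsub (val I') (val J') A).

(* The k-dilation, possibly +oo. *)
Definition dil (R : realType) (n k : nat) (U : set 'rV[R]_n)
    (Phi : 'rV[R]_n -> 'rV[R]_n) : \bar R :=
  ereal_sup [set (opnorm (ext_power k (jacobian Phi x)))%:E | x in U].

(* Main.v *)
Require Import Defs.
From mathcomp Require Import all_boot all_order all_algebra perm.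
From mathcomp Require Import boolp reals zify ring lra.
Set Implicit Arguments.
Unset Strict Implicit.
Unset Printing Implicit Defensive.
Import Order.TTheory GRing.Theory Num.Theory.
Local Open Scope ring_scope.

(* Suppose the k-dilation is too small. Let mu be the geometric mean of Q_(j+1), ..., Q_l and measure the target
   directions beyond the j-th in units of sigma = S_(j+1), the corresponding domain directions in units of sigma / mu.
   A self-map of the domain homotopic to the identity collapses every k-dimensional slice {x_i fixed for i > k} onto
   the product of the first j directions with the (k - j)-skeleton of the unit grid in the directions j+1, ..., l, up
   to boundedly many extra cells.

   The degree of a map is a sum, over the cells of a fine lattice, of cup products of the coboundaries of the
   indicators [Phi_s > t_s]. By homotopy invariance the label t may vary freely from one lattice point to another.
   As the degree is not zero, for every labelling there is a cell with an edge path along whose s-th step the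
   s-th indicator jumps. If t only depends on the coordinates beyond the k-th, and its unit box only on those beyond
   the l-th, then k components of Phi at a point of a collapsed slice match the labels, and l of them lie in the
   prescribed boxes.

   For random labels this is unlikely: the volume count leaves boundedly many k-cells over a given box, and each has a
   small image since the k x k minors are small. These events are local, so a greedy choice avoids all of them, a
   contradiction. *)

(** * Cubical cochains on a finite lattice *)

(** A step of the edge path in one of the first k directions does not change a label that ignores
    these coordinates, so the jump there is due to the map, which must pass close to the label: this
    is how one nonzero degree yields k matches. The unit sigma / mu is forced. The boxes depend only
    on the coordinates beyond the l-th, so all k-cells of an l-dimensional slice compete for them;
    with this unit the number of cells, up to constants the product of the R_i mu / sigma over j < i
    <= l, equals the product of the S_i / sigma, which is at most a multiple of the number of boxes
    in any l components. A coordinatewise collapse would fail on the k-dimensional slices whose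
    fixed coordinates lie in the narrow intervals where the collapse moves from one integer level to
    the next. Collapsing tilted coordinates, with small slopes in general position, confines such
    failures to boundedly many thickened unit cells in each slice. Finally, the unit fits into the
    domain only if Q_(j+1) <= mu; otherwise Q_(j+1) joins the first j ratios, which only strengthens
    the estimate. *)

Section Cochains.
Variables (V : finType) (n : nat) (sh : 'I_n -> V -> V).
Hypothesis shC : forall i j u, sh i (sh j u) = sh j (sh i u).
Hypothesis sh_inj : forall i, injective (sh i).

(** Cubes of all dimensions at once: the arguments are the lowest vertex of a cube and the ordered
    list of its directions, whose order fixes the signs. *)
Definition cochain := V -> seq 'I_n -> int.

(** The half of the cubical coboundary that runs over the upper faces, with alternating signs;
    [cface] is the half over the lower faces. Only the upper half moves the base vertex. *)
Fixpoint ctheta (X : cochain) (u : V) (es : seq 'I_n) : int :=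
  if es is i :: es' then X (sh i u) es' - ctheta (fun v fs => X v (i :: fs)) u es'
  else 0.

Fixpoint cface (X : cochain) (u : V) (es : seq 'I_n) : int :=
  if es is i :: es' then X u es' - cface (fun v fs => X v (i :: fs)) u es'
  else 0.

Definition cmul (b : V -> int) (X : cochain) : cochain := fun u es => b u * X u es.

(* Cup product with the coboundary of the 0-cochain [b]. *)
Definition cjump (b : V -> int) (X : cochain) : cochain :=
  fun u es => ctheta (cmul b X) u es - b u * ctheta X u es.

Definition cdiff (X : cochain) : cochain := fun u es => ctheta X u es - cface X u es.

Definition cone : cochain := fun _ es => (es == [::])%:R.

Definition ccup (bs : seq (V -> int)) : cochain := foldr cjump cone bs.

Lemma ctheta_lin (a c : int) X Y u es :
  ctheta (fun v fs => a * X v fs + c * Y v fs) u es =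
  a * ctheta X u es + c * ctheta Y u es.
Proof.
elim: es X Y => [|i es IH] X Y /=; first by ring.
by rewrite IH; ring.
Qed.

Lemma ctheta0 u es : ctheta (fun _ _ => 0) u es = 0.
Proof. by elim: es => [|i es IH] //=; rewrite IH subr0. Qed.

Lemma ctheta_sub X Y u es :
  ctheta (fun v fs => X v fs - Y v fs) u es = ctheta X u es - ctheta Y u es.
Proof. by elim: es X Y => [|i es IH] X Y /=; [ring | rewrite IH; ring]. Qed.

Lemma cface_sub X Y u es :
  cface (fun v fs => X v fs - Y v fs) u es = cface X u es - cface Y u es.
Proof. by elim: es X Y => [|i es IH] X Y /=; [ring | rewrite IH; ring]. Qed.

Lemma ctheta_shift X i u es :
  ctheta (fun v fs => X (sh i v) fs) u es = ctheta X (sh i u) es.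
Proof. by elim: es X => [|j es IH] X //=; rewrite shC (IH (fun v fs => X v (j :: fs))). Qed.

Lemma cface_shift X i u es :
  cface (fun v fs => X (sh i v) fs) u es = cface X (sh i u) es.
Proof. by elim: es X => [|j es IH] X //=; rewrite (IH (fun v fs => X v (j :: fs))). Qed.

(** Two directions removed in either order lead to the same vertex, as the shifts commute, and the
    two terms have opposite signs. *)
Lemma ctheta_theta X u es : ctheta (ctheta X) u es = 0.
Proof.
elim: es X => [|i es IH] X //=.
by rewrite ctheta_sub ctheta_shift IH subr0 subrr.
Qed.

Lemma cface_theta X u es : cface (ctheta X) u es = - ctheta (cface X) u es.
Proof.
elim: es X => [|i es IH] X /=; first by rewrite oppr0.
by rewrite cface_sub ctheta_sub cface_shift IH; ring.
Qed.

Lemma cface_mul b X u es : cface (cmul b X) u es = b u * cface X u es.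
Proof.
elim: es X => [|i es IH] X /=; first by rewrite mulr0.
by rewrite /cmul -/(cmul b (fun v fs => X v (i :: fs))) IH mulrBr.
Qed.

Lemma cdiff_mul b X u es :
  cdiff (cmul b X) u es = cjump b X u es + b u * cdiff X u es.
Proof. by rewrite /cdiff cface_mul /cjump; ring. Qed.

(** Leibniz rule: the coboundary of [b] is closed, so only the derivative of [X] survives. *)
Lemma cdiff_jump b X u es : cdiff (cjump b X) u es = - cjump b (cdiff X) u es.
Proof.
rewrite /cdiff /cjump.
have -> : cmul b (fun u es => ctheta X u es - cface X u es) =
   (fun u es => cmul b (ctheta X) u es - cmul b (cface X) u es).
  by apply/funext => v; apply/funext => fs; rewrite /cmul mulrBr.
rewrite !ctheta_sub !cface_sub ctheta_theta.
rewrite -[X in _ - (_ - cface X _ _)]/(cmul b (ctheta X)) cface_mul !cface_theta.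
have -> : cface (cmul b X) = cmul b (cface X).
  by apply/funext => v; apply/funext => fs; rewrite cface_mul.
rewrite ctheta_theta -[ctheta (fun _ _ => _ * _) _ _]/(ctheta (cmul b (ctheta X)) u es).
by ring.
Qed.

Lemma cdiff_one u es : cdiff cone u es = 0.
Proof.
rewrite /cdiff; case: es => [|i es] //=.
have H0 : (fun (v : V) (fs : seq 'I_n) => cone v (i :: fs)) = (fun _ _ => 0) by [].
rewrite H0 ctheta0.
have -> : cface (fun _ _ => 0) u es = 0.
  by elim: es => [|j es IH] //=; rewrite IH subr0.
by rewrite /cone subrr.
Qed.

Lemma cjump0 b u es : cjump b (fun _ _ => 0) u es = 0.
Proof.
rewrite /cjump ctheta0 mulr0 subr0.
have -> : cmul b (fun _ _ => 0) = (fun _ _ => 0).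
  by apply/funext => v; apply/funext => fs; rewrite /cmul mulr0.
exact: ctheta0.
Qed.

Lemma cdiff_cup bs u es : cdiff (ccup bs) u es = 0.
Proof.
elim: bs u es => [|b bs IH] u es /=; first exact: cdiff_one.
rewrite cdiff_jump.
have -> : cdiff (ccup bs) = (fun _ _ => 0) by apply/funext => v; apply/funext => fs.
by rewrite cjump0 oppr0.
Qed.

(** A shift permutes the finitely many vertices, so upper and lower faces cancel in the sum: the
    lattice has no boundary. *)
Lemma sum_ctheta X es : \sum_u ctheta X u es = \sum_u cface X u es.
Proof.
elim: es X => [|i es IH] X /=; first by [].
rewrite !sumrB IH; congr (_ - _).
rewrite [RHS](reindex_inj (@sh_inj i)); exact: eq_bigr.
Qed.

Lemma sum_cdiff X es : \sum_u cdiff X u es = 0.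
Proof. by rewrite /cdiff sumrB sum_ctheta subrr. Qed.

Lemma cjump_cons b X u i es :
  cjump b X u (i :: es) = (b (sh i u) - b u) * X (sh i u) es
    - cjump b (fun v fs => X v (i :: fs)) u es.
Proof. by rewrite /cjump /= /cmul; ring. Qed.

Lemma cjump_neq0 b X u es : cjump b X u es != 0 ->
  exists i es1 es2, [/\ es = es1 ++ i :: es2, b (sh i u) != b u &
    X (sh i u) (es1 ++ es2) != 0].
Proof.
elim: es X => [|i es IH] X; first by rewrite /cjump /= mulr0 subr0 eqxx.
rewrite cjump_cons => H.
have [H1|H1] := eqVneq ((b (sh i u) - b u) * X (sh i u) es) 0.
  move: H; rewrite H1 sub0r oppr_eq0 => /IH [i' [es1 [es2 [-> Hb HX]]]].
  by exists i', (i :: es1), es2.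
exists i, [::], es; split=> //; move: H1; rewrite mulf_eq0 negb_or subr_eq0.
  by case/andP.
by case/andP.
Qed.

Lemma perm_cons_mid (i : 'I_n) p q1 q2 :
  perm_eq (i :: p) (q1 ++ i :: q2) = perm_eq p (q1 ++ q2).
Proof. by rewrite perm_sym -[i :: q2]cat1s perm_catCA /= perm_cons perm_sym. Qed.

Definition vtx (u : V) (p : seq 'I_n) : V := foldl (fun v i => sh i v) u p.

Definition in_cube (u : V) (es : seq 'I_n) (v : V) :=
  exists A B, perm_eq (A ++ B) es /\ v = vtx u A.

Lemma in_cube_base u es : in_cube u es u.
Proof. by exists [::], es. Qed.

Lemma in_cube_shift u i es1 es2 v :
  in_cube (sh i u) (es1 ++ es2) v -> in_cube u (es1 ++ i :: es2) v.
Proof.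
move=> [A [B [HAB ->]]]; exists (i :: A), B; split=> //.
by rewrite /= perm_cons_mid.
Qed.

Lemma cjump_const b X u es c :
  (forall v, in_cube u es v -> b v = c) -> cjump b X u es = 0.
Proof.
move=> H; apply/eqP/negPn/negP => /cjump_neq0 [i [es1 [es2 [E Hb _]]]].
move: Hb; rewrite !H ?eqxx //; first exact: in_cube_base.
by rewrite E; apply: in_cube_shift; exact: in_cube_base.
Qed.

(** A cup product evaluates its last factor only on faces of the given cube. *)
Lemma cfold_eq0 bs X u es :
  (forall v fs, in_cube u es v -> (forall w, in_cube v fs w -> in_cube u es w) ->
     X v fs = 0) -> foldr cjump X bs u es = 0.
Proof.
elim: bs u es => [|b bs IH] u es H /=.
  by apply: H; [exact: in_cube_base | move=> w].
apply/eqP/negPn/negP => /cjump_neq0 [i [es1 [es2 [E _ /eqP]]]]; apply.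
apply: IH => v fs Hv Hfs; apply: H; rewrite E.
  exact: in_cube_shift.
by move=> w /Hfs; exact: in_cube_shift.
Qed.

Lemma ccup_const b0 bs s c u es : (s < size bs)%N ->
  (forall v, in_cube u es v -> nth b0 bs s v = c) -> ccup bs u es = 0.
Proof.
move=> Hs Hv; rewrite /ccup -(cat_take_drop s bs) foldr_cat (drop_nth b0 Hs) /=.
apply: cfold_eq0 => v fs _ Hfs; apply: (@cjump_const _ _ _ _ c) => w Hw.
by apply: Hv; apply: Hfs.
Qed.

Fixpoint jumps (bs : seq (V -> int)) (u : V) (p : seq 'I_n) : bool :=
  match bs, p with
  | b :: bs', i :: p' => (b (sh i u) != b u) && jumps bs' (sh i u) p'
  | [::], [::] => true
  | _, _ => false
  end.

(** Each factor of a nonzero cup product contributes an edge on which it jumps, and the next factor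
    is evaluated from the far end of that edge. The edges thus join up to a path across the cube
    that uses each direction once. *)
Lemma ccup_neq0 bs u es : ccup bs u es != 0 ->
  exists2 p, perm_eq p es & jumps bs u p.
Proof.
elim: bs u es => [|b bs IH] u es /=.
  by rewrite /cone; case: es => //= _; exists [::].
move=> /cjump_neq0 [i [es1 [es2 [-> Hb /IH [p Hp Hj]]]]].
by exists (i :: p); [rewrite perm_cons_mid | rewrite /= Hb].
Qed.

Lemma cjump_sub b b' X u es :
  cjump (fun v => b v - b' v) X u es = cjump b X u es - cjump b' X u es.
Proof.
rewrite /cjump.
have -> : cmul (fun v => b v - b' v) X = (fun v fs => cmul b X v fs - cmul b' X v fs).
  by apply/funext => v; apply/funext => fs; rewrite /cmul mulrBl.
by rewrite ctheta_sub; ring.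
Qed.

Lemma foldr_cjump_sub bs X Y u es :
  foldr cjump (fun v fs => X v fs - Y v fs) bs u es =
  foldr cjump X bs u es - foldr cjump Y bs u es.
Proof.
elim: bs u es => [|b bs IH] u es //=.
have -> : foldr cjump (fun v fs => X v fs - Y v fs) bs =
  (fun v fs => foldr cjump X bs v fs - foldr cjump Y bs v fs).
  by apply/funext => v; apply/funext => fs.
rewrite /cjump ctheta_sub.
have -> : cmul b (fun v fs => foldr cjump X bs v fs - foldr cjump Y bs v fs) =
  (fun v fs => cmul b (foldr cjump X bs) v fs - cmul b (foldr cjump Y bs) v fs).
  by apply/funext => v; apply/funext => fs; rewrite /cmul mulrBr.
by rewrite ctheta_sub; ring.
Qed.

Lemma cdiff_foldr bs X u es :
  cdiff (foldr cjump X bs) u es = (-1) ^+ size bs * foldr cjump (cdiff X) bs u es.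
Proof.
elim: bs u es => [|b bs IH] u es /=; first by rewrite mul1r.
rewrite cdiff_jump.
have -> : cdiff (foldr cjump X bs) =
   (fun v fs => (-1) ^+ size bs * foldr cjump (cdiff X) bs v fs).
  by apply/funext => v; apply/funext => fs.
have Hs Z : ctheta (fun v fs => (-1) ^+ size bs * Z v fs) u es =
    (-1) ^+ size bs * ctheta Z u es.
  have := ctheta_lin ((-1) ^+ size bs) 0 Z (fun _ _ => 0) u es.
  rewrite ctheta0 mulr0 addr0 => <-; congr ctheta.
  by apply/funext => v; apply/funext => fs; ring.
rewrite /cjump exprS Hs.
have -> : cmul b (fun v fs => (-1) ^+ size bs * foldr cjump (cdiff X) bs v fs) =
  (fun v fs => (-1) ^+ size bs * cmul b (foldr cjump (cdiff X) bs) v fs).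
  by apply/funext => v; apply/funext => fs; rewrite /cmul mulrCA.
rewrite Hs; ring.
Qed.

(* Summation by parts against the cutoff [chi]: only the cells where [chi] changes contribute. *)
Lemma sum_cut_cdiff (chi : V -> int) X es :
  (forall u, cjump chi X u es = 0) -> \sum_u chi u * cdiff X u es = 0.
Proof.
move=> H; rewrite -[RHS](sum_cdiff (cmul chi X) es).
by apply: eq_bigr => u _; rewrite cdiff_mul H add0r.
Qed.

(** The difference of the two products is, up to sign, the coboundary of the cochain [X] in which
    the function [b - b'] itself stands in place of its coboundary. Summation by parts leaves only
    the cubes where [chi] changes, and there each alternative of the hypothesis makes [X] vanish. *)
Lemma cut_step (chi : V -> int) bs b b' bs' es :
  (forall u i, chi (sh i u) != chi u ->
    (exists s c, (s < size bs)%N /\ forall v, in_cube u es v -> nth b bs s v = c)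
    \/ (forall v, in_cube u es v -> b v = b' v)
    \/ (exists s c, (s < size bs')%N /\ forall v, in_cube u es v -> nth b bs' s v = c)) ->
  \sum_u chi u * ccup (bs ++ b :: bs') u es =
  \sum_u chi u * ccup (bs ++ b' :: bs') u es.
Proof.
move=> H; apply/eqP; rewrite -subr_eq0 -sumrB; apply/eqP.
pose f v := b v - b' v.
pose X := foldr cjump (cmul f (ccup bs')) bs.
have HX u : (-1) ^+ size bs * cdiff X u es =
    ccup (bs ++ b :: bs') u es - ccup (bs ++ b' :: bs') u es.
  rewrite /X cdiff_foldr mulrA -expr2 sqrr_sign mul1r /ccup !foldr_cat -/(ccup _) /=.
  rewrite -foldr_cjump_sub; congr (foldr cjump _ _ _ _).
  apply/funext => v; apply/funext => fs.
  by rewrite cdiff_mul cdiff_cup mulr0 addr0 /f cjump_sub.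
transitivity ((-1) ^+ size bs * \sum_u chi u * cdiff X u es).
  by rewrite mulr_sumr; apply: eq_bigr => u _; rewrite mulrCA HX mulrBr.
rewrite sum_cut_cdiff ?mulr0 // => u.
apply/eqP/negPn/negP => /cjump_neq0 [i [es1 [es2 [E Hc /eqP]]]]; apply.
have Hsub w : in_cube (sh i u) (es1 ++ es2) w -> in_cube u es w.
  by rewrite E; exact: in_cube_shift.
rewrite /X; case: (H _ _ Hc) => [[s [c [Hs Hv]]]|[Hv|[s [c [Hs Hv]]]]].
- rewrite -(cat_take_drop s bs) foldr_cat (drop_nth b Hs) /=.
  apply: cfold_eq0 => v fs Hv' Hfs; apply: (@cjump_const _ _ _ _ c) => w Hw.
  by apply: Hv; apply: Hsub; apply: Hfs.
- apply: cfold_eq0 => v fs Hv' Hfs; rewrite /cmul /f Hv ?subrr ?mul0r //.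
  exact: Hsub.
- apply: cfold_eq0 => v fs Hv' Hfs; rewrite /cmul /ccup.
  rewrite -(cat_take_drop s bs') foldr_cat (drop_nth b Hs) /=.
  rewrite cfold_eq0 ?mulr0 // => v' fs' Hv'' Hfs'; apply: (@cjump_const _ _ _ _ c) => w Hw.
  by apply: Hv; apply: Hsub; apply: Hfs; apply: Hfs'.
Qed.

Lemma cup_homotopy (chi : V -> int) (b b' : nat -> V -> int) m es :
  (forall u i, chi (sh i u) != chi u -> exists s c, (s < m)%N /\
     forall v, in_cube u es v -> b s v = c /\ b' s v = c) ->
  \sum_u chi u * ccup (mkseq b m) u es = \sum_u chi u * ccup (mkseq b' m) u es.
Proof.
move=> H.
(* The factors are exchanged one at a time; the first [r] are already replaced. *)
pose mix r := mkseq b' r ++ [seq b s | s <- iota r (m - r)].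
have Hmix r : (r < m)%N -> \sum_u chi u * ccup (mix r) u es =
   \sum_u chi u * ccup (mix r.+1) u es.
  move=> Hr; rewrite /mix subnS; case: (m - r)%N (subnKC (ltnW Hr)) => [|d] Hd.
    by move: Hr; rewrite -Hd addn0 ltnn.
  rewrite mkseqS cat_rcons /=; apply: cut_step => u i /H [s [c [Hs Hv]]].
  have [Hsr|Hsr|Hsr] := ltngtP s r.
  - left; exists s, c; rewrite size_mkseq; split=> // v /Hv [_ <-].
    by rewrite nth_mkseq.
  - right; right; exists (s - r.+1)%N, c; rewrite size_map size_iota; split; first lia.
    move=> v /Hv [<- _]; rewrite (nth_map 0%N) ?size_iota; last by lia.
    by rewrite nth_iota; [congr b; lia | lia].
  - by right; left => v /Hv; rewrite Hsr => -[-> ->].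
have Hall r : (r <= m)%N -> \sum_u chi u * ccup (mix 0) u es =
   \sum_u chi u * ccup (mix r) u es.
  by elim: r => [|r IH] // Hr; rewrite IH 1?ltnW // Hmix.
have -> : mkseq b m = mix 0%N by rewrite /mix subn0.
have -> : mkseq b' m = mix m by rewrite /mix subnn cats0.
exact: Hall.
Qed.

Lemma cjump_sum i0 b X u es :
  cjump b X u es = \sum_(k < size es) (-1) ^+ k *
    ((b (sh (nth i0 es k) u) - b u) *
      X (sh (nth i0 es k) u) (take k es ++ drop k.+1 es)).
Proof.
elim: es X => [|i es IH] X; first by rewrite /cjump /= big_ord0 mulr0 subr0.
rewrite cjump_cons IH big_ord_recl /= expr0 mul1r ?take0 ?drop0 /=.
congr (_ + _); rewrite -sumrN; apply: eq_bigr => k _.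
by rewrite /bump /= add1n exprS mulN1r mulNr.
Qed.

(** If the increment of each function in a direction does not depend on the steps made before, the
    cup product expands like a determinant along its first row. Listing the directions by an
    injection [f] makes the faces instances of the same statement, with [f \o lift k]. *)
Lemma ccup_det m (f : 'I_m -> 'I_n) (N : nat -> 'I_n -> int) (b : nat -> V -> int) u r :
  (forall s A i, uniq (rcons A i) -> {subset rcons A i <= codom f} ->
     b s (sh i (vtx u A)) - b s (vtx u A) = N s i) -> injective f ->
  ccup [seq b s | s <- iota r m] u [seq f i | i <- enum 'I_m] =
  \det (\matrix_(s < m, k < m) N (r + s)%N (f k)).
Proof.
elim: m f u r => [|m IH] f u r HN finj.
  by rewrite enum_ord0 /= /cone eqxx det_mx00.
rewrite /= (cjump_sum (f ord0)).
set es := [seq f i | i <- enum 'I_m.+1].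
have Hsz : size es = m.+1 by rewrite size_map size_enum_ord.
rewrite (expand_det_row _ ord0).
have Hnth (k : 'I_m.+1) x0 : nth x0 es k = f k.
  by rewrite (nth_map ord0) ?size_enum_ord // nth_ord_enum.
have Hes (k : 'I_m.+1) : take k es ++ drop k.+1 es = [seq f (lift k i) | i <- enum 'I_m].
  apply: (@eq_from_nth _ (f k)).
    rewrite size_cat size_take size_drop size_map !size_enum_ord Hsz ltn_ord.
    by rewrite subSS subnKC // -ltnS.
  move=> i; rewrite size_cat size_take size_drop Hsz ltn_ord subSS subnKC -1?ltnS // => Hi.
  have Hi' : (i < m)%N by rewrite -ltnS.
  rewrite (nth_map (Ordinal Hi')) ?size_enum_ord // nth_cat size_take Hsz ltn_ord.
  rewrite (nth_ord_enum _ (Ordinal Hi')).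
  have -> : f (lift k (Ordinal Hi')) = nth (f k) es (bump k i) by rewrite -(Hnth _ (f k)).
  rewrite /bump; case: (leqP k i) => Hki.
    by rewrite nth_drop; congr nth; lia.
  by rewrite nth_take.
rewrite Hsz; apply: eq_bigr => k _; rewrite Hnth Hes.
rewrite mxE /cofactor /= add0n addn0 mulrCA.
have -> : b r (sh (f k) u) - b r u = N r (f k).
  by apply: (HN r [::] (f k)) => // x; rewrite inE => /eqP ->; exact: codom_f.
congr (_ * (_ * _)).
rewrite (IH (f \o lift k) (sh (f k) u) r.+1).
- congr (\det _); apply/matrixP => s i; rewrite !mxE /=; congr N.
  by rewrite /= /bump /= add1n addSnnS.
- move=> s A i HU HS.
  have := HN s (f k :: A) i; rewrite /= -/(vtx _ _); apply; last first.
    move=> x; rewrite inE => /orP [/eqP ->|/HS /codomP [y ->]]; exact: codom_f.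
  rewrite HU andbT; apply/negP => /HS /codomP [y /= /finj /eqP].
  by rewrite (negbTE (neq_lift _ _)).
- by move=> x y /= /finj /lift_inj.
Qed.

End Cochains.

(** * Connecting invertible matrices to signed permutation matrices *)

Lemma det_le (R : numDomainType) n (M : 'M[R]_n) (B : R) :
  (forall i j, `|M i j| <= B) -> `|\det M| <= n`!%:R * B ^+ n.
Proof.
move=> HM; rewrite /determinant; apply: le_trans (ler_norm_sum _ _ _) _.
apply: le_trans (ler_sum (G := fun _ => B ^+ n) _ _) _.
  move=> s _; rewrite normrM normrX normrN normr1 expr1n mul1r normr_prod.
  rewrite -[n in B ^+ n]card_ord -prodr_const; apply: ler_prod => i _.
  by rewrite normr_ge0 HM.
by rewrite sumr_const card_Sn mulr_natl.
Qed.

Lemma mulmx_lower_bound (R : numFieldType) n (M : 'M[R]_n.+1) (B d : R) (x : 'rV[R]_n.+1) i :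
  (forall i j, `|M i j| <= B) -> 0 < d -> d <= `|\det M| -> 0 <= B ->
  d * `|x 0 i| <= (n`!%:R * B ^+ n) * \sum_s `|(x *m M) 0 s|.
Proof.
move=> HM d0 Hd HB.
have E : x 0 i * \det M = \sum_s (x *m M) 0 s * (\adj M) s i.
  have : (x *m M *m \adj M) 0 i = (x *m (\det M)%:M) 0 i.
    by rewrite -mulmxA mul_mx_adj.
  by rewrite mul_mx_scalar !mxE => ->; rewrite mulrC.
apply: (@le_trans _ _ (`|x 0 i * \det M|)).
  by rewrite normrM mulrC ler_wpM2l.
rewrite E mulr_sumr; apply: le_trans (ler_norm_sum _ _ _) _.
apply: ler_sum => s _; rewrite normrM mulrC ler_wpM2r //.
rewrite mxE /cofactor normrM normrX normrN normr1 expr1n mul1r.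
by apply: det_le => a b; rewrite !mxE.
Qed.

(** In an LUP decomposition the factor L is moved linearly to the identity and U to the diagonal of
    its signs. Both stay triangular and no diagonal entry crosses 0, so the determinant stays away
    from 0, which gives [c]. The entries are quadratic in the parameter, which gives [B]. *)
Lemma GL_path (R : realFieldType) n (A : 'M[R]_n.+1) : \det A != 0 ->
  exists (P : R -> 'M[R]_n.+1) (sg : 'S_n.+1) (d : 'I_n.+1 -> R) (c B : R),
  [/\ 0 < c, 0 <= B & [/\ P 0 = A,
      P 1 = \matrix_(i, s) ((i == sg s)%:R * d s),
      forall s, d s = 1 \/ d s = -1,
      sgz (\det A) = (-1) ^+ sg * \prod_s sgz (d s) &
      (forall (t t' : R) i s, 0 <= t <= 1 -> 0 <= t' <= 1 ->
         `|P t i s - P t' i s| <= B * `|t - t'|) /\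
      (forall (t : R) (x : 'rV[R]_n.+1) i, 0 <= t <= 1 ->
         c * `|x 0 i| <= \sum_s `|(x *m P t) 0 s|)]].
Proof.
move=> HA.
have := cormen_lup_perm A; have := cormen_lup_correct A; have := cormen_lup_detL A.
have := @cormen_lup_lower _ n A; have := @cormen_lup_upper _ n A.
case: (cormen_lup A) => [[Q L] U] /= HU HL HdL HQ /is_perm_mxP [sg HQs].
rewrite -!mulmxE in HQ.
have HU0 i : U i i != 0.
  have : \det L * \det U != 0.
    by rewrite -det_mulmx -HQ det_mulmx mulf_neq0 // HQs det_perm signr_eq0.
  rewrite HdL mul1r -det_tr det_trig.
    by move/prodf_neq0 => /(_ i isT); rewrite mxE.
  by apply/is_trig_mxP => a b Hab; rewrite mxE HU.
pose dd i := Num.sg (U i i).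
pose D : 'M[R]_n.+1 := \matrix_(i, j) ((i == j)%:R * dd i).
pose Lt (t : R) := L + t *: (1%:M - L).
pose Ut (t : R) := U + t *: (D - U).
pose P t := Q^T *m (Lt t *m Ut t).
pose M0 := Q^T *m (L *m U).
pose M1 := Q^T *m (L *m (D - U) + (1%:M - L) *m U).
pose M2 := Q^T *m ((1%:M - L) *m (D - U)).
have HP t : P t = M0 + t *: M1 + t ^+ 2 *: M2.
  have E : Lt t *m Ut t = L *m U + t *: (L *m (D - U) + (1%:M - L) *m U) +
      t ^+ 2 *: ((1%:M - L) *m (D - U)).
    rewrite /Lt /Ut mulmxDl 2!(mulmxDr _ U) -!scalemxAl -!scalemxAr scalerA scalerDr.
    by rewrite expr2 !addrA.
  by rewrite /P E mulmxDr (mulmxDr _ (L *m U)) -!scalemxAr.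
have HPe t i s : P t i s = M0 i s + t * M1 i s + t ^+ 2 * M2 i s.
  by rewrite HP; move: (M0) (M1) (M2) => N0 N1 N2; rewrite !mxE.
pose B := \sum_i \sum_j (`|M0 i j| + `|M1 i j| + 2 * `|M2 i j|).
have B0 : 0 <= B by apply: sumr_ge0 => i _; apply: sumr_ge0 => j _; rewrite !addr_ge0 ?mulr_ge0.
have HB i j : `|M0 i j| + `|M1 i j| + 2 * `|M2 i j| <= B.
  rewrite /B (bigD1 i) //= (bigD1 j) //= -[leRHS]addrA lerDl addr_ge0 //.
    by apply: sumr_ge0 => a _; rewrite !addr_ge0 ?mulr_ge0.
  by apply: sumr_ge0 => a _; apply: sumr_ge0 => b _; rewrite !addr_ge0 ?mulr_ge0.
have Hent t i j : 0 <= t <= 1 -> `|P t i j| <= B.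
  move=> /andP [t0 t1]; apply: le_trans (HB i j); rewrite HPe.
  apply: le_trans (ler_normD _ _) _; apply: lerD.
    apply: le_trans (ler_normD _ _) _; rewrite lerD2l normrM ler_piMl //.
    by rewrite ger0_norm.
  rewrite normrM ger0_norm ?exprn_ge0 // ler_wpM2r //.
  by nra.
(* Lower bound for the absolute value of the i-th diagonal entry on its way from [U i i] to its
   sign. *)
pose u i := Num.min `|U i i| 1.
have Hu i : 0 < u i by rewrite /u lt_min normr_gt0 HU0 ltr01.
have Hdet t : \det (P t) = (-1) ^+ sg * \prod_i (U i i + t * (dd i - U i i)).
  rewrite /P 2!det_mulmx det_tr HQs det_perm; congr (_ * _).
  have -> : \det (Lt t) = 1.
    rewrite det_trig; last first.
      apply/is_trig_mxP => i j Hij; rewrite !mxE HL ?(ltnW Hij) //.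
      by rewrite (negbTE (_ : i != j)) ?subrr ?mulr0 ?addr0 // neq_ltn Hij.
    rewrite big1 // => i _; rewrite !mxE HL // eqxx mulr1n; ring.
  rewrite mul1r -det_tr det_trig.
    by apply: eq_bigr => i _; rewrite !mxE eqxx mul1r.
  apply/is_trig_mxP => i j Hij; rewrite !mxE HU //.
  by rewrite (negbTE (_ : j != i)) ?mul0r ?subrr ?mulr0 ?addr0 // neq_ltn Hij orbT.
pose c1 := \prod_i u i.
have c10 : 0 < c1 by apply: prodr_gt0.
have Hc1 t : 0 <= t <= 1 -> c1 <= `|\det (P t)|.
  move=> /andP [t0 t1]; rewrite Hdet normrM normrX normrN normr1 expr1n mul1r normr_prod.
  apply: ler_prod => i _; rewrite ltW //= /dd.
  have u1 : u i <= 1 by rewrite /u ge_min lexx orbT.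
  have u2 : u i <= `|U i i| by rewrite /u ge_min lexx.
  have := HU0 i; case: (sgrP (U i i)) u2 => // Ui u2 _.
    by rewrite ger0_norm; nra.
  by rewrite ler0_norm; nra.
pose K := n`!%:R * B ^+ n + 1.
have K0 : 0 < K by rewrite ltr_wpDl // mulr_ge0 ?ler0n ?exprn_ge0.
exists P, sg, dd, (c1 / K), B; split; [by rewrite divr_gt0 | by [] |].
have P0 : P 0 = A.
  rewrite HP scale0r expr0n /= scale0r !addr0 /M0 -HQ mulmxA HQs.
  by rewrite tr_perm_mx -perm_mxM fingroup.mulVg perm_mx1 mul1mx.
split=> //.
- rewrite /P /Lt /Ut !scale1r [L + _]addrC [U + _]addrC !subrK mul1mx; apply/matrixP => i s.
  rewrite !mxE (bigD1 s) //= big1 ?addr0; last first.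
    by move=> j /negbTE Hj; rewrite !mxE Hj mul0r mulr0.
  by rewrite HQs !mxE eqxx mul1r eq_sym; congr (_ %:R * _); rewrite eq_sym.
- move=> s; rewrite /dd; have := HU0 s; case: (sgrP (U s s)) => // _ _; [by left | by right].
- rewrite -P0 Hdet sgzM; congr (_ * _).
    by case: (odd_perm sg); rewrite ?expr1 ?expr0 ?sgzN1 ?sgz1.
  rewrite (big_morph _ (@sgzM R) (@sgz1 R)); apply: eq_bigr => i _.
  by rewrite mul0r addr0 /dd; case: (sgrP (U i i)) (HU0 i) => // H _; rewrite ?sgzN1 ?sgz1 ?(gtr0_sgz H) ?(ltr0_sgz H).
split.
- move=> t t' i s /andP [t0 t1] /andP [t'0 t'1]; rewrite !HPe.
  have -> : M0 i s + t * M1 i s + t ^+ 2 * M2 i s -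
    (M0 i s + t' * M1 i s + t' ^+ 2 * M2 i s) = (M1 i s + (t + t') * M2 i s) * (t - t').
    by ring.
  rewrite normrM ler_wpM2r //; apply: le_trans (HB i s).
  rewrite -addrA; apply: ler_wpDl => //; apply: le_trans (ler_normD _ _) _.
  by rewrite lerD2l normrM ler_wpM2r // ger0_norm ?addr_ge0 //; lra.
- move=> t x i Ht; rewrite mulrAC ler_pdivrMr //.
  apply: le_trans (mulmx_lower_bound x i (fun a b => Hent t a b Ht) c10 (Hc1 t Ht) B0) _.
  by rewrite mulrC ler_wpM2l ?sumr_ge0 // /K; lra.
Qed.

(** * Combinatorial degree on a periodic lattice *)

(** The coordinates wrap around, which makes the shifts bijective; cutoffs will be kept away from
    the seam, where a step jumps from [H] to 0. *)
Definition torus (n H : nat) : finType := {ffun 'I_n -> 'I_H.+1}.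

Definition tsh n H (i : 'I_n) (u : torus n H) : torus n H :=
  [ffun j => if j == i then ordS (u j) else u j].

Lemma tshC n H i j (u : torus n H) : tsh i (tsh j u) = tsh j (tsh i u).
Proof. by apply/ffunP => x; rewrite !ffunE; case: (x == i); case: (x == j). Qed.

Lemma tsh_inj n H i : injective (@tsh n H i).
Proof.
move=> u v /ffunP E; apply/ffunP => j; move: (E j); rewrite !ffunE.
by case: (j == i) => // /ordS_inj.
Qed.

(** Discrete form of the integral of a pulled back volume form: the cup product plays the form and
    [chi] selects the region. *)
Definition tdeg n H (chi : torus n H -> int) (b : 'I_n -> torus n H -> int) : int :=
  \sum_u chi u * ccup (@tsh n H) [seq b s | s <- enum 'I_n] u (enum 'I_n).

Definition in_cell n H (u v : torus n H) := forall i, (u i <= v i <= (u i).+1)%N.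

Lemma tsh_val n H i (u : torus n H) j : (u i < H)%N ->
  tsh i u j = (u j + (j == i))%N :> nat.
Proof.
move=> Hi; rewrite ffunE; case: eqP => [->|_]; last by rewrite addn0.
by rewrite /= modn_small ?addn1 // ltnS.
Qed.

Lemma torus_lt n H (w : torus n H) j : (w j : nat) <> H -> (w j < H)%N.
Proof. by move: (ltn_ord (w j)); rewrite ltnS leq_eqVlt => /orP [/eqP|]. Qed.

Lemma vtx_notin n H (u : torus n H) A i : i \notin A -> vtx (@tsh n H) u A i = u i.
Proof.
elim: A u => [|j A IH] u //=; rewrite inE negb_or => /andP [Hij HA].
by rewrite -/(vtx _ _ _) IH // ffunE (negbTE Hij).
Qed.

Lemma vtx_val n H (u : torus n H) A : uniq A -> {in A, forall i, (u i < H)%N} ->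
  forall i, vtx (@tsh n H) u A i = (u i + (i \in A))%N :> nat.
Proof.
elim: A u => [|j A IH] u /=; first by move=> _ _ i; rewrite addn0.
move=> /andP [Hj HA] Hlt i; rewrite -/(vtx _ _ _) IH //; last first.
  move=> x Hx; rewrite ffunE; case: eqP => [E|_]; first by rewrite -E Hx in Hj.
  by apply: Hlt; rewrite inE Hx orbT.
rewrite tsh_val; last by apply: Hlt; rewrite mem_head.
by rewrite inE -addnA; congr addn; case: eqP => [->|]; rewrite ?(negbTE Hj) ?addn0.
Qed.

Lemma in_cube_cell n H (u v : torus n H) : (forall i, (u i < H)%N) ->
  in_cube (@tsh n H) u (enum 'I_n) v -> in_cell u v.
Proof.
move=> Hu [A [B [HAB ->]]] i; rewrite vtx_val //; last first.
  have : uniq (A ++ B) by rewrite (perm_uniq HAB) enum_uniq.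
  by rewrite cat_uniq => /andP [].
by case: (i \in A); rewrite ?addn0 ?addn1 !leqnn ?leqnSn.
Qed.

Lemma tdeg_homotopy n H (chi : torus n H -> int) (b b' : 'I_n -> torus n H -> int) :
  (forall u i, chi (tsh i u) != chi u -> (forall j, (u j < H)%N) /\
     exists s c, forall v, in_cell u v -> b s v = c /\ b' s v = c) ->
  tdeg chi b = tdeg chi b'.
Proof.
move=> Hc; pose ex (f : 'I_n -> torus n H -> int) (s : nat) :=
  if insub s is Some i then f i else fun _ => 0.
have E (f : 'I_n -> torus n H -> int) : [seq f s | s <- enum 'I_n] = mkseq (ex f) n.
  rewrite /mkseq -val_enum_ord -map_comp; apply: eq_map => i /=.
  by rewrite /ex valK.
rewrite /tdeg !E; apply: cup_homotopy; [exact: tshC | exact: tsh_inj |].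
move=> u i /Hc [Hu [s [c Hs]]]; exists s, c; split; first exact: ltn_ord.
by move=> v /(in_cube_cell Hu) /Hs; rewrite /ex valK.
Qed.

Lemma sum_ge_ex (R : realFieldType) n (f : 'I_n.+1 -> R) C :
  C <= \sum_s f s -> exists s, C / n.+1%:R <= f s.
Proof.
move=> HC; apply: contrapT => Hn.
have Hlt s : f s < C / n.+1%:R by rewrite ltNge; apply/negP => Hs; apply: Hn; exists s.
have : \sum_s f s < \sum_(s < n.+1) C / n.+1%:R.
  by rewrite !big_ord_recl; apply: ltr_leD => //; apply: ler_sum => i _; exact: ltW.
rewrite sumr_const card_ord -[ltRHS]mulr_natr divfK ?pnatr_eq0 // => /(le_lt_trans HC).
by rewrite ltxx.
Qed.

(** * Lattice degree of a map near a zero: deformation to a signed permutation matrix *)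

Section LocalDegree.
Variable R : realType.

Definition pbit (x : R) : int := (0 < x)%R%:R.

Definition tpos n H (dl : R) (u : torus n H) : 'rV[R]_n := \row_i (dl * (u i)%:R).

Definition tbox n H (dl rho : R) (x0 : 'rV[R]_n) (u : torus n H) : int :=
  [forall i, `|tpos dl u 0 i - x0 0 i| <= rho]%:R.

Lemma tboxP n H (dl rho : R) (x0 : 'rV[R]_n) (u : torus n H) :
  reflect (forall i, `|tpos dl u 0 i - x0 0 i| <= rho) (tbox dl rho x0 u != 0).
Proof.
rewrite /tbox; case: (boolP [forall i, _]) => [/forallP H'|H']; constructor => //.
by move=> H''; case/negP: H'; apply/forallP.
Qed.

(** The cutoff changes only at points within [dl] of the boundary of the box, so a common constant
    sign is required on this shell alone. The margins [2 * dl] keep the box off the seam. *)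
Lemma box_homotopy n H (dl rho : R) (x0 : 'rV[R]_n) (g g' : torus n H -> 'rV[R]_n) :
  0 < dl -> (forall i, rho + 2 * dl <= x0 0 i) ->
  (forall i, x0 0 i + rho + 2 * dl <= dl * H%:R) ->
  (forall u, (forall j, `|tpos dl u 0 j - x0 0 j| <= rho + dl) ->
     (exists j, rho - dl <= `|tpos dl u 0 j - x0 0 j|) ->
     exists s c, forall v, in_cell u v -> pbit (g v 0 s) = c /\ pbit (g' v 0 s) = c) ->
  tdeg (tbox dl rho x0) (fun s u => pbit (g u 0 s)) =
  tdeg (tbox dl rho x0) (fun s u => pbit (g' u 0 s)).
Proof.
move=> dl0 Hlo Hhi Hs; apply: tdeg_homotopy => u i Hne.
have Hfar (w : torus n H) : tbox dl rho x0 w != 0 -> forall j, (w j < H)%N.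
  move=> /tboxP Hw j; apply: torus_lt => E.
  have := Hw j; rewrite mxE E ler_norml; have := Hhi j; move: (dl * _) => z; lra.
have Hfar0 (w : torus n H) j : tbox dl rho x0 w != 0 -> w j != 0%N :> nat.
  move=> /tboxP Hw; apply/eqP => E.
  have := Hw j; rewrite mxE E ler_norml; have := Hlo j; rewrite mulr0; lra.
have Hui : (u i < H)%N.
  apply: torus_lt => E.
  have H1 : tbox dl rho x0 u = 0.
    by apply/eqP/negPn/negP => /Hfar /(_ i); rewrite E ltnn.
  have H2 : tbox dl rho x0 (tsh i u) = 0.
    apply/eqP/negPn/negP => /(Hfar0 _ i); rewrite ffunE eqxx /= E modnn eqxx //.
  by rewrite H1 H2 eqxx in Hne.
have Hpos j : tpos dl (tsh i u) 0 j = tpos dl u 0 j + dl * (j == i)%:R.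
  by rewrite !mxE tsh_val // natrD mulrDr.
have [w [Hw Hwu]] : exists w : torus n H, tbox dl rho x0 w != 0 /\ forall j, j != i -> w j = u j.
  have [H0|H0] := eqVneq (tbox dl rho x0 u) 0.
    exists (tsh i u); split; last by move=> j Hj; rewrite ffunE (negbTE Hj).
    by apply: contra Hne => /eqP ->; rewrite H0.
  by exists u.
have Hu j : (u j < H)%N.
  by have [->//|Hj] := eqVneq j i; rewrite -Hwu //; apply: Hfar.
have Hclose : forall j, `|tpos dl u 0 j - x0 0 j| <= rho + dl.
  move=> j; have [->|Hj] := eqVneq j i; last first.
    by have /tboxP /(_ j) := Hw; rewrite [X in X - _]mxE Hwu // mxE; lra.
  have [H0|/tboxP /(_ i)] := eqVneq (tbox dl rho x0 u) 0; last lra.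
  have : tbox dl rho x0 (tsh i u) != 0 by apply: contra Hne => /eqP ->; rewrite H0.
  move=> /tboxP /(_ i); rewrite Hpos eqxx mulr1 !ler_norml; lra.
split=> //; apply: Hs => //.
apply: contrapT => Hn.
have Hin j : `|tpos dl u 0 j - x0 0 j| < rho - dl.
  by rewrite ltNge; apply/negP => H1; apply: Hn; exists j.
have H1 : tbox dl rho x0 u = 1.
  rewrite /tbox; case: forallP => // -[] j; have := Hin j; lra.
have H2 : tbox dl rho x0 (tsh i u) = 1.
  rewrite /tbox; case: forallP => // -[] j; have := Hin j; rewrite Hpos.
  case: (j == i); rewrite ?mulr1 ?mulr0 ?addr0; last lra.
  rewrite ltr_norml ler_norml; lra.
by rewrite H1 H2 eqxx in Hne.
Qed.

Lemma pbit_pos (x : R) : 0 < x -> pbit x = 1. Proof. by rewrite /pbit => ->. Qed.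
Lemma pbit_neg (x : R) : x <= 0 -> pbit x = 0. Proof. by rewrite /pbit leNgt => /negbTE ->. Qed.

Lemma pbit_close (x y : R) : `|y - x| < `|x| -> pbit y = pbit x.
Proof.
have [Hx|Hx] := ltrP 0 x.
  rewrite (gtr0_norm Hx) ltr_norml => H; rewrite !pbit_pos //; lra.
rewrite (ler0_norm Hx) ltr_norml => H; rewrite !pbit_neg //; lra.
Qed.

Lemma mulmx_entry_le n (x : 'rV[R]_n) (M : 'M[R]_n) a B s :
  (forall i, `|x 0 i| <= a) -> (forall i, `|M i s| <= B) -> 0 <= a ->
  `|(x *m M) 0 s| <= n%:R * (a * B).
Proof.
move=> Hx HM a0; rewrite mxE; apply: le_trans (ler_norm_sum _ _ _) _.
have -> : n%:R * (a * B) = \sum_(i < n) a * B by rewrite sumr_const card_ord mulr_natl.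
by apply: ler_sum => i _; rewrite normrM; apply: ler_pM.
Qed.

(** On the shell some component of the image under [M] is at least [c * rho / 2 / n.+1]. The two
    terms on the left of the last hypothesis bound its variation over a cell and its change from [M]
    to [M'], so its sign is constant. *)
Lemma linear_homotopy n H (dl rho : R) (x0 : 'rV[R]_n.+1) (M M' : 'M[R]_n.+1) (c B e : R) :
  0 < dl -> (forall i, rho + 2 * dl <= x0 0 i) ->
  (forall i, x0 0 i + rho + 2 * dl <= dl * H%:R) ->
  0 <= B -> 0 <= e ->
  (forall i s, `|M i s| <= B) -> (forall i s, `|M i s - M' i s| <= e) ->
  (forall (x : 'rV[R]_n.+1) i, c * `|x 0 i| <= \sum_s `|(x *m M) 0 s|) ->
  0 < c -> 2 * dl <= rho ->
  n.+1%:R * (dl * B) + n.+1%:R * ((2 * rho) * e) < c * rho / 2 / n.+1%:R ->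
  tdeg (tbox (H := H) dl rho x0) (fun s u => pbit (((tpos dl u - x0) *m M) 0 s)) =
  tdeg (tbox (H := H) dl rho x0) (fun s u => pbit (((tpos dl u - x0) *m M') 0 s)).
Proof.
move=> dl0 Hlo Hhi B0 e0 HB He Hc c0 Hdl Hsm; apply: box_homotopy => // u Hu [j Hj].
have : c * rho / 2 <= \sum_s `|((tpos dl u - x0) *m M) 0 s|.
  apply: le_trans (Hc _ j); rewrite -mulrA ler_pM2l //.
  by rewrite mxE [(- x0) _ _]mxE; lra.
move=> /sum_ge_ex [s Hs]; exists s, (pbit (((tpos dl u - x0) *m M) 0 s)) => v Huv.
have Hvu i : `|(tpos dl v - tpos dl u) 0 i| <= dl.
  rewrite !mxE -mulrBr normrM gtr0_norm // -[leRHS]mulr1 ler_pM2l //.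
  have /andP [H1 H2] := Huv i.
  by rewrite -natrB // ger0_norm ?ler0n // lern1 leq_subLR addn1.
have Ev : tpos dl v - x0 = (tpos dl u - x0) + (tpos dl v - tpos dl u).
  by rewrite [RHS]addrC addrA subrK.
have H1 : `|((tpos dl v - tpos dl u) *m M) 0 s| <= n.+1%:R * (dl * B).
  by apply: mulmx_entry_le => //; exact: ltW.
have H2 : `|((tpos dl v - x0) *m (M - M')) 0 s| <= n.+1%:R * ((2 * rho) * e).
  apply: mulmx_entry_le; [|by move=> i; rewrite 2!mxE; exact: He|lra].
  move=> i; have h1 := Hu i; have h2 := Hvu i; rewrite Ev.
  rewrite [X in `|X|]mxE; apply: le_trans (ler_normD _ _) _.
  have -> : (tpos dl u - x0) 0 i = tpos dl u 0 i - x0 0 i.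
    by rewrite [LHS]mxE [X in _ + X]mxE.
  lra.
have E1 : ((tpos dl v - x0) *m M) 0 s - ((tpos dl u - x0) *m M) 0 s =
    ((tpos dl v - tpos dl u) *m M) 0 s.
  have -> : tpos dl v - tpos dl u = (tpos dl v - x0) - (tpos dl u - x0).
    by rewrite opprB addrA subrK.
  move: (tpos dl v - x0) (tpos dl u - x0) => p q.
  by rewrite mulmxBl; move: (p *m M) (q *m M) => a b; rewrite !mxE.
have E2 : ((tpos dl v - x0) *m M') 0 s = ((tpos dl v - x0) *m M) 0 s -
    ((tpos dl v - x0) *m (M - M')) 0 s.
  have -> : ((tpos dl v - x0) *m (M - M')) 0 s =
      ((tpos dl v - x0) *m M) 0 s - ((tpos dl v - x0) *m M') 0 s.
    move: (tpos dl v - x0) => p.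
    by rewrite mulmxBr; move: (p *m M) (p *m M') => a b; rewrite !mxE.
  by rewrite opprB [RHS]addrC subrK.
have n0 : 0 <= n.+1%:R * (dl * B) by rewrite !mulr_ge0 // ltW.
have n1 : 0 <= n.+1%:R * ((2 * rho) * e) by rewrite !mulr_ge0 //; lra.
split; apply: pbit_close; apply: lt_le_trans (_ : c * rho / 2 / n.+1%:R <= _) => //.
  by rewrite E1; apply: le_lt_trans H1 _; apply: le_lt_trans Hsm; rewrite lerDl.
rewrite E2 addrAC E1; apply: le_lt_trans (ler_normB _ _) _.
exact: le_lt_trans (lerD H1 H2) Hsm.
Qed.

Lemma linear_path n (A : 'M[R]_n.+1) : \det A != 0 ->
  exists (sg : 'S_n.+1) (d : 'I_n.+1 -> R),
  [/\ forall s, d s = 1 \/ d s = -1,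
      sgz (\det A) = (-1) ^+ sg * \prod_s sgz (d s) &
   forall (rho : R), 0 < rho -> exists d0 : R, 0 < d0 /\
   forall H (dl : R) (x0 : 'rV[R]_n.+1),
     0 < dl -> dl <= d0 -> (forall i, rho + 2 * dl <= x0 0 i) ->
     (forall i, x0 0 i + rho + 2 * dl <= dl * H%:R) ->
     tdeg (tbox (H := H) dl rho x0) (fun s u => pbit (((tpos dl u - x0) *m A) 0 s)) =
     tdeg (tbox (H := H) dl rho x0)
       (fun s u => pbit (((tpos dl u - x0) *m
           \matrix_(i, s) ((i == sg s)%:R * d s)) 0 s))].
Proof.
move=> /GL_path [P [sg [d [c [B [c0 B0 [P0 P1 Hd Hsg [HL Hlow]]]]]]]].
exists sg, d; split=> // rho rho0.
pose C := \sum_i \sum_j `|A i j| + B.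
have C0 : 0 <= C by rewrite addr_ge0 // sumr_ge0 // => i _; rewrite sumr_ge0.
have HC t i s : 0 <= t <= 1 -> `|P t i s| <= C.
  move=> Ht; have := HL t 0 i s Ht; rewrite lexx ler01 P0 subr0 => /(_ isT) Hl.
  have HA : `|A i s| <= \sum_i \sum_j `|A i j|.
    rewrite (bigD1 i) //= (bigD1 s) //= -addrA lerDl addr_ge0 ?sumr_ge0 //.
    by move=> a _; rewrite sumr_ge0.
  have -> : P t i s = A i s + (P t i s - A i s) by rewrite addrC subrK.
  apply: le_trans (ler_normD _ _) _; apply: lerD => //.
  by apply: le_trans Hl _; rewrite ler_piMr // ger0_norm; case/andP: Ht.
pose kap := c * rho / 2 / n.+1%:R.
have kap0 : 0 < kap by rewrite !divr_gt0 ?mulr_gt0.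
(* Number of steps along the path. Passing to the next matrix uses up half of the margin [kap], and
   the bound on [dl] below keeps the variation over a cell within a quarter. *)
pose N := (Num.truncn (n.+1%:R * ((2 * rho) * B) * 2 / kap)).+1.
have HN : n.+1%:R * ((2 * rho) * (B / N%:R)) < kap / 2.
  have := truncnS_gt (n.+1%:R * ((2 * rho) * B) * 2 / kap).
  rewrite -/N ltr_pdivrMr // => h.
  have -> : n.+1%:R * ((2 * rho) * (B / N%:R)) = n.+1%:R * ((2 * rho) * B) / N%:R.
    by rewrite !mulrA.
  rewrite ltr_pdivrMr ?ltr0n //.
  by move: h; set X := n.+1%:R * _; set z := N%:R; clearbody X z; lra.
exists (Num.min (rho / 2) (kap / 4 / (n.+1%:R * (C + 1)))); split.
  by rewrite lt_min !divr_gt0 // mulr_gt0 // ltr_wpDl.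
move=> H dl x0 dl0; rewrite le_min => /andP [Hdl1 Hdl2] Hlo Hhi.
have Hstep m : (m < N)%N ->
  tdeg (tbox (H := H) dl rho x0) (fun s u => pbit (((tpos dl u - x0) *m P (m%:R / N%:R)) 0 s)) =
  tdeg (tbox (H := H) dl rho x0) (fun s u => pbit (((tpos dl u - x0) *m P (m.+1%:R / N%:R)) 0 s)).
  move=> Hm.
  have N0 : 0 < N%:R :> R by rewrite ltr0n.
  have Ht1 : 0 <= (m%:R / N%:R : R) <= 1.
    by rewrite divr_ge0 ?ler0n //= ler_pdivrMr // mul1r ler_nat ltnW.
  have Ht2 : 0 <= (m.+1%:R / N%:R : R) <= 1.
    by rewrite divr_ge0 ?ler0n //= ler_pdivrMr // mul1r ler_nat.
  apply: (@linear_homotopy _ _ _ _ _ _ _ c C (B / N%:R)) => //.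
  - by rewrite divr_ge0 // ler0n.
  - by move=> i s; apply: HC.
  - move=> i s; apply: le_trans (HL _ _ i s Ht1 Ht2) _; rewrite ler_wpM2l //.
    rewrite -mulrBl normrM distrC -natrB // subSnn normr1 mul1r ger0_norm //.
    by rewrite invr_ge0 ler0n.
  - by move=> x i; apply: Hlow.
  - lra.
  have : n.+1%:R * (dl * C) <= kap / 4.
    move: Hdl2; rewrite ler_pdivlMr ?mulr_gt0 // ?ltr_wpDl // => h.
    apply: le_trans h; rewrite mulrCA ler_pM2l // ler_pM2l //; lra.
  rewrite -/kap => h; lra.
have Hall m : (m <= N)%N ->
  tdeg (tbox (H := H) dl rho x0) (fun s u => pbit (((tpos dl u - x0) *m P 0) 0 s)) =
  tdeg (tbox (H := H) dl rho x0) (fun s u => pbit (((tpos dl u - x0) *m P (m%:R / N%:R)) 0 s)).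
  elim: m => [|m IH] Hm; first by rewrite mul0r.
  by rewrite IH 1?ltnW // Hstep.
have := Hall N (leqnn N).
by rewrite divff ?pnatr_eq0 // P0 P1.
Qed.

End LocalDegree.

(** * Lattice degree of a signed permutation matrix, and hence of every invertible matrix *)

Section SignedPermutation.
Variable R : realType.

Lemma pbit_scale (a x : R) : 0 < a -> pbit (a * x) = pbit x.
Proof. by move=> a0; rewrite /pbit pmulr_rgt0. Qed.

Lemma unit_crossing (d y : R) : d = 1 \/ d = -1 -> 0 < y ->
  exists m : nat, forall m' : nat,
    pbit (d * (m'.+1%:R - y)) - pbit (d * (m'%:R - y)) = (m' == m)%:R * sgz d.
Proof.
move=> [->|->] y0.
- exists (Num.truncn y) => m'; rewrite sgz1 mulr1 !mul1r eq_sym (truncn_eq _ (ltW y0)).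
  rewrite /pbit !subr_gt0 leNgt.
  case: (ltrP y m'%:R) => /= H1.
    by rewrite (lt_trans H1) ?ltr_nat // subrr.
  by case: (ltrP y m'.+1%:R) => H2; rewrite subr0.
(* For [d = -1] the indicator is that of the points strictly below [y]; when [y] is an integer it
   drops on the edge that ends at [y]. *)
- pose m := if (Num.truncn y)%:R == y then (Num.truncn y).-1 else Num.truncn y.
  have /andP [Ha Hb] : m%:R < y <= m.+1%:R.
    have /andP [H1 H2] := truncn_itv (ltW y0); rewrite /m.
    case: eqP => E; last by rewrite lt_neqAle H1 (ltW H2) !andbT; apply/eqP.
    have t0 : (0 < Num.truncn y)%N by rewrite lt0n; apply/eqP => E0; rewrite -E E0 ltxx in y0.
    by rewrite prednK // E lexx andbT -{2}E ltr_nat prednK.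
  exists m => m'; rewrite sgzN1 mulrN1 !mulN1r !opprB /pbit !subr_gt0.
  case: (ltngtP m' m) => Hm.
  + have H1 : m'.+1%:R < y by apply: le_lt_trans Ha; rewrite ler_nat.
    by rewrite H1 (lt_trans _ H1) ?ltr_nat // subrr oppr0.
  + have H1 : y <= m'%:R by apply: le_trans Hb _; rewrite ler_nat.
    have -> : (m'.+1%:R < y) = false.
      by apply/negbTE; rewrite -leNgt; apply: le_trans H1 _; rewrite ler_nat.
    by rewrite ltNge H1 subrr oppr0.
  + by rewrite Hm Ha ltNge Hb sub0r.
Qed.

Lemma map_enum_ord_iota T n (f : 'I_n -> T) (g : nat -> T) :
  (forall i, g (nat_of_ord i) = f i) ->
  [seq f s | s <- enum 'I_n] = [seq g s | s <- iota 0 n].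
Proof. by move=> H; rewrite -val_enum_ord -map_comp; apply: eq_map => i /=. Qed.

(** Each indicator depends on a single coordinate and flips on exactly one edge of that axis. So a
    single cube [u0] of the box contributes, and its increments form a signed permutation matrix. *)
Lemma signed_perm_degree n H (dl rho : R) (x0 : 'rV[R]_n) (sg : 'S_n) (d : 'I_n -> R) :
  0 < dl -> dl <= rho -> (forall i, rho + 2 * dl <= x0 0 i) ->
  (forall i, x0 0 i + rho + 2 * dl <= dl * H%:R) ->
  (forall s, d s = 1 \/ d s = -1) ->
  tdeg (tbox (H := H) dl rho x0) (fun s u => pbit (((tpos dl u - x0) *m
           \matrix_(i, s) ((i == sg s)%:R * d s)) 0 s)) =
  (-1) ^+ sg * \prod_s sgz (d s).
Proof.
move=> dl0 Hdl Hlo Hhi Hd.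
have x0pos i : 0 < x0 0 i / dl by rewrite divr_gt0 //; have := Hlo i; lra.
have [mm Hmm] : exists mm : 'I_n -> nat, forall s (m' : nat),
    pbit (d s * (m'.+1%:R - x0 0 (sg s) / dl)) - pbit (d s * (m'%:R - x0 0 (sg s) / dl))
      = (m' == mm s)%:R * sgz (d s).
  have /choice [mm Hmm] : forall s, exists m : nat, forall m' : nat,
    pbit (d s * (m'.+1%:R - x0 0 (sg s) / dl)) - pbit (d s * (m'%:R - x0 0 (sg s) / dl))
      = (m' == m)%:R * sgz (d s).
    by move=> s; apply: unit_crossing.
  by exists mm.
have Hmx s (m : nat) : m = mm s -> `|dl * m%:R - x0 0 (sg s)| <= dl.
  move=> Em; have := Hmm s m; rewrite Em eqxx mul1r -Em.
  have E : x0 0 (sg s) = dl * (x0 0 (sg s) / dl) by rewrite mulrC divfK // gt_eqF.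
  rewrite {3}E -mulrBr normrM gtr0_norm // -[leRHS]mulr1 ler_pM2l //.
  rewrite mulrSr; move: (x0 0 (sg s) / dl) (m%:R : R) => y z Hz.
  rewrite ler_norml; move: Hz.
  case: (Hd s) => ->; rewrite ?sgz1 ?sgzN1 ?mul1r ?mulN1r ?opprB /pbit !subr_gt0.
    by case: (ltrP y z); case: (ltrP y (z + 1)) => // h1 h2 _; lra.
  by case: (ltrP z y); case: (ltrP (z + 1) y) => // h1 h2 _; lra.
pose b s (u : torus n H) := pbit (d s * (dl * (u (sg s))%:R - x0 0 (sg s))).
have Eb : (fun s (u : torus n H) => pbit (((tpos dl u - x0) *m
           \matrix_(i, s) ((i == sg s)%:R * d s)) 0 s)) = b.
  apply/funext => s; apply/funext => u; rewrite /b mxE (bigD1 (sg s)) //= big1 ?addr0.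
    by rewrite !mxE eqxx mul1r mulrC.
  by move=> i /negbTE Hi; rewrite !mxE Hi mul0r mulr0.
rewrite Eb /tdeg.
pose w s (u : torus n H) := pbit (d s * (dl * (ordS (u (sg s)))%:R - x0 0 (sg s))) - b s u.
have Hcup u : ccup (@tsh n H) [seq b s | s <- enum 'I_n] u (enum 'I_n) =
    (-1) ^+ sg * \prod_s w s u.
  pose ex (s : nat) := if insub s is Some i then b i else fun _ => 0.
  rewrite (@map_enum_ord_iota _ _ b ex); last by move=> i; rewrite /ex valK.
  pose N (s : nat) (i : 'I_n) : int := if insub s is Some k then (i == sg k)%:R * w k u else 0.
  have := @ccup_det _ n (@tsh n H) n id N ex u 0.
  rewrite map_id => -> //.
    have -> : \matrix_(s < n, k < n) N (0 + s)%N (id k) =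
        diag_mx (\row_s w s u) *m perm_mx sg.
      apply/matrixP => s k; rewrite mxE /N add0n valK mul_diag_mx !mxE mulrC.
      by rewrite eq_sym.
    rewrite det_mulmx det_diag det_perm mulrC; congr (_ * _).
    by apply: eq_bigr => s _; rewrite mxE.
  move=> s A i; rewrite rcons_uniq => /andP [Hi _] _; rewrite /ex /N.
  case: insubP => [k _ _|_]; last by rewrite subrr.
  have Et : tsh i (vtx (@tsh n H) u A) (sg k) = if sg k == i then
      ordS (vtx (@tsh n H) u A (sg k)) else vtx (@tsh n H) u A (sg k).
    by rewrite ffunE.
  rewrite /w /b Et; case: (eqVneq i (sg k)) => [E|E].
    by rewrite mul1r -E vtx_notin.
  by rewrite mul0r subrr.
pose u0 : torus n H := [ffun i => inord (mm (sg^-1 i)%g)].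
have Hu0 s : u0 (sg s) = mm s :> nat.
  rewrite ffunE permK inordK // -(@ltr_nat R).
  have := Hmx s _ (erefl _); have := Hhi (sg s) => h1.
  rewrite ler_norml => /andP [_ h2].
  rewrite -(ltr_pM2l dl0) mulrSr mulrDr; have := Hlo (sg s); nra.
have Hw u : tbox dl rho x0 u != 0 -> forall s, w s u = (u (sg s) == mm s :> nat)%:R * sgz (d s).
  move=> /tboxP Hu s; rewrite -Hmm /w /b.
  have Hlt : (u (sg s) < H)%N.
    apply: torus_lt => E; have := Hu (sg s); rewrite mxE E ler_norml.
    have := Hhi (sg s); move: (dl * _) => z; lra.
  rewrite /= modn_small ?ltnS //.
  have Hs z : pbit (d s * (dl * z - x0 0 (sg s))) = pbit (d s * (z - x0 0 (sg s) / dl)).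
    by rewrite -[RHS](pbit_scale _ dl0); congr pbit; field; rewrite gt_eqF.
  by rewrite !Hs.
have H1 : tbox dl rho x0 u0 = 1.
  rewrite /tbox; case: forallP => // -[] i; rewrite mxE.
  have -> : i = sg ((sg^-1)%g i) by rewrite permKV.
  by apply: le_trans Hdl; apply: Hmx; rewrite Hu0.
rewrite (bigD1 u0) //= big1 ?addr0; last first.
  move=> u Hne; have [->|Hb] := eqVneq (tbox dl rho x0 u) 0; first by rewrite mul0r.
  have [s Hs] : exists s, u (sg s) != mm s :> nat.
    apply: contrapT => Hn; case/eqP: Hne; apply/ffunP => i.
    have -> : i = sg ((sg^-1)%g i) by rewrite permKV.
    apply: val_inj; rewrite /= Hu0; apply/eqP/negPn/negP => Hs; apply: Hn.
    by exists ((sg^-1)%g i).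
  by rewrite Hcup (bigD1 s) //= Hw // (negbTE Hs) !mul0r !mulr0.
rewrite H1 mul1r Hcup; congr (_ * _); apply: eq_bigr => s _.
by rewrite Hw ?H1 // Hu0 eqxx mul1r.
Qed.

Theorem linear_degree n (A : 'M[R]_n.+1) (rho : R) : \det A != 0 -> 0 < rho ->
  exists d0 : R, 0 < d0 /\ forall H (dl : R) (x0 : 'rV[R]_n.+1),
     0 < dl -> dl <= d0 -> (forall i, rho + 2 * dl <= x0 0 i) ->
     (forall i, x0 0 i + rho + 2 * dl <= dl * H%:R) ->
     tdeg (tbox (H := H) dl rho x0) (fun s u => pbit (((tpos dl u - x0) *m A) 0 s)) =
     sgz (\det A).
Proof.
move=> /linear_path [sg [d [Hd Hsg HP]]] rho0; have [d0 [d00 Hd0]] := HP rho rho0.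
exists (Num.min d0 rho); split; first by rewrite lt_min d00.
move=> H dl x0 dl0; rewrite le_min => /andP [H1 H2] Hlo Hhi.
by rewrite Hd0 // signed_perm_degree.
Qed.

End SignedPermutation.

(** * Counting grid points near an affine image of a cube *)

Section Schur.
Variables (R : fieldType) (k : nat).

Definition schur_mx (L : 'M[R]_k.+1) i0 j0 : 'M[R]_k :=
  \matrix_(i, j) (L (lift i0 i) (lift j0 j)
     - L (lift i0 i) j0 * (L i0 (lift j0 j) / L i0 j0)).

Lemma schur_det (L : 'M[R]_k.+1) i0 j0 : L i0 j0 != 0 ->
  \det L = L i0 j0 * ((-1) ^+ (i0 + j0) * \det (schur_mx L i0 j0)).
Proof.
move=> a0.
pose E : 'M[R]_k.+1 := \matrix_(i, i') ((i == i')%:R - (i' == i0)%:R * (i != i0)%:R * (L i j0 / L i0 j0)).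
have dE : \det E = 1.
  rewrite (expand_det_row E i0) (bigD1 i0) //= big1 ?addr0; last first.
    by move=> j /negbTE Hj; rewrite mxE eqxx eq_sym Hj mul0r mul0r subr0 mul0r.
  rewrite mxE !eqxx mulr0 mul0r subr0 mul1r /cofactor -signr_odd addnn odd_double mul1r.
  rewrite (_ : row' i0 (col' i0 E) = 1%:M) ?det1 //.
  apply/matrixP => i j; rewrite !mxE (inj_eq (@lift_inj _ i0)).
  by rewrite [lift i0 j == i0]eq_sym (negbTE (neq_lift i0 j)) !mul0r subr0.
have -> : \det L = \det (E *m L) by rewrite det_mulmx dE mul1r.
have HM i j : (E *m L) i j = L i j - (i != i0)%:R * (L i j0 / L i0 j0 * L i0 j).
  rewrite mxE.
  under eq_bigr => i' _ do rewrite mxE mulrBl.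
  rewrite sumrB; congr (_ - _).
    rewrite (bigD1 i) //= eqxx mul1r big1 ?addr0 // => x /negbTE Hx.
    by rewrite eq_sym Hx mul0r.
  rewrite (bigD1 i0) //= eqxx mul1r big1 ?addr0 ?mulrA // => x /negbTE Hx.
  by rewrite Hx !mul0r.
rewrite (expand_det_col _ j0) (bigD1 i0) //= big1 ?addr0; last first.
  by move=> i Hi; rewrite HM Hi mul1r divfK // subrr mul0r.
rewrite HM eqxx mul0r subr0 /cofactor; congr (_ * (_ * \det _)).
apply/matrixP => i j; rewrite mxE mxE HM /schur_mx [RHS]mxE.
rewrite [lift i0 i == i0]eq_sym neq_lift mul1r; congr (_ - _).
by rewrite mulrAC mulrA.
Qed.

(** Once the coordinate [j0] of the image is known, the other coordinates are, up to a known shift,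
    an image under the Schur complement; this drives the induction on the dimension in
    [affine_count]. *)
Lemma schur_mul (L : 'M[R]_k.+1) i0 j0 (x : 'rV[R]_k.+1) j : L i0 j0 != 0 ->
  ((\row_i x 0 (lift i0 i)) *m schur_mx L i0 j0) 0 j =
  (x *m L) 0 (lift j0 j) - (x *m L) 0 j0 * (L i0 (lift j0 j) / L i0 j0).
Proof.
move=> a0.
have E1 s : (x *m L) 0 s = x 0 i0 * L i0 s + \sum_i x 0 (lift i0 i) * L (lift i0 i) s.
  by rewrite mxE (bigD1_ord i0).
have E2 : ((\row_i x 0 (lift i0 i)) *m schur_mx L i0 j0) 0 j =
    \sum_i x 0 (lift i0 i) * L (lift i0 i) (lift j0 j) -
    (\sum_i x 0 (lift i0 i) * L (lift i0 i) j0) * (L i0 (lift j0 j) / L i0 j0).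
  rewrite mxE mulr_suml -sumrB; apply: eq_bigr => i _.
  by rewrite /schur_mx !mxE; ring.
rewrite E2 !E1.
by field.
Qed.
End Schur.

(** The union bound. *)
Lemma exists_uncovered (I T : finType) (E : I -> {set T}) :
  (\sum_i #|E i| < #|T|)%N -> exists t, forall i, t \notin E i.
Proof.
move=> H; apply: contrapT => Hn; move: H; rewrite ltnNge => /negP; apply.
have -> : (\sum_i #|E i| = \sum_t \sum_i (t \in E i))%N.
  rewrite exchange_big; apply: eq_bigr => i _.
  rewrite -sum1_card big_mkcond; apply: eq_bigr => t _ /=; by case: (t \in E i).
rewrite -sum1_card; apply: leq_sum => t _.
have [i Hi] : exists i, t \in E i.
  by apply: contrapT => Hi; apply: Hn; exists t => i; apply/negP => h; apply: Hi; exists i.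
by rewrite (bigD1 i) //= Hi.
Qed.

Section Count.
Variable R : realType.

Lemma interval_count (M : nat) (h w c : R) (A : {set 'I_M}) : 0 < h -> 0 <= w ->
  (forall m, m \in A -> `|h * m%:R + c| <= w) -> #|A|%:R * h <= 2 * w + h.
Proof.
move=> h0 w0 HA; have [->|[x Hx]] := set_0Vmem A.
  by rewrite cards0 mul0r; lra.
have [m0 Hm0 Hmin] : exists2 m0 : 'I_M, m0 \in A & forall m, m \in A -> (m0 <= m)%N.
  by case: (arg_minnP (fun m : 'I_M => nat_of_ord m) Hx) => m0 Hm0 Hmin; exists m0.
pose K := Num.truncn (2 * w / h).
have HK : K%:R * h <= 2 * w.
  by rewrite -ler_pdivlMr // truncn_le divr_ge0 ?mulr_ge0 // ltW.
have Hsub m : m \in A -> (m - m0 < K.+1)%N.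
  move=> Hm; have Hle := Hmin _ Hm; rewrite -(@ltr_nat R) natrB //.
  have := truncnS_gt (2 * w / h); rewrite -/K => HK2.
  apply: le_lt_trans HK2; rewrite ler_pdivlMr //.
  have := HA _ Hm; have := HA _ Hm0; rewrite !ler_norml; nra.
have Hinj : {in A &, injective (fun m : 'I_M => (inord (m - m0) : 'I_K.+1))}.
  move=> m m' Hm Hm' /(congr1 val) /=; rewrite !inordK ?Hsub // => E.
  apply: val_inj; move: E (Hmin _ Hm) (Hmin _ Hm') => /=; lia.
have : (#|A| <= K.+1)%N.
  by rewrite -(card_in_imset Hinj) (leq_trans (max_card _)) // card_ord.
rewrite -(@ler_nat R) => H1; apply: (@le_trans _ _ (K.+1%:R * h)).
  by rewrite ler_pM2r.
by rewrite mulrSr mulrDl mul1r lerD2r.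
Qed.

Definition near_image k M (L : 'M[R]_k) (d e h : R) (c : 'I_k -> R)
  (t : {ffun 'I_k -> 'I_M}) :=
  exists x : 'rV[R]_k, (forall i, `|x 0 i| <= d) /\
    forall s, `|h * (t s)%:R + c s - (x *m L) 0 s| <= e.

Definition insert_at k M (j0 : 'I_k.+1) (m : 'I_M) (t : {ffun 'I_k -> 'I_M}) :
    {ffun 'I_k.+1 -> 'I_M} :=
  [ffun j : 'I_k.+1 => if unlift j0 j is Some j' then t j' else m].

Lemma insert_at_lift k M (j0 : 'I_k.+1) m (t : {ffun 'I_k -> 'I_M}) j :
  insert_at j0 m t (lift j0 j) = t j.
Proof. by rewrite ffunE liftK. Qed.

Lemma insert_at_id k M (j0 : 'I_k.+1) m (t : {ffun 'I_k -> 'I_M}) : insert_at j0 m t j0 = m.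
Proof. by rewrite ffunE unlift_none. Qed.

Lemma insert_atK k M (j0 : 'I_k.+1) (t : {ffun 'I_k.+1 -> 'I_M}) :
  insert_at j0 (t j0) [ffun j => t (lift j0 j)] = t.
Proof. by apply/ffunP => j; rewrite ffunE; case: unliftP => [j'|] -> //; rewrite ffunE. Qed.

Lemma slice_card k M (E : {set {ffun 'I_k.+1 -> 'I_M}}) j0 :
  #|E| = (\sum_(m < M) #|[set t | insert_at j0 m t \in E]|)%N.
Proof.
rewrite -sum1_card (partition_big (fun t : {ffun 'I_k.+1 -> 'I_M} => t j0) xpredT) //=.
apply: eq_bigr => m _; rewrite sum1_card.
have Hg : injective (@insert_at k M j0 m).
  move=> t t' /ffunP H; apply/ffunP => j; have := H (lift j0 j).
  by rewrite !insert_at_lift.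
rewrite -[RHS](card_imset _ Hg); apply: eq_card => t; rewrite [LHS]unfold_in.
apply/andP/imsetP => [[Ht /eqP Hm]|[t' + ->]].
  exists [ffun j => t (lift j0 j)]; first by rewrite inE -Hm insert_atK.
  by rewrite -Hm insert_atK.
by rewrite inE => ->; rewrite insert_at_id.
Qed.

(** Replaces the volume of a neighbourhood of a parallelepiped: the first term is the volume of the
    image, the second its boundary layer, absent in dimension 0. The grid is sliced along the column
    of a largest entry a of [L]. There are about (a d + e) / h slices, each governed by the Schur
    complement S, and |det L| = a |det S|. *)
Lemma affine_count k : exists C : R, 0 < C /\
  forall M (L : 'M[R]_k) (d e h B : R) (c : 'I_k -> R) (E : {set {ffun 'I_k -> 'I_M}}),
    0 < h -> h <= e -> 0 <= d -> (forall i j, `|L i j| <= B) -> 0 <= B ->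
    (forall t, t \in E -> near_image L d e h c t) ->
    #|E|%:R * h ^+ k <= C * (`|\det L| * d ^+ k + (0 < k)%N%:R * (e * (B * d + e) ^+ k.-1)).
Proof.
elim: k => [|k [C [C0 IH]]].
  exists 1; split=> // M L d e h B c E _ _ _ _ _ _.
  rewrite !expr0 mul1r !mulr1 det_mx00 normr1 mul0r addr0.
  apply: (@le_trans _ _ #|{ffun 'I_0 -> 'I_M}|%:R); first by rewrite ler_nat max_card.
  by rewrite card_ffun !card_ord expn0.
(* The summands pay, in this order, for the volume term, for the volume of a slice times the error
   in the number of slices, and for the boundary layers of the slices. *)
pose D : R := 2 * k.+1%:R + 3 * (k`!%:R * 2 ^+ k) + 2 ^+ k * (2 * k.+1%:R + 3).
have D0 : 0 < D.
  have F0 : 0 < k`!%:R :> R by rewrite ltr0n fact_gt0.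
  by rewrite !addr_gt0 ?mulr_gt0 ?exprn_gt0 ?addr_gt0 ?mulr_gt0.
exists (C * D + 3 ^+ k.+1 * C); split; first by rewrite addr_gt0 ?mulr_gt0 ?exprn_gt0.
move=> M L d e h B c E h0 he d0 HL B0 HE.
have e0 : 0 < e by apply: lt_le_trans he.
pose sl j0 m := [set t : {ffun 'I_k -> 'I_M} | insert_at j0 m t \in E].
have Hmain j0 (w T : R) : 0 <= w -> 0 <= T ->
    (forall m t, t \in sl j0 m -> `|h * m%:R + c j0| <= w) ->
    (forall m, #|sl j0 m|%:R * h ^+ k <= T) -> #|E|%:R * h ^+ k.+1 <= (2 * w + h) * T.
  move=> w0 T0 Hw HT; rewrite (slice_card E j0) natr_sum exprSr mulrA mulr_suml mulr_suml.
  pose A := [set m | sl j0 m != set0].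
  rewrite (bigID (mem A)) /= [X in _ + X]big1 ?addr0; last first.
    by move=> m; rewrite inE negbK => /eqP Hm; rewrite -/(sl j0 m) Hm cards0 !mul0r.
  apply: (@le_trans _ _ (\sum_(m in A) T * h)).
    by apply: ler_sum => m _; rewrite ler_pM2r //; exact: HT.
  rewrite sumr_const -[leLHS]mulr_natl mulrCA mulrC ler_wpM2r //.
  apply: (@interval_count _ _ _ (c j0)) => // m; rewrite inE => /set0Pn [t Ht].
  exact: Hw Ht.
(* With a largest entry as pivot all multipliers in the elimination lie in [-1, 1], so the error at
   most doubles. *)
have [p Hp] : exists p : 'I_k.+1 * 'I_k.+1, forall i j, `|L i j| <= `|L p.1 p.2|.
  case: (@Order.TotalTheory.arg_maxP _ _ _ (ord0, ord0) xpredT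
    (fun p : 'I_k.+1 * 'I_k.+1 => `|L p.1 p.2|) isT) => p _ Hm.
  by exists p => i j; apply: (Hm (i, j)).
case: p Hp => i0 j0 /= Hp; rewrite /= mul1r.
have BP : 0 <= B * d + e by rewrite addr_ge0 ?mulr_ge0 // ltW.
have [a0|a0] := eqVneq (L i0 j0) 0.
  have L0 : L = 0 by apply/matrixP => i j; apply/eqP; rewrite mxE -normr_le0 -(normr0 R) -a0.
  have HE' t : t \in E -> forall s, `|h * (t s)%:R + c s| <= e.
    by move=> /HE [x [_ Hx]] s; have := Hx s; rewrite L0 mulmx0 mxE subr0.
  apply: le_trans (Hmain j0 e (C * e ^+ k) (ltW e0) _ _ _) _.
  - by rewrite mulr_ge0 ?exprn_ge0 // ltW.
  - by move=> m t; rewrite inE => /HE' /(_ j0); rewrite insert_at_id.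
  - move=> m; apply: le_trans (IH M 0 d e h 0 (fun j => c (lift j0 j)) _ h0 he d0 _ (lexx _) _) _.
    + by move=> i j; rewrite mxE normr0.
    + move=> t; rewrite inE => /HE' Ht; exists 0; split; first by move=> i; rewrite mxE normr0.
      by move=> s; rewrite mul0mx mxE subr0; have := Ht (lift j0 s); rewrite insert_at_lift.
    + rewrite mul0r add0r ler_pM2l //; case: (k) => [|k'].
        rewrite /= !expr0 det_mx00 normr1; lra.
      by rewrite det0 normr0 mul0r add0r /= mul1r -exprS.
  apply: (@le_trans _ _ (3 * e * (C * e ^+ k))).
    apply: ler_wpM2r; last by lra.
    by rewrite mulr_ge0 ?exprn_ge0 // ltW.
  have H1 : e ^+ k <= (B * d + e) ^+ k.
    by rewrite lerXn2r ?nnegrE // ?(ltW e0) // lerDr mulr_ge0.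
  have H2 : 3 <= 3 ^+ k.+1 :> R by rewrite exprS ler_peMr // exprn_ege1 // ler1n.
  apply: (@le_trans _ _ (3 ^+ k.+1 * C * (e * (B * d + e) ^+ k))).
    have -> : 3 * e * (C * e ^+ k) = 3 * (C * e) * e ^+ k by ring.
    have -> : 3 ^+ k.+1 * C * (e * (B * d + e) ^+ k) = 3 ^+ k.+1 * (C * e) * (B * d + e) ^+ k by ring.
    have Ce : 0 < C * e by rewrite mulr_gt0.
    apply: ler_pM => //; first by rewrite mulr_ge0 // ltW.
      by rewrite exprn_ge0 // ltW.
    by rewrite ler_pM2r.
  have X0 : 0 <= e * (B * d + e) ^+ k by rewrite mulr_ge0 ?exprn_ge0 // ltW.
  have Y0 : 0 <= `|\det L| * d ^+ k.+1 by rewrite mulr_ge0 ?exprn_ge0.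
  apply: ler_pM => //; rewrite ?lerDr ?lerDl //.
    by rewrite !mulr_ge0 ?exprn_ge0 // ltW.
  by rewrite mulr_ge0 // ltW.
pose a := `|L i0 j0|.
have a1 : 0 < a by rewrite normr_gt0.
have Hrho j : `|L i0 j / L i0 j0| <= 1.
  by rewrite normrM normfV -/a ler_pdivrMr // mul1r Hp.
pose S := schur_mx L i0 j0.
have HS i j : `|S i j| <= 2 * a.
  rewrite /S mxE; apply: le_trans (ler_normB _ _) _.
  rewrite normrM; have h1 := Hp (lift i0 i) (lift j0 j); have h2 := Hp (lift i0 i) j0.
  have h3 := Hrho (lift j0 j); rewrite -/a in h1 h2.
  have : `|L (lift i0 i) j0| * `|L i0 (lift j0 j) / L i0 j0| <= a * 1 by apply: ler_pM.
  lra.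
have Hdet : `|\det L| = a * `|\det S|.
  by rewrite (schur_det a0) normrM normrM normrX normrN normr1 expr1n mul1r.
pose w := k.+1%:R * (d * a) + e.
have w0 : 0 <= w by rewrite addr_ge0 ?mulr_ge0 // ltW.
pose T := C * (`|\det S| * d ^+ k + (0 < k)%N%:R * (2 * e * (2 * a * d + 2 * e) ^+ k.-1)).
have T0 : 0 <= T.
  rewrite /T mulr_ge0 ?(ltW C0) // addr_ge0 ?mulr_ge0 ?exprn_ge0 // ?(ltW e0) //.
  by rewrite addr_ge0 ?mulr_ge0 // ltW.
apply: le_trans (Hmain j0 w T w0 T0 _ _) _.
- move=> m t; rewrite inE => /HE [x [Hx Hs]]; have := Hs j0; rewrite insert_at_id => h1.
  have h2 : `|(x *m L) 0 j0| <= k.+1%:R * (d * a) by apply: mulmx_entry_le.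
  have -> : h * m%:R + c j0 = (h * m%:R + c j0 - (x *m L) 0 j0) + (x *m L) 0 j0 by ring.
  apply: le_trans (ler_normD _ _) _; rewrite /w addrC; exact: lerD.
- move=> m; apply: (IH M S d (2 * e) h (2 * a)
    (fun j => c (lift j0 j) - (h * m%:R + c j0) * (L i0 (lift j0 j) / L i0 j0))) => //; try lra.
  move=> t; rewrite inE => /HE [x [Hx Hs]]; exists (\row_i x 0 (lift i0 i)); split.
    by move=> i; rewrite mxE.
  move=> j; rewrite schur_mul //; have h1 := Hs (lift j0 j); have h2 := Hs j0.
  rewrite insert_at_lift in h1; rewrite insert_at_id in h2.
  set q := L i0 (lift j0 j) / L i0 j0.
  have -> : h * (t j)%:R + (c (lift j0 j) - (h * m%:R + c j0) * q) -
      ((x *m L) 0 (lift j0 j) - (x *m L) 0 j0 * q) =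
     (h * (t j)%:R + c (lift j0 j) - (x *m L) 0 (lift j0 j)) -
     (h * m%:R + c j0 - (x *m L) 0 j0) * q by ring.
  apply: le_trans (ler_normB _ _) _; rewrite normrM.
  have : `|h * m%:R + c j0 - (x *m L) 0 j0| * `|q| <= e * 1.
    by apply: ler_pM => //; exact: Hrho.
  lra.
pose P := a * d + e.
have P0 : 0 < P by rewrite ltr_wpDl // mulr_ge0 // ltW.
have PB : P <= B * d + e by rewrite lerD2r ler_wpM2r // HL.
have HPk : P ^+ k <= (B * d + e) ^+ k by rewrite lerXn2r ?nnegrE // ltW.
have ad0 : 0 <= a * d by rewrite mulr_ge0 // ltW.
have W1 : 2 * w + h <= 2 * k.+1%:R * (a * d) + 3 * e.
  by rewrite /w [d * a]mulrC; move: (k.+1%:R * (a * d)) (2 * k.+1%:R * (a * d)) (mulrA 2 k.+1%:R (a * d)) => X Y E1; lra.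
have T2 : `|\det S| * d ^+ k <= k`!%:R * 2 ^+ k * P ^+ k.
  apply: (@le_trans _ _ (k`!%:R * (2 * a) ^+ k * d ^+ k)).
    by rewrite ler_wpM2r ?exprn_ge0 //; apply: det_le.
  rewrite -mulrA -exprMn -[leRHS]mulrA -exprMn ler_wpM2l // lerXn2r ?nnegrE //.
  - by rewrite !mulr_ge0 // ltW.
  - by rewrite mulr_ge0 // ltW.
  by rewrite /P; lra.
have T3 : (2 * k.+1%:R * (a * d) + 3 * e) * ((0 < k)%N%:R * (2 * e * (2 * a * d + 2 * e) ^+ k.-1))
    <= 2 ^+ k * (2 * k.+1%:R + 3) * (e * P ^+ k).
  case: (posnP k) => [->|k0].
    by rewrite mul0r mulr0 !mulr_ge0 ?exprn_ge0 ?addr_ge0 ?mulr_ge0 // ltW.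
  rewrite mul1r.
  have -> : 2 ^+ k = 2 * 2 ^+ k.-1 :> R by rewrite -exprS prednK.
  have -> : P ^+ k = P * P ^+ k.-1 by rewrite -exprS prednK.
  have -> : 2 * a * d + 2 * e = 2 * P by rewrite /P; ring.
  rewrite exprMn.
  have -> : 2 * 2 ^+ k.-1 * (2 * k.+1%:R + 3) * (e * (P * P ^+ k.-1)) =
     ((2 * k.+1%:R + 3) * P) * (2 * e * (2 ^+ k.-1 * P ^+ k.-1)) by ring.
  apply: ler_wpM2r; first by rewrite !mulr_ge0 ?exprn_ge0 // ltW.
  rewrite /P mulrDl mulrDr; have : 0 <= 2 * k.+1%:R * e by rewrite !mulr_ge0 // ltW.
  lra.
apply: (@le_trans _ _ (C * D * (`|\det L| * d ^+ k.+1 + e * (B * d + e) ^+ k))); last first.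
  apply: ler_wpM2r; first by rewrite addr_ge0 ?mulr_ge0 ?exprn_ge0 // ltW.
  by rewrite lerDl mulr_ge0 ?exprn_ge0 // ltW.
apply: (@le_trans _ _ (C * D * (`|\det L| * d ^+ k.+1 + e * P ^+ k))); last first.
  apply: ler_wpM2l; first by rewrite mulr_ge0 // ltW.
  by rewrite lerD2l; apply: ler_wpM2l => //; exact: ltW.
apply: (@le_trans _ _ ((2 * k.+1%:R * (a * d) + 3 * e) * T)).
  by rewrite ler_wpM2r.
rewrite /T mulrCA -[leRHS]mulrA ler_wpM2l ?(ltW C0) // mulrDr.
apply: le_trans (lerD (lexx _) T3) _.
rewrite mulrDl Hdet exprS.
have -> : 2 * k.+1%:R * (a * d) * (`|\det S| * d ^+ k) =
   2 * k.+1%:R * (a * `|\det S| * (d * d ^+ k)) by ring.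
have : 3 * e * (`|\det S| * d ^+ k) <= 3 * (k`!%:R * 2 ^+ k) * (e * P ^+ k).
  have -> : 3 * (k`!%:R * 2 ^+ k) * (e * P ^+ k) = 3 * e * (k`!%:R * 2 ^+ k * P ^+ k) by ring.
  by rewrite ler_wpM2l // mulr_ge0 // ltW.
set X := a * `|\det S| * (d * d ^+ k); set Y := e * P ^+ k.
have X0 : 0 <= X by rewrite /X !mulr_ge0 ?exprn_ge0 // ltW.
have Y0 : 0 <= Y by rewrite /Y mulr_ge0 ?exprn_ge0 // ltW.
have F1 : 0 <= 3 * (k`!%:R * 2 ^+ k) :> R by rewrite !mulr_ge0 ?exprn_ge0.
have F2 : 0 <= 2 ^+ k * (2 * k.+1%:R + 3) :> R by rewrite mulr_ge0 ?exprn_ge0 ?addr_ge0 ?mulr_ge0.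
have F3 : 0 <= 2 * k.+1%:R :> R by rewrite mulr_ge0.
rewrite /D; move: F1 F2 F3; set f1 := 3 * _; set f2 := 2 ^+ k * _; set f3 := 2 * k.+1%:R.
clearbody X Y f1 f2 f3; nra.
Qed.
End Count.

(** * Avoiding local constraints of small probability *)

Section Greedy.
Local Open Scope nat_scope.
Variables (V X C : finType) (dep : C -> {set V}) (Bad : C -> {set {ffun V -> X}}).
Variables (x0 : X) (m D : nat).
Hypothesis depP : forall c (f g : {ffun V -> X}), (forall v, v \in dep c -> f v = g v) -> (f \in Bad c) = (g \in Bad c).
Hypothesis dep_deg : forall v, #|[set c | v \in dep c]| <= D.
Hypothesis dep_card : forall c, #|dep c| <= m.
Hypothesis Bad_card : forall c, #|Bad c| * D.+1 ^ m < #|X| ^ #|V|.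

Implicit Types (f g : {ffun V -> X}) (S : {set V}).

Definition upd f v x : {ffun V -> X} := [ffun w => if w == v then x else f w].

(** Its cardinality is, up to normalisation, the conditional probability of [Bad c] when the values
    on [S] are fixed as in [f]. *)
Definition extensions c (f : {ffun V -> X}) (S : {set V}) : {set {ffun V -> X}} :=
  [set g in Bad c | [forall v in S, g v == f v]].

Lemma extensions_upd c f S v x : v \notin S ->
  extensions c (upd f v x) (v |: S) = [set g in extensions c f S | g v == x].
Proof.
move=> vS; apply/setP => g; rewrite !inE -andbA; congr (_ && _).
apply/forall_inP/andP => [H|[/forall_inP H /eqP gv] w].
  split; last by have := H v; rewrite setU11 ffunE eqxx => /(_ isT).
  apply/forall_inP => w wS; have := H w; rewrite !inE wS orbT ffunE => /(_ isT).
  by have [E|//] := eqVneq w v; rewrite -E wS in vS.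
rewrite !inE ffunE => /orP [/eqP ->|wS]; first by rewrite eqxx gv.
have [->|_] := eqVneq w v; [by rewrite gv | exact: H].
Qed.

Lemma sum_extensions c f S v : v \notin S ->
  \sum_x #|extensions c (upd f v x) (v |: S)| = #|extensions c f S|.
Proof.
move=> vS; rewrite -sum1_card (partition_big (fun g : {ffun V -> X} => g v) xpredT) //=.
apply: eq_bigr => x _; rewrite extensions_upd // -sum1_card; apply: eq_bigl => g.
by rewrite !inE.
Qed.

Lemma extensions_indep c f S v x : v \notin S -> v \notin dep c ->
  #|extensions c (upd f v x) (v |: S)| * #|X| = #|extensions c f S|.
Proof.
move=> vS vd; rewrite -(sum_extensions c f vS) mulnC -sum_nat_const.
have Hle y z : #|extensions c (upd f v y) (v |: S)| <= #|extensions c (upd f v z) (v |: S)|.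
  rewrite !extensions_upd // -(@card_in_imset _ _ (fun g => upd g v z)).
    apply: subset_leq_card; apply/subsetP => h /imsetP [g]; rewrite !inE.
    move=> /andP [/andP [gB /forall_inP gS] gv] ->; rewrite ffunE eqxx eqxx andbT.
    apply/andP; split.
      rewrite -(@depP c g) // => w wd; rewrite ffunE; case: eqP => // E.
      by rewrite -E wd in vd.
    apply/forall_inP => w wS; rewrite ffunE; case: (w =P v) => [E|_]; last exact: gS.
    by rewrite -E wS in vS.
  move=> g h; rewrite !inE => /andP [_ /eqP gv] /andP [_ /eqP hv] /ffunP E.
  apply/ffunP => w; have := E w; rewrite !ffunE; case: eqP => [->|//]; by rewrite gv hv.
by apply: eq_bigr => y _; apply/eqP; rewrite eqn_leq !Hle.
Qed.

(** The conditional probabilities average over [x] to the old one, so by Markov's inequality each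
    grows by more than the factor [D.+1] for at most a fraction [1 / D.+1] of the values. At most
    [D] constraints involve [v], so some [x] remains. *)
Lemma greedy_value f S v : v \notin S -> exists x, forall c, v \in dep c ->
  #|extensions c (upd f v x) (v |: S)| * #|X| <= D.+1 * #|extensions c f S|.
Proof.
move=> vS.
pose viol c : {set X} := [set x | (v \in dep c) &&
  (D.+1 * #|extensions c f S| < #|extensions c (upd f v x) (v |: S)| * #|X|)].
have X0 : 0 < #|X| by apply/card_gt0P; exists x0.
have Hv c : #|viol c| * D.+1 <= (v \in dep c) * #|X|.
  case: (boolP (v \in dep c)) => Hc; last first.
    suff -> : viol c = set0 by rewrite cards0.
    by apply/setP => x; rewrite !inE (negbTE Hc).
  rewrite mul1n; have [E|n0] := posnP #|extensions c f S|.
    suff -> : viol c = set0 by rewrite cards0.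
    apply/setP => x; rewrite !inE Hc E muln0 /=.
    have : #|extensions c (upd f v x) (v |: S)| <= 0.
      by rewrite -E -(sum_extensions c f vS) (bigD1 x) //= leq_addr.
    by rewrite leqn0 => /eqP ->; rewrite mul0n.
  rewrite -(leq_pmul2r n0) -mulnA -sum_nat_const [leqRHS]mulnC -{2}(sum_extensions c f vS).
  rewrite big_distrl /=.
  apply: (@leq_trans (\sum_(x in viol c) #|extensions c (upd f v x) (v |: S)| * #|X|)).
    by apply: leq_sum => x; rewrite inE => /andP [_ /ltnW].
  by rewrite [leqRHS](bigID (mem (viol c))) /= leq_addr.
have [x Hx] : exists x, forall c, x \notin viol c.
  apply: exists_uncovered; rewrite -(ltn_pmul2r (ltn0Sn D)) big_distrl /=.
  apply: (@leq_ltn_trans (\sum_c (v \in dep c) * #|X|)); first by apply: leq_sum => c _.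
  rewrite -big_distrl /= mulnC ltn_pmul2l // ltnS; apply: leq_trans (dep_deg v).
  by rewrite -sum1_card [leqRHS]big_mkcond /=; apply: leq_sum => c _; rewrite inE; case: (v \in dep c).
by exists x => c Hc; have := Hx c; rewrite inE Hc /= -leqNgt.
Qed.

(** The values are fixed one after another. A constraint is touched at most [m] times, each time its
    conditional probability grows at most by the factor [D.+1], so it stays below 1. When all values
    are fixed it is 0 or 1, hence 0. *)
Lemma avoid_local_constraints : exists f, forall c, f \notin Bad c.
Proof.
have X0 : 0 < #|X| by apply/card_gt0P; exists x0.
have Hs (s : seq V) : uniq s -> exists f, forall c,
    #|extensions c f [set v in s]| * (D.+1 ^ m * #|X| ^ size s) <
    D.+1 ^ #|dep c :&: [set v in s]| * #|X| ^ #|V|.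
  elim: s => [|v s IH] /=.
    move=> _; exists [ffun=> x0] => c; rewrite expn0 muln1.
    have -> : [set v in [::]] = set0 :> {set V} by apply/setP => v; rewrite !inE.
    rewrite setI0 cards0 expn0 mul1n; apply: leq_ltn_trans (Bad_card c).
    by rewrite leq_mul2r subset_leq_card ?orbT //; apply/subsetP => g; rewrite inE => /andP [].
  move=> /andP [vs /IH [f Hf]].
  have -> : [set v0 in v :: s] = v |: [set v in s] by apply/setP => w; rewrite !inE.
  have vS : v \notin [set v in s] by rewrite inE.
  have [x Hx] := greedy_value f vS.
  exists (upd f v x) => c; have := Hf c.
  case: (boolP (v \in dep c)) => Hc.
    have -> : dep c :&: (v |: [set v in s]) = v |: (dep c :&: [set v in s]).
      by apply/setP => w; rewrite !inE; case: eqP => [->|_] //=; rewrite Hc.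
    rewrite cardsU1 !inE (negbTE vs) andbF /= add1n !expnS => H.
    have := Hx c Hc; move: H; set a := #|extensions c f _|; set b := #|extensions _ (upd _ _ _) _|.
    move=> H1 H2; apply: (@leq_ltn_trans (D.+1 * a * (D.+1 ^ m * #|X| ^ size s))).
      by rewrite [D.+1 ^ m * (_ * _)]mulnCA mulnA leq_mul2r H2 orbT.
    by rewrite -!mulnA ltn_pmul2l.
  have -> : dep c :&: (v |: [set v in s]) = dep c :&: [set v in s].
    by apply/setP => w; rewrite !inE; case: eqP => [->|_] //=; rewrite (negbTE Hc).
  rewrite -(extensions_indep f x vS Hc) expnS => H; apply: leq_ltn_trans H.
  by rewrite -mulnA leq_mul2l mulnCA leqnn orbT.
have [f Hf] := Hs (enum V) (enum_uniq V).
exists f => c; apply/negP => Hc; have := Hf c; rewrite -cardE.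
have -> : [set v in enum V] = setT by apply/setP => v; rewrite !inE mem_enum.
rewrite setIT mulnA ltn_pmul2r ?expn_gt0 ?X0 // ltnNge => /negP; apply.
apply: (@leq_trans (D.+1 ^ m)); first by rewrite leq_pexp2l.
rewrite leq_pmull //; apply/card_gt0P; exists f; rewrite inE Hc.
by apply/forall_inP.
Qed.

End Greedy.

(** All fibres of the restriction along [h] have the same size. *)
Lemma card_restrict (I V X : finType) (h : I -> V) (E : {set {ffun I -> X}}) : injective h ->
  (#|[set g : {ffun V -> X} | [ffun i => g (h i)] \in E]| * #|X| ^ #|I| = #|E| * #|X| ^ #|V|)%N.
Proof.
move=> hI; pose fib e := [set g : {ffun V -> X} | [ffun i => g (h i)] == e].
have Hle e e' : (#|fib e| <= #|fib e'|)%N.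
  pose phi (g : {ffun V -> X}) : {ffun V -> X} :=
    [ffun v => if [pick i | h i == v] is Some i then e' i else g v].
  rewrite -(@card_in_imset _ _ phi).
    apply: subset_leq_card; apply/subsetP => _ /imsetP [g _ ->]; rewrite inE.
    apply/eqP/ffunP => i; rewrite !ffunE; case: pickP => [j /eqP /hI -> //|/(_ i)].
    by rewrite eqxx.
  move=> g g'; rewrite !inE => /eqP ge /eqP ge' /ffunP Ep; apply/ffunP => v.
  have := Ep v; rewrite !ffunE; case: pickP => [i /eqP <- _|//].
  by move/ffunP/(_ i): ge; move/ffunP/(_ i): ge'; rewrite !ffunE => -> ->.
have Hf e : (#|fib e| * #|X| ^ #|I| = #|X| ^ #|V|)%N.
  rewrite -!card_ffun -[in RHS]sum1_card.
  rewrite (partition_big (fun g : {ffun V -> X} => [ffun i => g (h i)]) xpredT) //=.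
  rewrite mulnC -sum_nat_const; apply: eq_bigr => e' _; rewrite sum1dep_card.
  apply/eqP; rewrite eqn_leq; apply/andP; split; exact: Hle.
rewrite -[in RHS]sum1_card big_distrl /=.
rewrite -[X in (X * _)%N]sum1_card (partition_big (fun g : {ffun V -> X} => [ffun i => g (h i)]) (mem E)) /=; last first.
  by move=> g; rewrite inE.
rewrite big_distrl /=; apply: eq_bigr => e eE; rewrite mul1n -(Hf e) sum1dep_card; congr (_ * _)%N.
apply: eq_card => g; rewrite !inE; case: eqP => [->|_]; by rewrite ?eE ?andbF.
Qed.

(** The constraint [(w, tau)] reads, for each [s], the s-th label at the vertex reached from [w] by
    the directions from [c] on that [tau] places before [s]. It reads [n] labels, and a label is
    read for at most one [w] per permutation; hence [q] is [(n! + 1) ^ n]. *)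
Lemma lattice_labels n : exists q : nat, (0 < q)%N /\ forall c H (X : finType)
    (Bad : torus n H -> 'S_n -> {set {ffun 'I_n -> X}}), (0 < #|X|)%N ->
  (forall w tau, #|Bad w tau| * q < #|X| ^ n)%N ->
  exists f : torus n H -> 'I_n -> X, forall w (tau : 'S_n),
    [ffun s : 'I_n => f (vtx (@tsh n H) w (enum [set i : 'I_n | (c <= i)%N && (tau i < s)%N])) s]
      \notin Bad w tau.
Proof.
exists (#|{: 'S_n}|.+1 ^ n)%N; split; first by rewrite expn_gt0.
move=> c H X Bad /card_gt0P [x0 _] HB.
pose T (tau : 'S_n) (s : 'I_n) := enum [set i : 'I_n | (c <= i)%N && (tau i < s)%N].
pose h (cn : torus n H * 'S_n) (s : 'I_n) := (vtx (@tsh n H) cn.1 (T cn.2 s), s).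
have hI cn : injective (h cn) by move=> s s' [].
have vtxI A : injective (fun w => vtx (@tsh n H) w A).
  by elim: A => [|i A IH] u v //= /IH; exact: tsh_inj.
have [||||f Hf] := @avoid_local_constraints (torus n H * 'I_n)%type X (torus n H * 'S_n)%type
  (fun cn => [set h cn s | s : 'I_n])
  (fun cn => [set g : {ffun _ -> X} | [ffun s => g (h cn s)] \in Bad cn.1 cn.2]) x0 n #|{: 'S_n}|.
- move=> cn f g Hfg; rewrite !inE; suff -> : [ffun s => f (h cn s)] = [ffun s => g (h cn s)] by [].
  by apply/ffunP => s; rewrite !ffunE Hfg // imset_f.
- move=> [v s]; rewrite -[leqRHS]/#|{: 'S_n}| -(@card_in_imset _ _ (fun cn : torus n H * 'S_n => cn.2)).
    by rewrite max_card.
  move=> [w t] [w' t']; rewrite !inE => /imsetP [s1 _ [E1 E2]] /imsetP [s2 _ [E3 E4]] /= Et.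
  by move: E3 E4 E1; rewrite -Et => -> <-; rewrite E2 => /vtxI ->.
- by move=> cn; apply: leq_trans (leq_imset_card _ _) _; rewrite card_ord.
- move=> cn; have X0 : (0 < #|X| ^ n)%N by rewrite expn_gt0; apply/orP; left; apply/card_gt0P; exists x0.
  have E := @card_restrict 'I_n (torus n H * 'I_n)%type X (h cn) (Bad cn.1 cn.2) (hI cn).
  rewrite card_ord in E; rewrite -(ltn_pmul2r X0) mulnAC E mulnAC [ltnRHS]mulnC ltn_pmul2r //.
  by rewrite expn_gt0; apply/orP; left; apply/card_gt0P; exists x0.
exists (fun u s => f (u, s)) => w tau; have := Hf (w, tau); rewrite inE.
by [].
Qed.

(** * Counting labels *)

Lemma det_mxsub_scale (R : comNzRingType) n k (J : 'M[R]_n) (f g : 'I_k -> 'I_n) (al be : 'I_n -> R) :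
  \det (mxsub f g (\matrix_(i, s) (al i * J i s * be s))) =
  (\prod_a al (f a)) * \det (mxsub f g J) * \prod_a be (g a).
Proof.
have -> : mxsub f g (\matrix_(i, s) (al i * J i s * be s)) =
    diag_mx (\row_a al (f a)) *m mxsub f g J *m diag_mx (\row_a be (g a)).
  by apply/matrixP => a c; rewrite mul_mx_diag mul_diag_mx !mxE.
rewrite !det_mulmx !det_diag; congr (_ * _ * _); by apply: eq_bigr => a _; rewrite mxE.
Qed.

(** A piece with extent [d] only in the [k] directions [f], and thin in the others, is seen by the
    components [g] as an affine image of a k-cube up to the error [e]; [affine_count] then bounds
    the labels it can match. *)
Lemma piece_count (R : realType) (k : nat) : exists C : R, 0 < C /\
  forall n M (J0 : 'M[R]_n) (f g : 'I_k -> 'I_n) (phi : 'rV[R]_n -> 'I_n -> R) (Pc : 'rV[R]_n -> Prop)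
    (d eta ea e2 e h B : R) (c : 'I_n -> R) (x0 : 'rV[R]_n) (E : {set {ffun 'I_k -> 'I_M}}),
  injective f -> 0 < h -> h <= e -> 0 <= d -> 0 <= eta -> 0 <= B -> (forall i s, `|J0 i s| <= B) ->
  (forall x, Pc x -> forall a, `|x 0 (f a) - x0 0 (f a)| <= d) ->
  (forall x, Pc x -> forall i, (forall a, f a != i) -> `|x 0 i - x0 0 i| <= eta) ->
  (forall x, Pc x -> forall s, `|phi x s - phi x0 s - ((x - x0) *m J0) 0 s| <= ea) ->
  ea + n%:R * (B * eta) + e2 <= e ->
  (forall t, t \in E -> exists2 x, Pc x & forall a, `|phi x (g a) - (c (g a) + h * (t a)%:R)| <= e2) ->
  #|E|%:R * h ^+ k <= C * (`|\det (mxsub f g J0)| * d ^+ k + (0 < k)%N%:R * (e * (B * d + e) ^+ k.-1)).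
Proof.
have [C [C0 HC]] := affine_count R k; exists C; split=> //.
move=> n M J0 f g phi Pc d eta ea e2 e h B c x0 E fI h0 he d0 eta0 B0 HB Hd Heta Ha He HE.
apply: (HC M (mxsub f g J0) d e h B (fun a => c (g a) - phi x0 (g a)) E h0 he d0) => //.
  by move=> i s; rewrite mxE.
move=> t /HE [x Px Hx]; exists (\row_a (x 0 (f a) - x0 0 (f a))); split.
  by move=> a; rewrite mxE; exact: Hd.
move=> s; have h1 := Hx s; have h2 := Ha x Px (g s).
have E3 : `|((x - x0) *m J0) 0 (g s) - (\row_a (x 0 (f a) - x0 0 (f a)) *m mxsub f g J0) 0 s| <= n%:R * (B * eta).
  have -> : (\row_a (x 0 (f a) - x0 0 (f a)) *m mxsub f g J0) 0 s =
      \sum_(i | i \in codom f) (x 0 i - x0 0 i) * J0 i (g s).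
    rewrite mxE -big_uniq /=; last by rewrite map_inj_uniq ?enum_uniq.
    by rewrite big_map big_enum /=; apply: eq_bigr => a _; rewrite !mxE.
  rewrite mxE (eq_bigr (fun i => (x 0 i - x0 0 i) * J0 i (g s))); last by move=> i _; rewrite !mxE.
  rewrite (bigID (fun i => i \in codom f)) /=.
  rewrite addrAC subrr add0r; apply: le_trans (ler_norm_sum _ _ _) _.
  apply: (@le_trans _ _ (\sum_(i < n) B * eta)); last by rewrite sumr_const card_ord mulr_natl.
  rewrite big_mkcond /=; apply: ler_sum => i _; case: ifP => Hi; last by rewrite mulr_ge0.
  rewrite normrM mulrC; apply: ler_pM => //; apply: Heta => // a.
  by apply/eqP => fa; move: Hi; rewrite -fa codom_f.
move: h1 h2 E3 He; move: (phi x (g s)) (phi x0 (g s)) (((x - x0) *m J0) 0 (g s)) ((_ *m mxsub f g J0) 0 s) (c (g s)) (h * _) (n%:R * _).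
by clear; move=> A A0 P Q c' ht z; rewrite !ler_norml; lra.
Qed.

(** Double counting of the pairs that meet, followed by Markov's inequality. *)
Lemma markov_count (B C : finType) (meets : B -> C -> bool) (V : {set C}) (N Q T : nat) :
  (forall b c, meets b c -> c \in V) ->
  (forall c, #|[set b | meets b c]| * N <= Q)%N ->
  (#|[set b | T < #|[set c | meets b c]|]| * (T.+1 * N) <= #|V| * Q)%N.
Proof.
move=> HV H; apply: (@leq_trans (\sum_(c in V) #|[set b | meets b c]| * N)); last first.
  by rewrite -sum_nat_const; apply: leq_sum => c _.
rewrite -big_distrl /= mulnA leq_mul2r; apply/orP; right.
have -> : (\sum_(c in V) #|[set b | meets b c]| = \sum_b #|[set c | meets b c]|)%N.
  transitivity (\sum_(c in V) \sum_b (meets b c : nat))%N.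
    by apply: eq_bigr => c _; rewrite -sum1dep_card big_mkcond; apply: eq_bigr => b _; case: (meets b c).
  rewrite exchange_big; apply: eq_bigr => b _.
  rewrite -sum1dep_card [RHS]big_mkcond [LHS]big_mkcond /=; apply: eq_bigr => c _.
  by have := HV b c; case: (meets b c) => [->//|_]; case: ifP.
rewrite -sum_nat_const [leqRHS](bigID (mem [set b | (T < #|[set c | meets b c]|)%N])) /=.
by apply: leq_trans (leq_addr _ _); apply: leq_sum => b; rewrite inE.
Qed.

(** Box numbers have a different range [N s] in each component, whereas labels are drawn from one
    alphabet. Labels below a common multiple [Q] are uniform modulo each [N s], so they serve for
    all components. *)
Lemma residue_count n Q (N : 'I_n -> nat) (J : {set 'I_n}) (be : 'I_n -> nat) :
  (forall s, N s %| Q)%N -> (forall s, 0 < N s)%N ->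
  (#|[set b : {ffun 'I_n -> 'I_Q} | [forall s in J, b s %% N s == be s]]| * \prod_(s in J) N s <= Q ^ n)%N.
Proof.
move=> NQ N0.
pose F s : pred 'I_Q := fun x => (s \in J) ==> (x %% N s == be s)%N.
have -> : #|[set b : {ffun 'I_n -> 'I_Q} | [forall s in J, b s %% N s == be s]%N]| = #|family F|.
  apply: eq_card => b; rewrite inE; apply/forallP/familyP => H s; have := H s; by rewrite unfold_in.
rewrite card_family foldrE big_map big_enum /= -[X in (Q ^ X)%N](card_ord n) -prod_nat_const.
rewrite [X in (_ * X)%N]big_mkcond -big_split /=; apply: leq_prod => s _.
case: ifP => sJ; last by rewrite muln1 -[leqRHS](card_ord Q) max_card.
have [Q' EQ] := dvdnP (NQ s).
have HF : (#|F s| <= Q')%N.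
  have lt (x : 'I_Q) : (x %/ N s < Q')%N by rewrite ltn_divLR // -EQ; exact: ltn_ord.
  rewrite -[leqRHS](card_ord Q') -(@card_in_image _ _ (fun x => Ordinal (lt x))) ?max_card //.
  move=> x y; rewrite -!topredE /= /F sJ /= => /eqP hx /eqP hy [E].
  by apply: val_inj => /=; rewrite [LHS](divn_eq _ (N s)) [RHS](divn_eq _ (N s)) E hx hy.
by apply: (@leq_trans (Q' * N s)); [rewrite leq_mul2r HF orbT | rewrite -EQ].
Qed.

From mathcomp Require Import all_classical all_reals all_analysis.
Import Order.TTheory GRing.Theory Num.Theory.
Import numFieldNormedType.Exports.
Local Open Scope classical_set_scope.
Local Open Scope ring_scope.

(** * Uniform first-order approximation on compact sets *)

Section Analysis.
Variables (R : realType) (n : nat).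
Implicit Types (x y : 'rV[R]_n) (U K : set 'rV[R]_n) (f : 'rV[R]_n -> 'rV[R]_n).

Definition cnear (d : R) x y := forall i, `|y 0 i - x 0 i| <= d.

Lemma near_cnear x (P : 'rV[R]_n -> Prop) : (\forall y \near x, P y) ->
  exists d : R, 0 < d /\ forall y, cnear d x y -> P y.
Proof.
move=> /nbhs_ballP [e /= e0 He]; exists (e / 2); split; first by rewrite divr_gt0.
move=> y Hy; apply: He; split=> // i j; rewrite ord1 /ball /= distrC.
by apply: le_lt_trans (Hy j) _; rewrite ltr_pdivrMr // mulr2n mulrDr mulr1 ltrDl.
Qed.

Lemma cnear_near x (d : R) : 0 < d -> \forall y \near x, cnear d x y.
Proof.
move=> d0; apply/nbhs_ballP; exists d => //= y [_ Hy] i.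
by have := Hy 0 i; rewrite /ball /= distrC => /ltW.
Qed.

Lemma jacobianE (f : 'rV[R]_n -> 'rV[R]_n) x i s : differentiable f x ->
  jacobian f x i s = 'D_(delta_mx 0 i) f x 0 s.
Proof. by move=> df; rewrite /jacobian mxE deriveE. Qed.

Lemma dist_le_trans_eq (a b a' b' e : R) : a = a' -> b = b' -> `|a' - b'| <= e -> `|a - b| <= e.
Proof. by move=> -> ->. Qed.

Lemma norm_le_dist (a b e B : R) : `|a - b| <= e -> `|b| <= B -> `|a| <= B + e.
Proof. by have := ler_normD (a - b) b; rewrite subrK; lra. Qed.

Lemma jacobian_near U f x (e : R) : open U -> smooth_on U f -> U x -> 0 < e ->
  exists d : R, 0 < d /\ forall y, cnear d x y ->
    U y /\ forall i s, `|jacobian f y i s - jacobian f x i s| <= e.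
Proof.
move=> oU sf Ux e0; have [df cf] := sf 1%N.
apply: near_cnear.
have HU : \forall y \near x, U y by apply: open_nbhs_nbhs.
have HD : \forall y \near x, forall i : 'I_n,
   `|'D_(delta_mx 0 i) f x - 'D_(delta_mx 0 i) f y| < e.
  have H i : \forall y \near x, `|'D_(delta_mx 0 i) f x - 'D_(delta_mx 0 i) f y| < e.
    have := cf (delta_mx 0 i) x Ux.
    by move=> /cvgrPdist_lt /(_ e e0).
  exact: (filter_forall (nbhs_filter x) H).
near=> y; have Uy : U y by near: y.
have HDy : forall i : 'I_n, `|'D_(delta_mx 0 i) f x - 'D_(delta_mx 0 i) f y| < e.
  by near: y; exact: HD.
split; first exact: Uy.
move=> i s.
have E1 := jacobianE i s (df y Uy).
have E2 := jacobianE i s (df x Ux).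
apply: (dist_le_trans_eq E1 E2).
rewrite distrC; apply: le_trans (ltW (HDy i)); rewrite [leRHS]/Num.Def.normr /= mx_normrE.
apply: le_trans (le_bigmax _ _ (0, s)); by rewrite !mxE.
Unshelve. all: by end_near.
Qed.

Lemma segment_derivative U f x h (t : R) s : smooth_on U f -> U (x + t *: h) ->
  is_derive t 1 (fun t => f (x + t *: h) 0 s) ((h *m jacobian f (x + t *: h)) 0 s).
Proof.
move=> sf Ux; have [df _] := sf 1%N; have dfx := df _ Ux.
have Hd : derivable f (x + t *: h) h by apply: diff_derivable.
have Hds : derivable (fun y => f y 0 s) (x + t *: h) h by have/derivable_mxP := Hd; apply.
have E : (fun k : R => k^-1 *: ((fun t => f (x + t *: h) 0 s) (k *: 1 + t) - f (x + t *: h) 0 s)) =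
   (fun k : R => k^-1 *: ((fun y => f y 0 s) (k *: h + (x + t *: h)) - f (x + t *: h) 0 s)).
  apply/funext => k; congr (_ *: (f _ 0 s - _)).
  by rewrite [k *: 1]mulr1 scalerDl addrCA.
have -> : (h *m jacobian f (x + t *: h)) 0 s = 'D_h (fun y => f y 0 s) (x + t *: h).
  by rewrite -deriveEjacobian // derive_mx // mxE.
by apply: DeriveDef; rewrite /derivable /derive E.
Qed.

Lemma mean_value_approx U f x0 (d e : R) x y : smooth_on U f ->
  (forall z, cnear d x0 z -> U z /\ forall i s, `|jacobian f z i s - jacobian f x0 i s| <= e) ->
  cnear d x0 x -> cnear d x0 y -> forall s,
  `|f y 0 s - f x 0 s - ((y - x) *m jacobian f x0) 0 s| <= e * \sum_i `|y 0 i - x 0 i|.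
Proof.
move=> sf Hz Hx Hy s.
have Hseg (t : R) : 0 <= t <= 1 -> cnear d x0 (x + t *: (y - x)).
  move=> /andP [t0 t1] i; have h1 := Hx i; have h2 := Hy i; rewrite !mxE.
  move: h1 h2; rewrite !ler_norml; move: (x 0 i) (y 0 i) (x0 0 i) => a b c; nra.
have Hder (t : R) : 0 <= t <= 1 -> is_derive t 1 (fun t => f (x + t *: (y - x)) 0 s)
    (((y - x) *m jacobian f (x + t *: (y - x))) 0 s).
  by move=> Ht; apply: (@segment_derivative U); [|case: (Hz _ (Hseg t Ht))].
have [| |c Hc] := @MVT_segment R (fun t => f (x + t *: (y - x)) 0 s)
   (fun t => ((y - x) *m jacobian f (x + t *: (y - x))) 0 s) 0 1 ler01.
- by move=> t; rewrite in_itv /= => /andP [/ltW t0 /ltW t1]; apply: Hder; rewrite t0.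
- apply: continuous_in_subspaceT => t; rewrite inE /= in_itv /= => Ht.
  apply/differentiable_continuous/derivable1_diffP.
  by have [] := Hder t Ht.
have E1 : x + 1 *: (y - x) = y by rewrite scale1r addrC subrK.
have E0 : x + 0 *: (y - x) = x by rewrite scale0r addr0.
rewrite E1 E0 subr0 mulr1 => ->.
move: Hc; rewrite in_itv /= => Hc; have [_ HJ] := Hz _ (Hseg c Hc).
have -> : ((y - x) *m jacobian f (x + c *: (y - x))) 0 s - ((y - x) *m jacobian f x0) 0 s =
    \sum_i (y 0 i - x 0 i) * (jacobian f (x + c *: (y - x)) i s - jacobian f x0 i s).
  move: (jacobian f (x + c *: (y - x))) (jacobian f x0) => A B.
  by rewrite !mxE -sumrB; apply: eq_bigr => i _; rewrite !mxE; ring.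
rewrite mulr_sumr; apply: le_trans (ler_norm_sum _ _ _) _.
by apply: ler_sum => i _; rewrite normrM mulrC ler_wpM2r.
Qed.

Lemma lebesgue_number K (S : set 'rV[R]_n -> Prop) :
  (forall A B, A `<=` B -> S B -> S A) -> compact K ->
  (forall x, K x -> exists d : R, 0 < d /\ S [set y | cnear d x y]) ->
  exists d : R, 0 < d /\ forall x, K x -> S [set y | cnear d x y].
Proof.
move=> Smon /compact_near_coveringP cK HS.
have H := cK R (0^'+) (fun d x => S [set y | cnear d x y]) _.
have {}H : \forall d \near 0^'+, K `<=` (fun x => S [set y | cnear d x y]).
  apply: H => x Kx; have [d [d0 Hd]] := HS x Kx.
  exists ([set y | cnear (d / 2) x y], [set d' | d' < d / 2]).
    split; first by apply: cnear_near; rewrite divr_gt0.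
    by apply: nbhs_right_lt; rewrite divr_gt0.
  move=> [y d'] [/= Hy Hd']; apply: Smon Hd => z Hz i.
  have := Hy i; have := Hz i; rewrite !ler_norml; lra.
near (0 : R)^'+ => d; exists d; split; first by near: d; exact: nbhs_right_gt.
by near: d.
Unshelve. all: by end_near.
Qed.

(** The derivative is frozen at a point [xc] that the Lebesgue number argument supplies; [affine_at]
    later moves it to [x0]. *)
Definition affine_near U (f : 'rV[R]_n -> 'rV[R]_n) (e d : R) x0 :=
  exists2 xc, U xc & forall x, cnear d x0 x ->
    [/\ U x, forall i s, `|jacobian f x i s - jacobian f xc i s| <= e &
     forall y, cnear d x0 y -> forall s,
       `|f y 0 s - f x 0 s - ((y - x) *m jacobian f xc) 0 s| <= e * \sum_i `|y 0 i - x 0 i|].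

Lemma uniform_affine U f K (e : R) : open U -> smooth_on U f -> compact K ->
  K `<=` U -> 0 < e -> exists d : R, 0 < d /\ forall x0, K x0 -> affine_near U f e d x0.
Proof.
move=> oU sf cK KU e0.
apply: (@lebesgue_number K (fun A => exists2 xc, U xc & forall x, A x ->
    [/\ U x, forall i s, `|jacobian f x i s - jacobian f xc i s| <= e &
     forall y, A y -> forall s,
       `|f y 0 s - f x 0 s - ((y - x) *m jacobian f xc) 0 s| <= e * \sum_i `|y 0 i - x 0 i|])) => //.
  move=> A B AB [xc Uxc H]; exists xc => // x /AB /H [h1 h2 h3]; split=> // y /AB; exact: h3.
move=> x Kx; have [d [d0 Hd]] := jacobian_near oU sf (KU _ Kx) e0.
exists d; split=> //; exists x; first exact: KU.
move=> z /= Hz; have [Uz HJ] := Hd z Hz; split=> // w Hw s.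
exact: (mean_value_approx sf Hd).
Qed.

Lemma jacobian_bounded U f K : open U -> smooth_on U f -> compact K -> K `<=` U ->
  exists2 L : R, 0 <= L & forall x, K x -> forall i s, `|jacobian f x i s| <= L.
Proof.
move=> oU sf /compact_near_coveringP cK KU.
have H := cK R (+oo) (fun L x => forall i s, `|jacobian f x i s| <= L) _.
have {}H : \forall L \near +oo, K `<=` (fun x => forall i s, `|jacobian f x i s| <= L).
  apply: H => x Kx; have [d [d0 Hd]] := jacobian_near oU sf (KU _ Kx) ltr01.
  pose B := \sum_i \sum_s `|jacobian f x i s|.
  exists ([set y | cnear d x y], [set L | B + 1 < L]).
    by split; [apply: cnear_near | apply: nbhs_pinfty_gt; rewrite num_real].
  move=> [y L] [/= Hy HL] i s; have [_ HJ] := Hd y Hy; move: (HJ i s).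
  have : `|jacobian f x i s| <= B.
    rewrite /B (bigD1 i) //= (bigD1 s) //= -addrA lerDl addr_ge0 ?sumr_ge0 //.
    by move=> a _; rewrite sumr_ge0.
  move=> HB HJi; apply: le_trans (norm_le_dist HJi HB) (ltW HL).
near (+oo : set_system R) => L; exists L; first by near: L; apply: nbhs_pinfty_ge; rewrite num_real.
by near: L.
Unshelve. all: by end_near.
Qed.

End Analysis.

(** * Homotopy invariance for maps of pairs *)

Section Pairs.
Variables (R : realType) (n : nat) (a b : 'rV[R]_n) (r s : 'I_n -> R).
Variables (U : set 'rV[R]_n) (Phi : 'rV[R]_n -> 'rV[R]_n).
Hypothesis oU : open U.
Hypothesis UR : U `<=` rectangle a r.
Hypothesis HPhi : map_of_pairs U (rectangle b s) Phi.

Definition deep (m : R) (y : 'rV[R]_n) := forall i, b 0 i + m <= y 0 i <= b 0 i + s i - m.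

Definition core (m : R) : set 'rV[R]_n := [set x | U x /\ deep m (Phi x)].

Lemma smooth_continuous x : U x -> {for x, continuous Phi}.
Proof.
have [df _] := mp_smooth HPhi 1%N.
by move=> /df; exact: differentiable_continuous.
Qed.

Lemma near_coord (f : 'rV[R]_n -> 'rV[R]_n) (F : set_system 'rV[R]_n) (y : 'rV[R]_n) (e : R) : Filter F ->
  f @ F --> y -> 0 < e -> \forall x \near F, forall i, `|f x 0 i - y 0 i| <= e.
Proof.
move=> FF Hf e0; have := Hf _ (cnear_near y e0); rewrite /nbhs /=.
by apply: filterS.
Qed.

Lemma closure_U_rect x i : closure U x -> a 0 i <= x 0 i <= a 0 i + r i.
Proof.
move=> Cx.
have Hd d : 0 < d -> a 0 i - d <= x 0 i <= a 0 i + r i + d.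
  move=> d0; have [y [/UR Uy Hy]] := Cx _ (cnear_near x d0).
  have := Uy i; have := Hy i; rewrite ler_norml; lra.
apply/andP; split; apply/ler_addgt0Pr => e e0; have := Hd e e0; lra.
Qed.

Lemma core_closure m : 0 < m -> [set x | closure U x /\ deep m (Phi x)] `<=` U.
Proof.
move=> m0 x [Cx Dx]; apply: contrapT => nU.
have Bx : boundary U x by split=> // /interior_subset.
have [_] := mp_boundary HPhi Bx; apply.
apply: filterS (cnear_near (Phi x) m0) => y Hy i.
have := Hy i; have := Dx i; rewrite ler_norml; lra.
Qed.

(** Since the boundary of [U] is sent to the boundary of the target, the core does not change when
    [U] is replaced by its closure, on which the map is continuous; the core is therefore closed and
    bounded. *)
Lemma core_compact m : 0 < m -> compact (core m).
Proof.
move=> m0.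
have -> : core m = [set x | closure U x /\ deep m (Phi x)].
  apply/seteqP; split=> x [H1 H2]; split=> //; first exact: subset_closure.
  by apply: core_closure (conj H1 H2).
apply: bounded_closed_compact.
  pose M0 := \sum_i (`|a 0 i| + `|r i|).
  exists M0; split; first by rewrite num_real.
  move=> M HM x [Cx _] /=; rewrite [leLHS]/Num.Def.normr /= mx_normrE.
  have M00 : 0 <= M0 by apply: sumr_ge0 => i _; rewrite addr_ge0.
  apply: bigmax_le; first by lra.
  move=> [j i] _ /=; rewrite ord1 (le_trans _ (ltW HM)) //.
  apply: (@le_trans _ _ (`|a 0 i| + `|r i|)).
    have := closure_U_rect i Cx; have := ler_norm (r i); have := ler_norm (a 0 i).
    have := ler_norm (- a 0 i); rewrite normrN ler_norml; lra.
  rewrite /M0 (bigD1 i) //= lerDl; apply: sumr_ge0 => k _; by rewrite addr_ge0.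
move=> x Cx.
have CUx : closure U x.
  have : closure (closure U) x by move=> B /Cx [w [[Cw _] Bw]]; exists w.
  by rewrite -(iffLR (closure_id _) (@closed_closure _ U)).
split=> // i.
have /subspace_continuousP/(_ x CUx) Hcx := mp_continuous HPhi.
have Hd (e : R) : 0 < e -> b 0 i + m - e <= Phi x 0 i <= b 0 i + s i - m + e.
  move=> e0.
  have H : nbhs x (fun z => closure U z -> forall i, `|Phi z 0 i - Phi x 0 i| <= e).
    exact: (@near_coord Phi (within (closure U) (nbhs x)) (Phi x) e _ Hcx e0).
  have [y [[Cy Dy] Hy]] := Cx _ H.
  have := Hy Cy i; have := Dy i; rewrite ler_norml; lra.
apply/andP; split; apply/ler_addgt0Pr => e e0; have := Hd e e0; lra.
Qed.

Lemma core_sub m : core m `<=` U. Proof. by move=> x []. Qed.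

Lemma uniform_osc (m e : R) : 0 < m -> 0 < e -> exists d : R, 0 < d /\
  forall x, core m x -> forall y, cnear d x y -> U y /\ forall i, `|Phi y 0 i - Phi x 0 i| <= e.
Proof.
move=> m0 e0; have e20 : 0 < e / 2 by rewrite divr_gt0.
have [| | |d [d0 Hd]] := @lebesgue_number R n (core m) (fun A => forall y z, A y -> A z ->
    U z /\ forall i, `|Phi z 0 i - Phi y 0 i| <= e).
- by move=> A B AB H y z /AB Ay /AB Az; exact: H.
- exact: core_compact.
- move=> x [Ux _].
  have HU : \forall y \near x, U y by apply: open_nbhs_nbhs.
  have Hn : \forall y \near x, U y /\ forall i, `|Phi y 0 i - Phi x 0 i| <= e / 2.
    near=> y; split; near: y => //.
    exact: (@near_coord Phi (nbhs x) (Phi x) (e / 2) _ (smooth_continuous Ux) e20).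
  have [d [d0 Hd]] := near_cnear Hn; exists d; split=> // y z /= /Hd [_ Hy] /Hd [Uz Hz].
  split=> // i; have := Hy i; have := Hz i; rewrite !ler_norml; lra.
exists d; split=> // x Cx y Hy; apply: (Hd x Cx) => //= i.
by rewrite subrr normr0 ltW.
Unshelve. all: by end_near.
Qed.

Definition chi_core H m (y : torus n H -> 'rV[R]_n) (u : torus n H) : int := `[< core m (y u) >]%:R.

Definition bits H (y t : torus n H -> 'rV[R]_n) (i : 'I_n) (u : torus n H) : int :=
  pbit (Phi (y u) 0 i - t u 0 i).

Lemma chi_coreP H m (y : torus n H -> 'rV[R]_n) u : reflect (core m (y u)) (chi_core m y u != 0).
Proof.
rewrite /chi_core; case: asboolP => Hc; first by rewrite oner_eq0; constructor.
by rewrite eqxx; constructor.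
Qed.

Lemma chi_core_neq H m (y y' : torus n H -> 'rV[R]_n) u v :
  chi_core m y u != chi_core m y' v ->
  (core m (y u) /\ ~ core m (y' v)) \/ (core m (y' v) /\ ~ core m (y u)).
Proof.
by rewrite /chi_core; case: asboolP => h1; case: asboolP => h2; rewrite ?eqxx //; tauto.
Qed.

Section Step.
Variables (H : nat) (m d : R) (y y' t t' : torus n H -> 'rV[R]_n).
Hypothesis Hosc : forall x, core m x -> forall z, cnear d x z ->
  U z /\ forall i, `|Phi z 0 i - Phi x 0 i| <= m / 4.
Hypothesis Ht : forall u, deep (2 * m) (t u).
Hypothesis Ht' : forall u, deep (2 * m) (t' u).
Hypothesis Hin : forall u, U (y u) \/ U (y' u) -> forall i, (0 < u i < H)%N.
Hypothesis Hclose : forall u v w : torus n H, (forall i, (u i < H)%N) -> in_cell u v -> in_cell u w ->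
  [/\ cnear d (y w) (y v), cnear d (y w) (y' v), cnear d (y' w) (y v) & cnear d (y' w) (y' v)].

Lemma in_cell_refl (u : torus n H) : in_cell u u. Proof. by move=> i; rewrite leqnn leqnSn. Qed.

(** Where the core is left, some component of the map is within [m] of a face of the target. Over
    the cell it moves by at most [m / 2] more, while the labels stay [2 * m] away from the face, so
    its indicator is constant whatever the labels are. *)
Lemma exit_const z z' (u w w' : torus n H) : z = y \/ z = y' -> z' = y \/ z' = y' ->
  (forall i, (u i < H)%N) -> in_cell u w -> in_cell u w' ->
  core m (z w) -> ~ core m (z' w') ->
  exists i c, forall v, in_cell u v -> bits y t i v = c /\ bits y' t' i v = c.
Proof.
move=> Hz Hz' Hu Hw Hw' Cz nCz.
have Hall v : in_cell u v -> cnear d (z w) (y v) /\ cnear d (z w) (y' v).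
  by move=> Hv; have [h1 h2 h3 h4] := Hclose Hu Hv Hw; case: Hz => ->.
have Hzz : cnear d (z w) (z' w') by have [h1 h2] := Hall w' Hw'; case: Hz' => ->.
have [Uz' Oz'] := Hosc Cz Hzz.
have [i Hi] : exists i, ~ (b 0 i + m <= Phi (z' w') 0 i <= b 0 i + s i - m).
  by apply: contrapT => Hn; apply: nCz; split=> // i; apply: contrapT => Hi; apply: Hn; exists i.
have {}Hi : Phi (z' w') 0 i < b 0 i + m \/ b 0 i + s i - m < Phi (z' w') 0 i.
  by move/negP: Hi; rewrite negb_and -!ltNge => /orP.
have Hv2 v : in_cell u v -> `|Phi (y v) 0 i - Phi (z w) 0 i| <= m / 4 /\
    `|Phi (y' v) 0 i - Phi (z w) 0 i| <= m / 4.
  by move=> /Hall [h1 h2]; have [_ ->] := Hosc Cz h1; have [_ ->] := Hosc Cz h2.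
have := Oz' i; rewrite ler_norml => Oi.
case: Hi => Hi; [exists i, 0 | exists i, 1] => v /Hv2; rewrite !ler_norml => -[h1 h2];
  have := Ht v i; have := Ht' v i => h3 h4.
  by rewrite /bits !pbit_neg //; lra.
by rewrite /bits !pbit_pos //; lra.
Qed.

(** The indicators are changed under the old cutoff, then the cutoff itself: on the cubes where the
    two cutoffs differ the cup product vanishes. *)
Lemma top_step : tdeg (chi_core m y) (bits y t) = tdeg (chi_core m y') (bits y' t').
Proof.
transitivity (tdeg (chi_core m y) (bits y' t')).
  apply: tdeg_homotopy => u i Hne.
  have Hu : forall j, (u j < H)%N.
    case: (chi_core_neq Hne) => -[[Uy _] _] j; last first.
      by have /andP [] := Hin (or_introl Uy) j.
    have := Hin (or_introl Uy) j; rewrite ffunE; case: (j == i) => /andP [h1 h2] //.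
    by apply: torus_lt => E; move: h1; rewrite /= E modnn.
  split=> //.
  have Hc1 : in_cell u (tsh i u).
    by move=> j; rewrite tsh_val //; case: (j == i); rewrite ?addn0 ?addn1 ?leqnn ?leqnSn.
  have Hc0 := in_cell_refl u.
  case: (chi_core_neq Hne) => -[C1 C2].
    by apply: (@exit_const y y u (tsh i u) u) => //; left.
  by apply: (@exit_const y y u u (tsh i u)) => //; left.
apply: eq_bigr => u _.
have [->//|Hne] := eqVneq (chi_core m y u) (chi_core m y' u).
have Hu : forall j, (u j < H)%N.
  move=> j; suff /andP [] : (0 < u j < H)%N by [].
  by apply: Hin; case: (chi_core_neq Hne) => -[[Uy _] _]; [left|right].
have [i [c Hc]] : exists i c, forall v, in_cell u v -> bits y t i v = c /\ bits y' t' i v = c.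
  have Hc0 := in_cell_refl u.
  case: (chi_core_neq Hne) => -[C1 C2].
    by apply: (@exit_const y y' u u u) => //; [left|right].
  by apply: (@exit_const y' y u u u) => //; [right|left].
have -> : ccup (@tsh n H) [seq bits y' t' i | i <- enum 'I_n] u (enum 'I_n) = 0.
  apply: (@ccup_const _ _ _ (fun _ => 0) _ i c); first by rewrite size_map size_enum_ord.
  move=> v /(in_cube_cell Hu) /Hc [_ <-].
  by rewrite (nth_map i) ?size_enum_ord // nth_ord_enum.
by rewrite !mulr0.
Qed.

End Step.

Lemma top_homotopy H (m d B : R) (y0 y1 t t1 : torus n H -> 'rV[R]_n) :
  0 < m -> 0 < d -> 0 <= B ->
  (forall x, core m x -> forall z, cnear d x z ->
    U z /\ forall i, `|Phi z 0 i - Phi x 0 i| <= m / 4) ->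
  (forall u, deep (2 * m) (t u)) -> (forall u, deep (2 * m) (t1 u)) ->
  (forall u v w : torus n H, (forall i, (u i < H)%N) -> in_cell u v -> in_cell u w ->
     cnear (d / 2) (y0 w) (y0 v) /\ cnear (d / 2) (y1 w) (y1 v)) ->
  (forall u i, `|y1 u 0 i - y0 u 0 i| <= B) ->
  (forall (q : R) u, 0 <= q <= 1 -> U ((1 - q) *: y0 u + q *: y1 u) ->
     forall i, (0 < u i < H)%N) ->
  tdeg (chi_core m y0) (bits y0 t) = tdeg (chi_core m y1) (bits y1 t1).
Proof.
move=> m0 d0 B0 Hosc Ht Ht1 Hcl HB Hin.
pose Y (q : R) u := (1 - q) *: y0 u + q *: y1 u.
(* One step of the straight-line homotopy then moves a point by at most [d / 2], and the spread over
   a cell uses the other half of [d]. *)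
pose N := (Num.truncn (B * 2 / d)).+1.
have N0 : 0 < N%:R :> R by rewrite ltr0n.
have HN : B / N%:R <= d / 2.
  have := truncnS_gt (B * 2 / d); rewrite -/N ltr_pdivrMr // ler_pdivrMr //.
  by set z := N%:R; clearbody z; lra.
have HY (q q' : R) (u v w : torus n H) : 0 <= q <= 1 -> `|q - q'| <= N%:R^-1 ->
    (forall i, (u i < H)%N) -> in_cell u v -> in_cell u w -> cnear d (Y q' w) (Y q v).
  move=> /andP [q0 q1] Hq Hu Hv Hw i; have [h1 h2] := Hcl u v w Hu Hv Hw.
  have := h1 i; have := h2 i; have := HB w i; rewrite !mxE.
  move: (y0 v 0 i) (y1 v 0 i) (y0 w 0 i) (y1 w 0 i) => A0 A1 C0 C1 g1 g2 g3.
  have -> : (1 - q) * A0 + q * A1 - ((1 - q') * C0 + q' * C1) =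
     ((1 - q) * (A0 - C0) + q * (A1 - C1)) + (q - q') * (C1 - C0) by ring.
  apply: le_trans (ler_normD _ _) _.
  have : `|(q - q') * (C1 - C0)| <= d / 2.
    by rewrite normrM mulrC; apply: le_trans HN; apply: ler_pM.
  have : `|(1 - q) * (A0 - C0) + q * (A1 - C1)| <= d / 2.
    rewrite ler_norml; move: g2 g3; rewrite !ler_norml; nra.
  lra.
have HY0 : Y 0 = y0 by apply/funext => u; rewrite /Y subr0 scale1r scale0r addr0.
have HY1 : Y 1 = y1 by apply/funext => u; rewrite /Y subrr scale1r scale0r add0r.
have Hq k : (k <= N)%N -> 0 <= (k%:R / N%:R : R) <= 1.
  by move=> Hk; rewrite divr_ge0 ?ler0n //= ler_pdivrMr // mul1r ler_nat.
have Hstep k t' : (k < N)%N -> (forall u, deep (2 * m) (t' u)) ->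
   tdeg (chi_core m (Y (k%:R / N%:R))) (bits (Y (k%:R / N%:R)) t') =
   tdeg (chi_core m (Y (k.+1%:R / N%:R))) (bits (Y (k.+1%:R / N%:R)) t1).
  move=> Hk Ht'. apply: (top_step Hosc Ht' Ht1).
    by move=> u [] Hu; apply: Hin Hu; apply: Hq => //; exact: ltnW.
  move=> u v w Hu Hv Hw.
  have E0 (x : R) : `|x - x| <= N%:R^-1 by rewrite subrr normr0 invr_ge0 ltW.
  have E1 : `|k.+1%:R / N%:R - k%:R / N%:R| <= N%:R^-1 :> R.
    by rewrite -mulrBl -natrB // subSnn mul1r ger0_norm // invr_ge0 ltW.
  by split; apply: (HY _ _ u) => //; rewrite 1?distrC //; apply: Hq => //; exact: ltnW.
have Hall k : (k < N)%N -> tdeg (chi_core m y0) (bits y0 t) =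
   tdeg (chi_core m (Y (k.+1%:R / N%:R))) (bits (Y (k.+1%:R / N%:R)) t1).
  elim: k => [|k IH] Hk; last by rewrite IH 1?ltnW // Hstep.
  by rewrite -{1 2}HY0; have := Hstep 0%N t Hk Ht; rewrite mul0r.
have := Hall N.-1 (leqnn _); rewrite prednK // divff ?gt_eqF // HY1.
by [].
Qed.

End Pairs.

(** * Existence of a regular value by counting *)

Section Sard.
Variables (R : realType) (n : nat) (a b : 'rV[R]_n) (r s : 'I_n -> R).
Variables (U : set 'rV[R]_n) (Phi : 'rV[R]_n -> 'rV[R]_n).
Hypothesis oU : open U.
Hypothesis UR : U `<=` rectangle a r.
Hypothesis HPhi : map_of_pairs U (rectangle b s) Phi.

Lemma dist_add (A p q x y : R) : `|A - q| <= x -> `|p - q| <= y -> `|A - p| <= x + y.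
Proof.
move=> h1 h2; have -> : A - p = (A - q) - (p - q) by ring.
by apply: le_trans (ler_normB _ _) _; apply: lerD.
Qed.

(** Moving the derivative from the unknown centre to [x0] costs a second error of the same size. *)
Lemma affine_at (e d : R) x0 x : U x0 -> affine_near U Phi e d x0 -> 0 <= d -> cnear d x0 x ->
  forall i, `|Phi x 0 i - Phi x0 0 i - ((x - x0) *m jacobian Phi x0) 0 i|
     <= 2 * e * (n%:R * d).
Proof.
move=> Ux0 [xc Uxc H] d0 Hx i.
have Hx0 : cnear d x0 x0 by move=> j; rewrite subrr normr0.
have [_ HJ Ha] := H x0 Hx0; have h1 := Ha x Hx i.
have Hs : \sum_j `|x 0 j - x0 0 j| <= n%:R * d.
  have -> : n%:R * d = \sum_(j < n) d by rewrite sumr_const card_ord mulr_natl.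
  by apply: ler_sum => j _; exact: Hx.
have e0 : 0 <= e by apply: le_trans (HJ i i).
have h2 : `|((x - x0) *m jacobian Phi x0) 0 i - ((x - x0) *m jacobian Phi xc) 0 i| <=
   n%:R * (d * e).
  have -> : ((x - x0) *m jacobian Phi x0) 0 i - ((x - x0) *m jacobian Phi xc) 0 i =
     ((x - x0) *m (jacobian Phi x0 - jacobian Phi xc)) 0 i.
    move: (jacobian Phi x0) (jacobian Phi xc) => A B.
    by rewrite mulmxBr; move: (_ *m A) (_ *m B) => P Q; rewrite !mxE.
  apply: mulmx_entry_le => // [j|j]; first by rewrite !mxE; exact: Hx.
  move: (HJ j i); move: (jacobian Phi x0) (jacobian Phi xc) => A B.
  by rewrite !mxE.
have h3 : e * \sum_j `|x 0 j - x0 0 j| <= e * (n%:R * d) by rewrite ler_wpM2l.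
have -> : 2 * e * (n%:R * d) = e * (n%:R * d) + n%:R * (d * e) by ring.
exact: dist_add (le_trans h1 h3) h2.
Qed.

(** A counting form of Sard's theorem. The candidates form a grid in a cube of side [m] that starts
    [2 * m] inside the target, which explains [5 * m]. In a small cube of the domain the critical
    values lie near an affine image with determinant 0, so each small cube spoils few candidates. *)
Lemma regular_value_exists (m : R) : (0 < n)%N -> 0 < m -> (forall i, 5 * m <= s i) ->
  exists y, deep b s (2 * m) y /\
    forall x, U x -> Phi x = y -> \det (jacobian Phi x) != 0.
Proof.
move=> n0 m0 Hs.
pose K := core b s U Phi m.
have cK : compact K := core_compact UR HPhi m0.
have KU : K `<=` U := @core_sub _ _ b s U Phi m.
have [L L0 HL] := jacobian_bounded oU (mp_smooth HPhi) cK KU.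
have [C [C0 HC]] := affine_count R n.
pose rho := \sum_i `|r i| + 1.
have rho0 : 0 < rho by rewrite ltr_wpDl // sumr_ge0.
have Hrho i : r i < rho.
  apply: le_lt_trans (ler_norm _) _; rewrite /rho (bigD1 i) //= -addrA ltrDl.
  by rewrite ltr_wpDl // sumr_ge0.
(* All spoiled candidates together, weighted by [h ^+ n], amount to at most [e * W], against
   [m ^+ n] for all candidates. *)
pose W := rho ^+ n * (C * (2 * n%:R * (L + 2 * n%:R) ^+ n.-1)).
have W0 : 0 <= W.
  rewrite /W mulr_ge0 ?exprn_ge0 ?(ltW rho0) // mulr_ge0 ?(ltW C0) //.
  by rewrite mulr_ge0 ?exprn_ge0 ?addr_ge0 ?mulr_ge0.
pose e := Num.min 1 (m ^+ n / 2 / (W + 1)).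
have e0 : 0 < e by rewrite lt_min ltr01 !divr_gt0 ?exprn_gt0 // ltr_wpDl.
have e1 : e <= 1 by rewrite ge_min lexx.
have He : e * W < m ^+ n.
  apply: (@le_lt_trans _ _ (m ^+ n / 2 / (W + 1) * W)).
    by rewrite ler_wpM2r // ge_min lexx orbT.
  have h0 : 0 < m ^+ n by rewrite exprn_gt0.
  rewrite mulrAC ltr_pdivrMr ?ltr_wpDl //; nra.
have [d' [d'0 Hd']] := uniform_affine oU (mp_smooth HPhi) cK KU e0.
pose G := (Num.truncn (rho / d')).+1.
have G0 : 0 < G%:R :> R by rewrite ltr0n.
pose d := rho / G%:R.
have d0 : 0 < d by rewrite divr_gt0.
have dd' : d <= d'.
  rewrite ler_pdivrMr // mulrC -ler_pdivrMr // ltW //; exact: truncnS_gt.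
pose e' := 2 * e * (n%:R * d).
have nR0 : 0 < n%:R :> R by rewrite ltr0n.
have e'0 : 0 < e' by apply: mulr_gt0; apply: mulr_gt0.
pose M := (Num.truncn (m / e')).+1.
have M0 : 0 < M%:R :> R by rewrite ltr0n.
pose h := m / M%:R.
have h0 : 0 < h by rewrite divr_gt0.
have he : h <= e'.
  rewrite ler_pdivrMr // mulrC -ler_pdivrMr // ltW //; exact: truncnS_gt.
pose y (t : {ffun 'I_n -> 'I_M}) : 'rV[R]_n := \row_i (b 0 i + 2 * m + h * (t i)%:R).
pose cube (g : {ffun 'I_n -> 'I_G}) (x : 'rV[R]_n) :=
  forall i, a 0 i + (g i)%:R * d <= x 0 i <= a 0 i + (g i).+1%:R * d.
pose E g : {set {ffun 'I_n -> 'I_M}} := [set t | `[< exists x, [/\ U x, Phi x = y t,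
   \det (jacobian Phi x) = 0 & cube g x] >]]%SET.
have EP g t : t \in E g -> exists x, [/\ U x, Phi x = y t,
    \det (jacobian Phi x) = 0 & cube g x].
  by rewrite /E finset.in_set => /asboolP.
have Hdeep t : deep b s (2 * m) (y t).
  move=> i; rewrite mxE; have ht : h * (t i)%:R <= m.
    by rewrite /h mulrAC ler_pdivrMr // ler_pM2l // ler_nat ltnW.
  have ht0 : 0 <= h * (t i)%:R by rewrite mulr_ge0 // ltW.
  have := Hs i; lra.
have HK t x : U x -> Phi x = y t -> K x.
  move=> Ux Ex; split=> // i; rewrite Ex; have := Hdeep t i; lra.
have Hcov x : U x -> exists g, cube g x.
  move=> Ux.
  have Hg i : exists gi : 'I_G, a 0 i + gi%:R * d <= x 0 i <= a 0 i + gi.+1%:R * d.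
    have := UR Ux i; have := Hrho i => h1 h2.
    have q0 : 0 <= (x 0 i - a 0 i) / d by rewrite divr_ge0 ?(ltW d0) //; lra.
    have /andP [t1 t2] := truncn_itv q0.
    have Hlt : (Num.truncn ((x 0 i - a 0 i) / d)%R < G)%N.
      rewrite truncn_lt_nat // ltr_pdivrMr // /d mulrC divfK ?gt_eqF //; lra.
    exists (Ordinal Hlt) => /=.
    move: t1 t2; rewrite ler_pdivlMr // ltr_pdivrMr //; lra.
  have /choice [g Hg'] : forall i, exists gi : 'I_G,
     a 0 i + gi%:R * d <= x 0 i <= a 0 i + gi.+1%:R * d by [].
  by exists [ffun i => g i] => i; rewrite ffunE.
have Hcount g : #|E g|%:R * h ^+ n <= C * (e' * (L * d + e') ^+ n.-1).
  have [->|[t0]] := finset.set_0Vmem (E g).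
    rewrite cards0 mul0r; apply: mulr_ge0; first exact: ltW.
    apply: mulr_ge0; first exact: ltW.
    apply: exprn_ge0; apply: addr_ge0; last exact: ltW.
    by apply: mulr_ge0 => //; exact: ltW.
  move=> /EP [x0 [Ux0 Ex0 Dx0 Cx0]].
  have Kx0 := HK _ _ Ux0 Ex0.
  apply: le_trans (HC M (jacobian Phi x0) d e' h L
     (fun i => b 0 i + 2 * m - Phi x0 0 i) (E g) h0 he (ltW d0) (HL _ Kx0) L0 _) _.
    move=> t /EP [x [Ux Ex _ Cx]]; exists (x - x0); split.
      move=> i; rewrite !mxE; have := Cx i; have := Cx0 i.
      rewrite !mulrSr !mulrDl !mul1r ler_norml; lra.
    move=> i.
    have Hx : cnear d' x0 x.
      move=> j; have := Cx j; have := Cx0 j.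
      rewrite !mulrSr !mulrDl !mul1r ler_norml; lra.
    have Hxd : cnear d x0 x.
      move=> j; have := Cx j; have := Cx0 j.
      rewrite !mulrSr !mulrDl !mul1r ler_norml; lra.
    have Ha : affine_near U Phi e d x0.
      have [xc Uxc Hxc] := Hd' x0 Kx0; exists xc => // z Hz.
      have Hz' : cnear d' x0 z by move=> j; apply: le_trans (Hz j) dd'.
      have [uz1 uz2 uz3] := Hxc z Hz'; split=> // w Hw; apply: uz3 => j.
      by apply: le_trans (Hw j) dd'.
    have -> : h * (t i)%:R + (b 0 i + 2 * m - Phi x0 0 i) = Phi x 0 i - Phi x0 0 i.
      by rewrite Ex mxE; ring.
    exact: (affine_at Ux0 Ha (ltW d0) Hxd).
  by rewrite Dx0 normr0 mul0r add0r n0 mul1r.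
have [t Ht] : exists t, forall g, t \notin E g.
  apply: exists_uncovered; rewrite -(@ltr_nat R) natr_sum card_ffun !card_ord.
  have hn0 : 0 < h ^+ n by rewrite exprn_gt0.
  rewrite -(ltr_pM2r hn0) mulr_suml natrX -exprMn.
  have -> : M%:R * h = m by rewrite mulrC divfK // gt_eqF.
  apply: le_lt_trans He.
  apply: (@le_trans _ _ (\sum_(g : {ffun 'I_n -> 'I_G}) C * (e' * (L * d + e') ^+ n.-1))).
    by apply: ler_sum.
  rewrite sumr_const card_ffun !card_ord -[leLHS]mulr_natl natrX.
  have Er : rho = G%:R * d by rewrite mulrC divfK // gt_eqF.
  have Hle : e' * (L * d + e') ^+ n.-1 <= e * (2 * n%:R * (L + 2 * n%:R) ^+ n.-1) * d ^+ n.
    have -> : d ^+ n = d * d ^+ n.-1 by rewrite -exprS prednK.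
    have -> : e * (2 * n%:R * (L + 2 * n%:R) ^+ n.-1) * (d * d ^+ n.-1) =
       e' * ((L + 2 * n%:R) * d) ^+ n.-1.
      rewrite /e' [((L + 2 * n%:R) * d) ^+ _]exprMn.
      by set X := (L + 2 * n%:R) ^+ _; set Y := d ^+ _; ring.
    have P1 : 0 <= L * d + e' by apply: addr_ge0; [apply: mulr_ge0 => //; exact: ltW | exact: ltW].
    have P3 : L * d + e' <= (L + 2 * n%:R) * d.
      rewrite mulrDl lerD2l /e' mulrAC -[leLHS]mulrA -[leRHS]mulrA ler_pM2l //.
      by rewrite -[leRHS]mul1r mulrC ler_wpM2r // mulr_ge0 // ltW.
    have P2 := le_trans P1 P3.
    by rewrite ler_pM2l // lerXn2r.
  have -> : e * W = G%:R ^+ n * (C * (e * (2 * n%:R * (L + 2 * n%:R) ^+ n.-1) * d ^+ n)).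
    by rewrite /W Er [(G%:R * d) ^+ _]exprMn; set X := (L + 2 * n%:R) ^+ _; set Y := d ^+ _; ring.
  by rewrite ler_wpM2l ?exprn_ge0 ?ler0n // ler_wpM2l // ltW.
exists (y t); split=> // x Ux Ex; apply/negP => /eqP Dx.
have [g Cg] := Hcov x Ux; have := Ht g; rewrite /E finset.in_set => /negP; apply.
by apply/asboolP; exists x.
Qed.

End Sard.

(** * Local degree at a nondegenerate zero *)

Lemma tpos_cell (R : realType) n H (dl : R) (u v : torus n H) j : 0 <= dl -> in_cell u v ->
  `|tpos dl v 0 j - tpos dl u 0 j| <= dl.
Proof.
move=> d0 /(_ j) /andP [h1 h2]; rewrite !mxE -mulrBr normrM (ger0_norm d0) -natrB //.
by rewrite normr_nat ler_piMr // lern1 leq_subLR addn1.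
Qed.

(** On the shell of the box some component of the linear part is at least [c * rho / 2 / N], whereas
    the nonlinear error and the variation over a cell are at most [c * rho / 8 / N] each. So [g] and
    its linear part have a common constant sign there. *)
Lemma local_degree (R : realType) n (A : 'M[R]_n.+1) (g : 'rV[R]_n.+1 -> 'rV[R]_n.+1) (z0 : 'rV[R]_n.+1) :
  \det A != 0 ->
  (forall e : R, 0 < e -> exists d : R, 0 < d /\ forall z, cnear d z0 z -> forall s,
     `|g z 0 s - ((z - z0) *m A) 0 s| <= e * \sum_i `|z 0 i - z0 0 i|) ->
  exists rho0 : R, 0 < rho0 /\ forall rho, 0 < rho -> rho <= rho0 ->
  exists d0 : R, 0 < d0 /\ forall H (dl : R), 0 < dl -> dl <= d0 ->
    (forall i, rho + 2 * dl <= z0 0 i) ->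
    (forall i, z0 0 i + rho + 2 * dl <= dl * H%:R) ->
    tdeg (tbox (H := H) dl rho z0) (fun s u => pbit (g (tpos dl u) 0 s)) = sgz (\det A).
Proof.
move=> detA Hg.
have [B [B0 HB]] : exists B : R, 0 < B /\ forall i j, `|A i j| <= B.
  exists (1 + \sum_i \sum_j `|A i j|); split.
    by rewrite ltr_pwDl // sumr_ge0 // => i _; rewrite sumr_ge0.
  move=> i j; rewrite (bigD1 i) //= (bigD1 j) //= [leRHS]addrC -!addrA lerDl.
  rewrite addr_ge0 ?sumr_ge0 // addr_ge0 // sumr_ge0 // => k _; by rewrite sumr_ge0.
have detA0 : 0 < `|\det A| by rewrite normr_gt0.
pose c : R := `|\det A| / (n`!%:R * B ^+ n).
have q0 : 0 < n`!%:R * B ^+ n by apply: mulr_gt0; rewrite ?exprn_gt0 // ltr0n fact_gt0.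
have c0 : 0 < c by rewrite divr_gt0.
have Hc (x : 'rV[R]_n.+1) i : c * `|x 0 i| <= \sum_s `|(x *m A) 0 s|.
  rewrite /c mulrAC ler_pdivrMr // mulrC [leRHS]mulrC mulrC.
  exact: mulmx_lower_bound (ltW B0).
pose N : R := n.+1%:R.
have N0 : 0 < N by rewrite ltr0n.
have N1 : 1 <= N by rewrite ler1n.
(* Chosen so that [e * (N * (2 * rho))] equals [c * rho / 8 / N]. *)
pose e : R := c / (16 * N ^+ 2).
have e0 : 0 < e by rewrite divr_gt0 // mulr_gt0 // exprn_gt0.
have [d [d0 Hd]] := Hg e e0.
exists (d / 2); split; first by rewrite divr_gt0.
move=> rho rho0 rhod.
have [d1 [d10 Hd1]] := linear_degree detA rho0.
pose d2 : R := c * rho / (8 * N ^+ 2 * B).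
have p0 : 0 < 8 * N ^+ 2 * B by rewrite mulr_gt0 // mulr_gt0 // exprn_gt0.
have d20 : 0 < d2 by rewrite divr_gt0 // mulr_gt0.
exists (Num.min d1 (Num.min d2 (rho / 4))); split.
  by rewrite !lt_min d10 d20 divr_gt0.
move=> H dl dl0; rewrite !le_min => /and3P [dl1 dl2 dl3] Hlo Hhi.
rewrite -(Hd1 H dl z0 dl0 dl1 Hlo Hhi).
apply: (@box_homotopy R n.+1 H dl rho z0 (fun u => g (tpos dl u))
  (fun u => (tpos dl u - z0) *m A)) => // u Hu [j Hj].
pose x := tpos dl u - z0.
have xE i : x 0 i = tpos dl u 0 i - z0 0 i by rewrite /x mxE [(- z0) 0 i]mxE.
have [s Hs] := sum_ge_ex (Hc x j).
exists s, (pbit ((x *m A) 0 s)).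
have Hs' : c * rho / 2 / N <= `|(x *m A) 0 s|.
  apply: le_trans Hs; rewrite ler_pM2r ?invr_gt0 // -mulrA ler_pM2l // xE.
  by apply: le_trans Hj; lra.
move=> v Hv.
have Hvu i : `|tpos dl v 0 i - tpos dl u 0 i| <= dl by apply: tpos_cell => //; exact: ltW.
have Hvz i : `|tpos dl v 0 i - z0 0 i| <= 2 * rho.
  have := Hvu i; have := Hu i; rewrite !ler_norml; lra.
have E1 : `|((tpos dl v - z0) *m A) 0 s - (x *m A) 0 s| <= c * rho / 8 / N.
  have -> : ((tpos dl v - z0) *m A) 0 s - (x *m A) 0 s = ((tpos dl v - tpos dl u) *m A) 0 s.
    have -> : tpos dl v - tpos dl u = (tpos dl v - z0) - x.
      by rewrite /x opprB addrA addrNK.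
    by rewrite [in RHS]mulmxBl; move: (_ *m A) (x *m A) => P Q; rewrite !mxE.
  apply: (@le_trans _ _ (n.+1%:R * (dl * B)) _ _ _); first apply: mulmx_entry_le => //.
  - move=> i; have := Hvu i.
    by move: (tpos dl v) (tpos dl u) => P Q; rewrite !mxE.
  - exact: ltW.
  have -> : c * rho / 8 / N = N * (d2 * B).
    rewrite /d2; field; rewrite -/N; by rewrite !gt_eqF.
  by rewrite ler_pM2l // ler_pM2r.
have E2 : `|g (tpos dl v) 0 s - ((tpos dl v - z0) *m A) 0 s| <= c * rho / 8 / N.
  have Hz : cnear d z0 (tpos dl v).
    by move=> i; apply: le_trans (Hvz i) _; lra.
  apply: le_trans (Hd _ Hz s) _.
  apply: (@le_trans _ _ (e * (N * (2 * rho)))).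
    rewrite ler_pM2l //; apply: (@le_trans _ _ (\sum_(i < n.+1) 2 * rho)).
      by apply: ler_sum => i _; exact: Hvz.
    by rewrite sumr_const card_ord -[leLHS]mulr_natl.
  rewrite le_eqVlt; apply/orP; left; apply/eqP.
  by rewrite /e; field; rewrite -/N; rewrite !gt_eqF.
have pos : 0 < c * rho / N by rewrite divr_gt0 // mulr_gt0.
have Eh (k : R) : c * rho / k / N = (c * rho / N) / k by rewrite mulrAC.
split; apply: pbit_close; apply: lt_le_trans Hs'.
  have Ht := le_trans (ler_distD (((tpos dl v - z0) *m A) 0 s) _ _) (lerD E2 E1).
  by apply: le_lt_trans Ht _; rewrite !Eh; move: (c * rho / N) pos => X; clear; lra.
by apply: le_lt_trans E1 _; rewrite !Eh; move: (c * rho / N) pos => X; clear; lra.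
Qed.

(** * The lattice degree with a constant regular label is the degree of the map *)

Section AffineDegree.
Variables (R : realType) (n : nat) (a b : 'rV[R]_n.+1) (r s : 'I_n.+1 -> R).
Variables (U : set 'rV[R]_n.+1) (Phi : 'rV[R]_n.+1 -> 'rV[R]_n.+1).
Hypothesis oU : open U.
Hypothesis UR : U `<=` rectangle a r.
Hypothesis HPhi : map_of_pairs U (rectangle b s) Phi.
Variables (m : R) (y : 'rV[R]_n.+1).
Hypothesis m0 : 0 < m.
Hypothesis Dy : deep b s (2 * m) y.
Hypothesis ry : forall x, U x -> Phi x = y -> \det (jacobian Phi x) != 0.

Lemma preim_core x : U x -> Phi x = y -> core b s U Phi m x.
Proof. by move=> Ux E; split=> // i; rewrite E; have := Dy i; move: m0; lra. Qed.

(** Two close preimages would differ by a vector that the invertible Jacobian nearly annihilates;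
    compactness of the core makes the separation uniform. *)
Lemma preim_isolated : exists d : R, 0 < d /\ forall x z, U x -> Phi x = y -> U z -> Phi z = y ->
  cnear d x z -> x = z.
Proof.
have [| | |d [d0 Hd]] := @lebesgue_number R n.+1 (core b s U Phi m) (fun A => forall x z, A x -> A z ->
    U x -> Phi x = y -> U z -> Phi z = y -> x = z).
- by move=> A B AB H x z /AB Ax /AB Az; exact: H.
- exact: (core_compact UR HPhi m0).
- move=> x [Ux Dx].
  have [E|nE] := pselect (Phi x = y); last first.
    have [i Hi] : exists i, Phi x 0 i != y 0 i.
      apply: contrapT => Hn; apply: nE; apply/rowP => i.
      by apply/eqP/negPn/negP => Hi; apply: Hn; exists i.
    have e0 : 0 < `|Phi x 0 i - y 0 i| / 2 by rewrite divr_gt0 // normr_gt0 subr_eq0.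
    have [d [d0 Hd]] := near_cnear (near_coord (nbhs_filter x) (smooth_continuous HPhi Ux) e0).
    exists d; split=> // z w /= /Hd /(_ i) Hz _ _ Ez; exfalso; move: Hz; rewrite Ez distrC.
    by move: e0; lra.
  have dJ := ry Ux E; have dJ0 : 0 < `|\det (jacobian Phi x)| by rewrite normr_gt0.
  pose B : R := 1 + \sum_i \sum_j `|jacobian Phi x i j|.
  have HB i j : `|jacobian Phi x i j| <= B.
    rewrite /B (bigD1 i) //= (bigD1 j) //= [leRHS]addrC -!addrA lerDl.
    rewrite addr_ge0 ?sumr_ge0 // addr_ge0 // sumr_ge0 // => k _; by rewrite sumr_ge0.
  have B0 : 0 < B by rewrite ltr_pwDl // sumr_ge0 // => i _; rewrite sumr_ge0.
  pose q : R := n`!%:R * B ^+ n.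
  have q0 : 0 < q by apply: mulr_gt0; rewrite ?exprn_gt0 // ltr0n fact_gt0.
  have N0 : 0 < n.+1%:R :> R by rewrite ltr0n.
  pose e : R := `|\det (jacobian Phi x)| / (2 * (q * n.+1%:R * n.+1%:R)).
  have e0 : 0 < e.
    by apply: divr_gt0 => //; apply: mulr_gt0 => //; apply: mulr_gt0 => //; apply: mulr_gt0.
  have [d [d0 Hd]] := jacobian_near oU (mp_smooth HPhi) Ux e0.
  exists d; split=> // z w /= Hz Hw Uz Ez Uw Ew.
  have Hm i := mean_value_approx (mp_smooth HPhi) Hd Hz Hw i.
  pose S := \sum_i `|w 0 i - z 0 i|.
  have S0 : 0 <= S by rewrite sumr_ge0.
  have Hi i : `|\det (jacobian Phi x)| * `|(w - z) 0 i| <= q * (n.+1%:R * (e * S)).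
    apply: le_trans (@mulmx_lower_bound _ n (jacobian Phi x) B _ (w - z) i HB dJ0 (lexx _) (ltW B0)) _.
    rewrite -/q ler_pM2l //; apply: (@le_trans _ _ (\sum_(i < n.+1) e * S)).
      apply: ler_sum => k _; have := Hm k; rewrite Ez Ew subrr sub0r normrN; exact.
    by rewrite sumr_const card_ord -[leLHS]mulr_natl.
  have HS : `|\det (jacobian Phi x)| * S <= n.+1%:R * (q * (n.+1%:R * (e * S))).
    rewrite /S mulr_sumr; apply: (@le_trans _ _ (\sum_(i < n.+1) q * (n.+1%:R * (e * S)))).
      apply: ler_sum => k _; have := Hi k.
      by rewrite mxE [(- z) 0 k]mxE.
    by rewrite sumr_const card_ord -[leLHS]mulr_natl.
  have E2 : n.+1%:R * (q * (n.+1%:R * (e * S))) = `|\det (jacobian Phi x)| * S / 2.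
    rewrite /e; field; by rewrite !gt_eqF.
  rewrite E2 in HS.
  have S00 : S = 0.
    apply/eqP; rewrite eq_le S0 andbT leNgt; apply/negP => S1.
    move: (mulr_gt0 dJ0 S1) HS; set X := _ * S; lra.
  apply/rowP => i; apply/eqP; rewrite eq_sym -subr_eq0 -normr_eq0; apply/eqP.
  by have/psumr_eq0P := S00; apply.
exists d; split=> // x z Ux Ex Uz Ez Hz; apply: (Hd x (preim_core Ux Ex)) => //= i.
by rewrite subrr normr0 ltW.
Qed.

Lemma preim_finite : finite_set [set x | U x /\ Phi x = y].
Proof.
have [d [d0 Hd]] := preim_isolated.
have := core_compact UR HPhi m0; rewrite compact_cover => /(_ _ setT (fun x => ball x (d / 2))).
have d20 : 0 < d / 2 by rewrite divr_gt0.
case; first by move=> x _; exact: ball_open.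
  by move=> x _; exists x => //; exact: ballxx.
move=> D _ Hcov.
have Hfin := bigcup_finite (F := fun x => [set z | (U z /\ Phi z = y) /\ ball x (d / 2) z]) (finite_fset D).
apply: (sub_finite_set _ (Hfin _)).
  move=> x [Ux Ex]; have [i Di Hi] := Hcov x (preim_core Ux Ex); by exists i.
move=> x _; have [->|/set0P [z0 [[Uz0 Ez0] Hz0]]] := eqVneq [set z | (U z /\ Phi z = y) /\ ball x (d / 2) z] set0.
  exact: finite_set0.
apply: (@sub_finite_set _ _ [set z0]); last exact: finite_set1.
move=> z [[Uz Ez] Hz] /=; apply/esym; apply: Hd => // i.
  have : `|x 0 i - z0 0 i| < d / 2 by case: Hz0 => _ /(_ 0 i).
  have : `|x 0 i - z 0 i| < d / 2 by case: Hz => _ /(_ 0 i).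
  rewrite !ltr_norml ler_norml; lra.
Qed.

(** Provides an indicator that is constant on each fine cell of the core away from the preimages. *)
Lemma preim_far (rho : R) : 0 < rho -> exists c : R, 0 < c /\ forall x, core b s U Phi m x ->
  (exists z, [/\ U z, Phi z = y & cnear rho z x]) \/ exists i, c <= `|Phi x 0 i - y 0 i|.
Proof.
move=> rho0; have /compact_near_coveringP cK := core_compact UR HPhi m0.
have H := cK R (0^'+) (fun c x => (exists z, [/\ U z, Phi z = y & cnear rho z x]) \/
  exists i, c <= `|Phi x 0 i - y 0 i|) _.
have {}H : \forall c \near 0^'+, core b s U Phi m `<=` (fun x =>
  (exists z, [/\ U z, Phi z = y & cnear rho z x]) \/ exists i, c <= `|Phi x 0 i - y 0 i|).
  apply: H => x [Ux Dx].
  have [E|nE] := pselect (Phi x = y).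
    exists ([set w | cnear rho x w], setT).
      by split; [exact: cnear_near | exact: filterT].
    by move=> [w c] [/= Hw _]; left; exists x.
  have [i Hi] : exists i, Phi x 0 i != y 0 i.
    apply: contrapT => Hn; apply: nE; apply/rowP => i.
    by apply/eqP/negPn/negP => Hi; apply: Hn; exists i.
  have e0 : 0 < `|Phi x 0 i - y 0 i| / 2 by rewrite divr_gt0 // normr_gt0 subr_eq0.
  exists ([set w | forall i', `|Phi w 0 i' - Phi x 0 i'| <= `|Phi x 0 i - y 0 i| / 2],
    [set c | c < `|Phi x 0 i - y 0 i| / 2]).
    split; first exact: (near_coord (nbhs_filter x) (smooth_continuous HPhi Ux) e0).
    by apply: nbhs_right_lt.
  move=> [w c] [/= /(_ i) Hw Hc]; right; exists i.
  have := ler_distD (Phi w 0 i) (Phi x 0 i) (y 0 i).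
  rewrite [`|Phi x 0 i - Phi w 0 i|]distrC; lra.
near (0 : R)^'+ => c; exists c; split; first by near: c; exact: nbhs_right_gt.
by near: c.
Unshelve. all: by end_near.
Qed.

Lemma seq_uniform (T : eqType) (xs : seq T) (P : T -> R -> Prop) :
  (forall x, x \in xs -> exists d0 : R, 0 < d0 /\ forall d, 0 < d -> d <= d0 -> P x d) ->
  exists d0 : R, 0 < d0 /\ forall x, x \in xs -> forall d, 0 < d -> d <= d0 -> P x d.
Proof.
elim: xs => [|x xs IH] Hx; first by exists 1.
have [|d1 [d10 H1]] := IH; first by move=> z Hz; apply: Hx; rewrite inE Hz orbT.
have [d2 [d20 H2]] := Hx x (mem_head _ _).
exists (Num.min d1 d2); split; first by rewrite lt_min d10.
move=> z; rewrite inE => /orP [/eqP ->|Hz] d d0; rewrite le_min => /andP [h1 h2].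
  exact: H2.
exact: H1.
Qed.

Definition rescale (o kap : 'I_n.+1 -> R) (z : 'rV[R]_n.+1) : 'rV[R]_n.+1 := \row_i (o i + kap i * z 0 i).

(** The cutoff of the core may be replaced by disjoint boxes around the preimages of [y], as the cup
    product vanishes on the other cubes of the core. Each box contributes the sign of the Jacobian,
    which the positive factors [kap] preserve. *)
Lemma affine_degree (D : int) (W : R) (o kap : 'I_n.+1 -> R) :
  has_degree U (rectangle b s) Phi D -> (forall i, 0 < kap i) ->
  (forall z, U (rescale o kap z) -> forall i, 1 <= z 0 i <= W - 1) ->
  exists d0 : R, 0 < d0 /\ forall H (dl : R), 0 < dl -> dl <= d0 -> dl * H%:R = W ->
    tdeg (chi_core b s U Phi m (fun u : torus n.+1 H => rescale o kap (tpos dl u)))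
      (bits Phi (fun u => rescale o kap (tpos dl u)) (fun _ => y)) = D.
Proof.
move=> HD k0 HW.
have Iy : interior (rectangle b s) y.
  apply: filterS (cnear_near y m0) => w Hw i.
  have := Hw i; have := Dy i; rewrite ler_norml; move: m0; lra.
have := HD y Iy ry; have [xs0 E0] := (iffLR (finite_seqP _) preim_finite).
pose xs := undup xs0; have uxs : uniq xs by rewrite undup_uniq.
have {E0} Exs : [set x | U x /\ Phi x = y] = [set` xs].
  rewrite E0; apply/seteqP; split=> x /=; by rewrite mem_undup.
have xsP x : x \in xs <-> U x /\ Phi x = y.
  by split=> H; [have : [set` xs] x by [] | have : [set x | U x /\ Phi x = y] x by []];
    rewrite -?Exs // Exs.
rewrite Exs -fsbig_seq // => {}HD.
have {HD} <- : \sum_(x <- xs) sgz (\det (jacobian Phi x)) = D := HD.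
pose K : R := 1 + \sum_i kap i.
have kK i : kap i <= K.
  by rewrite /K (bigD1 i) //= addrCA lerDl addr_ge0 // sumr_ge0 // => j _; exact: ltW.
have K0 : 0 < K by rewrite ltr_pwDl // sumr_ge0 // => j _; exact: ltW.
pose kmin : R := (\sum_i (kap i)^-1)^-1.
have kmin0 : 0 < kmin.
  rewrite invr_gt0 (bigD1 ord0) //= ltr_pwDl ?invr_gt0 // sumr_ge0 // => i _.
  by rewrite invr_ge0 ltW.
have kkmin i : kmin <= kap i.
  rewrite -[leRHS]invrK lef_pV2 ?posrE ?invr_gt0 //; last by rewrite -invr_gt0.
  by rewrite (bigD1 i) //= lerDl sumr_ge0 // => j _; rewrite invr_ge0 ltW.
pose zeta (x : 'rV[R]_n.+1) : 'rV[R]_n.+1 := \row_i ((x 0 i - o i) / kap i).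
have zetaK x : rescale o kap (zeta x) = x.
  apply/rowP => i; rewrite !mxE mulrC divfK ?gt_eqF //; ring.
have rsc (x z : 'rV[R]_n.+1) i : rescale o kap z 0 i - x 0 i = kap i * (z 0 i - zeta x 0 i).
  by rewrite -[in LHS](zetaK x) !mxE; ring.
pose g (z : 'rV[R]_n.+1) : 'rV[R]_n.+1 := \row_i (Phi (rescale o kap z) 0 i - y 0 i).
pose A (x : 'rV[R]_n.+1) : 'M[R]_n.+1 := diag_mx (\row_i kap i) *m jacobian Phi x.
have detA (x : 'rV[R]_n.+1) : sgz (\det (A x)) = sgz (\det (jacobian Phi x)).
  rewrite /A det_mulmx det_diag sgzM gtr0_sgz ?mul1r //.
  by rewrite prodr_gt0 // => i _; rewrite mxE.
have Hloc x : x \in xs -> exists rho0 : R, 0 < rho0 /\ forall rho, 0 < rho -> rho <= rho0 ->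
  exists d0 : R, 0 < d0 /\ forall dl : R, 0 < dl -> dl <= d0 -> forall H,
    (forall i, rho + 2 * dl <= zeta x 0 i) ->
    (forall i, zeta x 0 i + rho + 2 * dl <= dl * H%:R) ->
    tdeg (tbox (H := H) dl rho (zeta x)) (fun s u => pbit (g (tpos dl u) 0 s)) =
      sgz (\det (jacobian Phi x)).
  move=> /xsP [Ux Ex].
  have dA : \det (A x) != 0 by rewrite -sgz_eq0 detA sgz_eq0; exact: ry.
  have [|rho0 [r0 Hr]] := @local_degree R n (A x) g (zeta x) dA.
    move=> e e0; have eK : 0 < e / K by rewrite divr_gt0.
    have [d [d0 Hd]] := jacobian_near oU (mp_smooth HPhi) Ux eK.
    exists (d / K); split; first by rewrite divr_gt0.
    move=> z Hz i.
    have Hn : cnear d x (rescale o kap z).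
      move=> j; rewrite rsc normrM gtr0_norm //; apply: (@le_trans _ _ (K * (d / K))).
        by apply: ler_pM => //; exact: ltW.
      by rewrite mulrC divfK // gt_eqF.
    have Hx : cnear d x x by move=> j; rewrite subrr normr0 ltW.
    have Hm := mean_value_approx (mp_smooth HPhi) Hd Hx Hn i.
    have E1 : (z - zeta x) *m A x = (rescale o kap z - x) *m jacobian Phi x.
      rewrite /A mulmxA; congr (_ *m _); apply/rowP => j; rewrite mul_mx_diag mxE [in RHS]mxE [(- x) 0 j]mxE rsc.
      by rewrite [(z - _) 0 j]mxE [(- zeta x) 0 j]mxE [in LHS]mulrC; congr (_ * _); rewrite mxE.
    have E2 : g z 0 i = Phi (rescale o kap z) 0 i - Phi x 0 i by rewrite /g mxE Ex.
    rewrite E1 E2; apply: le_trans Hm _.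
    rewrite mulrAC ler_pdivrMr // -mulrA ler_pM2l // mulr_suml; apply: ler_sum => j _.
    by rewrite rsc normrM gtr0_norm // mulrC ler_wpM2l.
  exists rho0; split=> // rho h1 h2; have [d0 [d00 Hd0]] := Hr rho h1 h2.
  by exists d0; split=> // dl h3 h4 H h5 h6; rewrite Hd0 // detA.
have [rho1 [rho10 Hrho1]] := seq_uniform Hloc.
have [diso [diso0 Hiso]] := preim_isolated.
have [dm [dm0 Hdm]] := uniform_osc oU UR HPhi m0 m0.
(* In this order the bounds allow the local degrees, keep the boxes off the seam, make them
   disjoint, and keep them inside the core. *)
pose rho : R := Num.min rho1 (Num.min (1/2) (Num.min (diso / (2 * K)) (dm / K))).
have rho0 : 0 < rho by rewrite !lt_min rho10 !divr_gt0 // mulr_gt0.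
have [hr1 hr2 hr3 hr4] : [/\ rho <= rho1, rho <= 1/2, rho * (2 * K) <= diso & rho * K <= dm].
  by rewrite -!ler_pdivlMr ?mulr_gt0 // /rho !ge_min !lexx !orbT; split.
have {Hrho1} := fun x Hx => Hrho1 x Hx rho rho0 hr1.
move=> /seq_uniform [d1 [d10 Hd1]].
have rk0 : 0 < rho * kmin by rewrite mulr_gt0.
have [c [c0 Hc]] := preim_far rk0.
have c20 : 0 < c / 2 by rewrite divr_gt0.
have [dc [dc0 Hdc]] := uniform_osc oU UR HPhi m0 c20.
exists (Num.min d1 (Num.min (1/4) (dc / K))); split.
  by rewrite !lt_min d10 !divr_gt0.
move=> H dl dl0; rewrite !le_min => /and3P [dl1 dl2 dl3] HdlW.
have {}dl3 : K * dl <= dc by rewrite mulrC -ler_pdivlMr.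
have Hz x i : x \in xs -> rho + 2 * dl <= zeta x 0 i /\ zeta x 0 i + rho + 2 * dl <= dl * H%:R.
  move=> /xsP [Ux _]; rewrite -{1}(zetaK x) in Ux; have := HW _ Ux i.
  rewrite HdlW; move: hr2 dl2; lra.
have Hl x : x \in xs -> sgz (\det (jacobian Phi x)) =
    tdeg (tbox (H := H) dl rho (zeta x)) (fun s u => pbit (g (tpos dl u) 0 s)).
  by move=> Hx; rewrite (Hd1 x Hx dl dl0 dl1 H) // => i; have [] := Hz x i Hx.
rewrite (eq_big_seq _ Hl) /tdeg exchange_big /=; apply: eq_bigr => u _.
rewrite -mulr_suml.
have -> : [seq (fun u : torus n.+1 H => pbit (g (tpos dl u) 0 s)) | s <- enum 'I_n.+1] =
   [seq bits Phi (fun u : torus n.+1 H => rescale o kap (tpos dl u)) (fun=> y) s | s <- enum 'I_n.+1].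
  by apply: eq_map => i; apply/funext => v; rewrite /g mxE.
set cc := ccup _ _ _ _; have [->|cc0] := eqVneq cc 0; first by rewrite !mulr0.
congr (_ * _).
have tbox1 x v : tbox (H := H) dl rho (zeta x) v != 0 -> tbox dl rho (zeta x) v = 1.
  by rewrite /tbox; case: [forall i, _].
have Hin : U (rescale o kap (tpos dl u)) -> forall i, (u i < H)%N.
  move=> Uu i; have := HW _ Uu i; rewrite -HdlW mxE => /andP [_ h].
  rewrite -(@ltr_nat R) -(ltr_pM2l dl0); lra.
have Hcell x : x \in xs -> tbox dl rho (zeta x) u != 0 -> core b s U Phi m (rescale o kap (tpos dl u)).
  move=> /xsP [Ux Ex] /tboxP Hu.
  have [|Uu Hu'] := Hdm x (preim_core Ux Ex) (rescale o kap (tpos dl u)).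
    move=> j; rewrite rsc normrM gtr0_norm //; apply: le_trans hr4; rewrite mulrC.
    by apply: ler_pM => //; exact: ltW.
  by split=> // i; have := Hu' i; have := Dy i; rewrite Ex ler_norml; lra.
have [Cu|nCu] := pselect (core b s U Phi m (rescale o kap (tpos dl u))); last first.
  have -> : chi_core b s U Phi m (fun u : torus n.+1 H => rescale o kap (tpos dl u)) u = 0.
    by apply/eqP/negPn/negP => /chi_coreP.
  rewrite big_seq big1 // => x Hx; apply/eqP/negPn/negP => /(Hcell x Hx); exact: nCu.
have -> : chi_core b s U Phi m (fun u : torus n.+1 H => rescale o kap (tpos dl u)) u = 1.
  by rewrite /chi_core; case: asboolP.
have Hu := Hin Cu.1.
have [[x [Ux Ex Hx]]|[i Hi]] := Hc _ Cu; last first.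
  case/negP: cc0; apply/eqP.
  apply: (@ccup_const _ _ _ (fun _ => 0) _ i (pbit (Phi (rescale o kap (tpos dl u)) 0 i - y 0 i))).
    by rewrite size_map size_enum_ord.
  move=> v /(in_cube_cell Hu) Hv; rewrite (nth_map i) ?size_enum_ord // nth_ord_enum.
  apply: pbit_close; apply: lt_le_trans Hi.
  have [|_ /(_ i)] := Hdc _ Cu (rescale o kap (tpos dl v)).
    move=> j; apply: le_trans dl3.
    have -> : rescale o kap (tpos dl v) 0 j - rescale o kap (tpos dl u) 0 j =
       kap j * (tpos dl v 0 j - tpos dl u 0 j) by rewrite ![rescale _ _ _ _ _]mxE; ring.
    rewrite normrM gtr0_norm //; apply: ler_pM => //; first exact: ltW.
    by apply: tpos_cell => //; exact: ltW.
  rewrite opprB addrA addrNK => h; apply: le_lt_trans h _; lra.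
have xxs : x \in xs by apply/xsP.
have Tx : tbox dl rho (zeta x) u != 0.
  apply/tboxP => i; have := Hx i; rewrite rsc normrM gtr0_norm // => h.
  rewrite -(ler_pM2l kmin0) [leRHS]mulrC; apply: le_trans h.
  by rewrite ler_wpM2r.
rewrite (bigD1_seq x) //= tbox1 // big_seq_cond big1 ?addr0 // => x' /andP [Hx' ne].
apply/eqP/negPn/negP => Tx'; case/negP: ne; apply/eqP.
move: (Hx') => /xsP [Ux' Ex']; apply: Hiso => // i.
move: Tx Tx' => /tboxP/(_ i) h1 /tboxP/(_ i) h2.
have -> : x 0 i - x' 0 i = kap i * (zeta x 0 i - zeta x' 0 i).
  by rewrite -{1}(zetaK x) rsc.
rewrite normrM gtr0_norm //; apply: le_trans hr3.
apply: (@le_trans _ _ (K * (2 * rho))); last by rewrite mulrCA mulrA mulrAC [rho * _]mulrC -!mulrA [K * _]mulrC.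
apply: ler_pM => //; first exact: ltW.
move: h1 h2; rewrite !ler_norml; lra.
Qed.

End AffineDegree.

(** * A jumping edge path for every labelling *)

Lemma jumps_nth (V : finType) n (sh : 'I_n -> V -> V) bs u p b0 i0 k : jumps sh bs u p -> (k < size p)%N ->
  nth b0 bs k (sh (nth i0 p k) (vtx sh u (take k p))) != nth b0 bs k (vtx sh u (take k p)).
Proof.
elim: bs u p k => [|b bs IH] u [|i p] k //= /andP [h1 h2]; case: k => [|k] //= Hk.
exact: IH.
Qed.

(** The map precomposed with [G] and labelled by [t] has the lattice degree of the original map with
    a constant regular label, which is [D]. Hence some cube based in the core has a nonzero cup
    product, and [tau i] is the place of direction [i] in its edge path. *)
Lemma degree_jumps (R : realType) (n : nat) (a b : 'rV[R]_n.+1) (r s : 'I_n.+1 -> R)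
  (U : set 'rV[R]_n.+1) (Phi : 'rV[R]_n.+1 -> 'rV[R]_n.+1) (D : int) (m W LG BG : R)
  (o kap : 'I_n.+1 -> R) (G : 'rV[R]_n.+1 -> 'rV[R]_n.+1) :
  open U -> U `<=` rectangle a r -> map_of_pairs U (rectangle b s) Phi ->
  has_degree U (rectangle b s) Phi D -> D != 0 ->
  0 < m -> (forall i, 5 * m <= s i) -> (forall i, 0 < kap i) -> 0 < W -> 0 <= LG ->
  (forall z, U (rescale o kap z) -> forall i, 1 <= z 0 i <= W - 1) ->
  (forall (x z : 'rV[R]_n.+1) (e : R), (forall i, 0 <= x 0 i <= W) -> (forall i, 0 <= z 0 i <= W) ->
     cnear e x z -> cnear (LG * e) (G x) (G z)) ->
  (forall x : 'rV[R]_n.+1, (forall i, 0 <= x 0 i <= W) -> forall i, `|G x 0 i - x 0 i| <= BG) ->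
  (forall (q : R) (x : 'rV[R]_n.+1), 0 <= q <= 1 -> (forall i, 0 <= x 0 i <= W) ->
     U (rescale o kap ((1 - q) *: G x + q *: x)) -> forall i, 1 <= x 0 i <= W - 1) ->
  forall eta : R, 0 < eta -> exists H (dl : R), [/\ 0 < dl, dl <= eta, dl * H%:R = W &
    forall t : torus n.+1 H -> 'rV[R]_n.+1, (forall u, deep b s (2 * m) (t u)) ->
    exists (u : torus n.+1 H) (tau : 'S_n.+1), [/\ forall i, (0 < u i < H)%N,
      core b s U Phi m (rescale o kap (G (tpos dl u))) &
      forall (i : 'I_n.+1) (v w : torus n.+1 H), (forall j, v j = u j + (tau j < i) :> nat)%N ->
        (forall j, w j = u j + (tau j <= i) :> nat)%N ->
        bits Phi (fun u => rescale o kap (G (tpos dl u))) t i w !=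
        bits Phi (fun u => rescale o kap (G (tpos dl u))) t i v]].
Proof.
move=> oU UR HPhi HD D0 m0 Hs k0 W0 LG0 HW HL HB Hex eta eta0.
have [y [Dy ry]] := regular_value_exists oU UR HPhi (ltn0Sn n) m0 Hs.
have [d1 [d10 Hd1]] := affine_degree oU UR HPhi m0 Dy ry HD k0 HW.
have m40 : 0 < m / 4 by rewrite divr_gt0.
have [d [d0 Hd]] := uniform_osc oU UR HPhi m0 m40.
pose K : R := 1 + \sum_i kap i.
have kK i : kap i <= K.
  by rewrite /K (bigD1 i) //= addrCA lerDl addr_ge0 // sumr_ge0 // => j _; exact: ltW.
have K0 : 0 < K by rewrite ltr_pwDl // sumr_ge0 // => j _; exact: ltW.
pose d2 : R := d / (2 * (K * (LG + 1))).
have L10 : 0 < LG + 1 by rewrite ltr_wpDl.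
have q0 : 0 < 2 * (K * (LG + 1)) by rewrite mulr_gt0 // mulr_gt0.
have d20 : 0 < d2 by rewrite divr_gt0.
pose e : R := Num.min eta (Num.min d1 d2).
have e0 : 0 < e by rewrite !lt_min eta0 d10.
pose H := (Num.truncn (W / e)).+1; pose dl : R := W / H%:R.
have H0 : 0 < H%:R :> R by rewrite ltr0n.
have dl0 : 0 < dl by rewrite divr_gt0.
have : dl <= e.
  rewrite ler_pdivrMr // mulrC -ler_pdivrMr // ltW //; exact: truncnS_gt.
rewrite !le_min => /and3P [dl1 dl2 dl3].
have HdlW : dl * H%:R = W by rewrite divfK // gt_eqF.
exists H, dl; split=> // t Ht.
have Hx (u : torus n.+1 H) i : 0 <= tpos dl u 0 i <= W.
  rewrite mxE mulr_ge0 ?ler0n ?(ltW dl0) //= -HdlW ler_pM2l // ler_nat -ltnS; exact: ltn_ord.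
have rsD (x z : 'rV[R]_n.+1) i : rescale o kap z 0 i - rescale o kap x 0 i = kap i * (z 0 i - x 0 i).
  by rewrite ![rescale _ _ _ _ _]mxE; ring.
have Hcl (u v w : torus n.+1 H) : in_cell u v -> in_cell u w -> cnear dl (tpos dl w) (tpos dl v).
  move=> Hv Hw i; move: (Hv i) (Hw i) => /andP [h1 h2] /andP [h3 h4].
  rewrite !mxE -mulrBr normrM gtr0_norm // ler_piMr ?(ltW dl0) // ler_norml.
  have := h1; have := h2; have := h3; have := h4; rewrite -!(@ler_nat R) -!natr1; lra.
have Hdl : K * ((LG + 1) * dl) <= d / 2.
  have : dl * (2 * (K * (LG + 1))) <= d by rewrite -ler_pdivlMr.
  have -> : dl * (2 * (K * (LG + 1))) = 2 * (K * ((LG + 1) * dl)) by ring.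
  lra.
have Hdg := Hd1 H dl dl0 dl2 HdlW.
have BG0 : 0 <= BG.
  have u : torus n.+1 H by exact: [ffun=> ord0].
  by apply: le_trans (HB _ (Hx u) ord0).
have Htop := @top_homotopy R n.+1 b s U Phi H m d (K * BG)
   (fun u => rescale o kap (G (tpos dl u))) (fun u => rescale o kap (tpos dl u)) t (fun _ => y)
   m0 d0 (mulr_ge0 (ltW K0) BG0) Hd Ht (fun _ => Dy).
have {Htop} : tdeg (chi_core b s U Phi m (fun u : torus n.+1 H => rescale o kap (G (tpos dl u))))
     (bits Phi (fun u => rescale o kap (G (tpos dl u))) t) = D.
  rewrite -Hdg; apply: Htop.
  - move=> u v w _ Hv Hw; have Hc := Hcl u v w Hv Hw; split=> i; rewrite rsD normrM gtr0_norm //.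
      apply: le_trans Hdl; apply: ler_pM => //; first exact: ltW.
      apply: le_trans (HL _ _ _ (Hx w) (Hx v) Hc i) _.
      by rewrite ler_pM2r // lerDl.
    apply: le_trans Hdl; apply: ler_pM => //; first exact: ltW.
    by apply: le_trans (Hc i) _; rewrite ler_peMl ?(ltW dl0) // lerDr.
  - move=> u i; rewrite rsD normrM gtr0_norm // distrC; apply: ler_pM => //; first exact: ltW.
    exact: HB (Hx u) i.
  - move=> q u Hq; have -> : (1 - q) *: rescale o kap (G (tpos dl u)) + q *: rescale o kap (tpos dl u) =
      rescale o kap ((1 - q) *: G (tpos dl u) + q *: tpos dl u).
      apply/rowP => i; rewrite !mxE.
      by move: (G _ 0 i) => x; ring.
    move=> /(Hex q _ Hq (Hx u)) Hi i; have := Hi i; rewrite mxE => /andP [h1 h2].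
    rewrite lt0n; apply/andP; split.
      by apply/negP => /eqP E; move: h1; rewrite E mulr0; lra.
    rewrite -(@ltr_nat R) -(ltr_pM2l dl0) HdlW; lra.
move=> HD'; have : exists u, chi_core b s U Phi m (fun u : torus n.+1 H => rescale o kap (G (tpos dl u))) u *
   ccup (@tsh n.+1 H) [seq bits Phi (fun u => rescale o kap (G (tpos dl u))) t i | i <- enum 'I_n.+1] u (enum 'I_n.+1) != 0.
  apply: contrapT => Hn; case/negP: D0; rewrite -HD' /tdeg big1 // => u _.
  by apply/eqP/negPn/negP => Hu; apply: Hn; exists u.
case=> u; rewrite mulf_eq0 negb_or => /andP [/chi_coreP Cu] /ccup_neq0 [p Hp Hj].
have Hu i : (0 < u i < H)%N.
  have Uu : U (rescale o kap ((1 - 0) *: G (tpos dl u) + 0 *: tpos dl u)).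
    by rewrite subr0 scale1r scale0r addr0; case: Cu.
  have := Hex 0 _ _ (Hx u) Uu i; rewrite lexx ler01 => /(_ isT); rewrite mxE => /andP [h1 h2].
  rewrite lt0n; apply/andP; split.
    by apply/negP => /eqP E; move: h1; rewrite E mulr0; lra.
  rewrite -(@ltr_nat R) -(ltr_pM2l dl0) HdlW; lra.
have Up : uniq p by rewrite (perm_uniq Hp) enum_uniq.
have Sp : size p = n.+1 by rewrite (perm_size Hp) size_enum_ord.
have Mp i : i \in p by rewrite (perm_mem Hp) mem_enum.
have Htau i : (index i p < n.+1)%N by have := Mp i; rewrite -index_mem Sp.
have tau_inj : injective (fun i => Ordinal (Htau i)).
  by move=> i j [E]; rewrite -(nth_index ord0 (Mp i)) E nth_index.
exists u, (perm tau_inj); split=> // i v w Hv Hw.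
have Hi : (i < size p)%N by rewrite Sp.
have := jumps_nth (fun _ => 0) ord0 Hj Hi; rewrite (nth_map i) ?size_enum_ord // nth_ord_enum.
have Ev : vtx (@tsh n.+1 H) u (take i p) = v.
  apply/ffunP => j; apply: val_inj; rewrite /= vtx_val; first last.
  - by move=> x _; have /andP [] := Hu x.
  - exact: take_uniq.
  - by rewrite Hv permE /= in_take.
have Ew : tsh (nth ord0 p i) (vtx (@tsh n.+1 H) u (take i p)) = w.
  have -> : tsh (nth ord0 p i) (vtx (@tsh n.+1 H) u (take i p)) = vtx (@tsh n.+1 H) u (take i.+1 p).
    by rewrite (take_nth ord0) // /vtx foldl_rcons.
  apply/ffunP => j; apply: val_inj; rewrite /= vtx_val; first last.
  - by move=> x _; have /andP [] := Hu x.
  - exact: take_uniq.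
  - by rewrite Hw permE /= in_take.
by rewrite Ew Ev.
Qed.

(** * Slopes in general position *)

(** The point is taken on the moment curve (t, t^2, ..., t^p), where each affine function becomes a
    nonzero polynomial in t; infinitely many small t are available. *)
Lemma avoid_hyperplanes (R : realType) p (I : finType) (c0 : I -> R) (c : I -> 'rV[R]_p) (dl : R) : 0 < dl ->
  (forall i, c0 i != 0 \/ c i != 0) ->
  exists be : 'rV[R]_p, (forall a, `|be 0 a| <= dl) /\
    forall i, c0 i + \sum_a be 0 a * c i 0 a != 0.
Proof.
move=> dl0 Hc.
pose P i : {poly R} := (c0 i)%:P + \sum_a (c i 0 a) *: 'X^(a.+1).
have P0 i : P i != 0.
  apply/negP => /eqP E.
  have Ecoef m : (P i)`_m = (if m == 0%N then c0 i else 0) + \sum_(a < p) c i 0 a * (m == a.+1)%:R.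
    rewrite coefD coefC coef_sum; congr (_ + _); apply: eq_bigr => a _.
    by rewrite coefZ coefXn.
  case: (Hc i) => /negP; apply; apply/eqP.
    have := Ecoef 0%N; rewrite E coef0 eqxx big1 ?addr0 // => a _; by rewrite mulr0.
  apply/rowP => a; have := Ecoef a.+1; rewrite E coef0 add0r (bigD1 a) //= eqxx mulr1 big1 ?addr0 ?mxE //.
  by move=> b ba; rewrite eqSS; case: eqP => [/val_inj Eab|_]; [rewrite Eab eqxx in ba | rewrite mulr0].
pose Q := \prod_i P i.
have Q0 : Q != 0 by apply/prodf_neq0 => i _.
pose d1 : R := Num.min dl 1.
have d10 : 0 < d1 by rewrite lt_min dl0 ltr01.
pose t (m : nat) : R := d1 / m.+1%:R.
have tI : injective t.
  move=> m m' /(mulfI (lt0r_neq0 d10)) /invr_inj /eqP; rewrite eqr_nat => /eqP [].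
  by [].
have [m Hm] : exists m, ~~ root Q (t m).
  apply: contrapT => Hn; have Hr m : root Q (t m) by apply: contrapT => /negP Hm; apply: Hn; exists m.
  have := @max_poly_roots _ Q [seq t m | m <- iota 0 (size Q)] Q0.
  rewrite size_map size_iota ltnn map_inj_uniq // iota_uniq => Hf.
  suff : false by []. apply: Hf => //; by apply/allP => _ /mapP [m _ ->].
have t0 : 0 <= t m by rewrite divr_ge0 ?ltW.
have t1 : t m <= d1 by rewrite ler_pdivrMr ?ltr0n // ler_peMr ?ler1n // ltW.
have tle1 : t m <= 1 by apply: le_trans t1 _; rewrite ge_min lexx orbT.
exists (\row_a t m ^+ a.+1); split.
  move=> a; rewrite mxE ger0_norm ?exprn_ge0 // exprS.
  apply: (@le_trans _ _ (t m)); last by apply: le_trans t1 _; rewrite ge_min lexx.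
  by rewrite ler_piMr // exprn_ile1.
move=> i; have := Hm; rewrite /root /Q horner_prod prodf_seq_neq0 => /allP /(_ i).
rewrite mem_index_enum => /(_ isT) /=; rewrite hornerD hornerC horner_sum.
suff -> : \sum_a (\row_a t m ^+ a.+1) 0 a * c i 0 a = \sum_a (c i 0 a *: 'X^(a.+1)).[t m] by [].
by apply: eq_bigr => a _; rewrite mxE hornerZ hornerXn mulrC.
Qed.

Section Rows.
Variables (R : realType) (p : nat).
Implicit Types (l : nat -> 'rV[R]_p.+1).

Definition dotp (l z : 'rV[R]_p.+1) : R := \sum_a z 0 a * l 0 a.

Definition rowsmx l (f : 'I_p.+1 -> nat) : 'M[R]_p.+1 := \matrix_(a, s) l (f s) 0 a.

Lemma rowsmxE l (f : 'I_p.+1 -> nat) z s : (z *m rowsmx l f) 0 s = dotp (l (f s)) z.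
Proof. by rewrite mxE; apply: eq_bigr => a _; rewrite mxE. Qed.

(** The second clause is about the families of parallel hyperplanes at integer levels that the rows
    define: members of [p.+2] families, at levels up to [D], share a point only if all the levels
    are 0. *)
Definition general_rows (D N : nat) l :=
  (forall f : 'I_p.+1 -> nat, injective f -> (forall i, f i < N)%N -> \det (rowsmx l f) != 0) /\
  (forall (f : 'I_p.+2 -> nat) (d : 'I_p.+2 -> int) (z : 'rV[R]_p.+1), injective f -> (forall i, f i < N)%N ->
     (forall i, `|d i| <= D)%N -> (forall i, dotp (l (f i)) z = (d i)%:~R) -> forall i, d i = 0).

Lemma general_rows_base D : general_rows D p.+1 (fun i => delta_mx 0 (inord i)).
Proof.
split=> [f fI fN|f d z fI fN].
  pose g i := Ordinal (fN i).
  have gI : injective g by move=> i i' [/fI].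
  have -> : rowsmx (fun i => delta_mx 0 (inord i)) f = (perm_mx (perm gI))^T.
    apply/matrixP => a s; rewrite !mxE permE /=; congr (_%:R).
    by rewrite eq_sym -val_eqE /= inordK // val_eqE [in RHS]eq_sym.
  by rewrite det_tr det_perm signr_eq0.
exfalso; pose g i := Ordinal (fN i).
have gI : injective g by move=> i i' [/fI].
by have := leq_card g gI; rewrite !card_ord ltnn.
Qed.

(** Each failure of general position confines the new row to an affine hyperplane: either a
    determinant, expanded along the new column, vanishes, or the row takes a forbidden integer value
    at the point [sol] that [p.+1] old rows determine. *)
Lemma general_rows_step D N l (dl : R) : 0 < dl -> (p < N)%N -> general_rows D N l ->
  exists be : 'rV[R]_p.+1, (forall a, `|be 0 a| <= dl) /\
    general_rows D N.+1 (fun i => if i == N then be else l i).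
Proof.
move=> dl0 pN [G1 G2].
pose int_of (x : 'I_(2 * D).+1) : int := (x : nat)%:Z - D%:Z.
pose sol (g : {ffun 'I_p.+1 -> 'I_N}) (d : {ffun 'I_p.+1 -> 'I_(2 * D).+1}) : 'rV[R]_p.+1 :=
  (\row_s (int_of (d s))%:~R) *m invmx (rowsmx l (fun i => g i)).
pose I1 : finType := ({ffun 'I_p.+1 -> 'I_N} * ({ffun 'I_p.+1 -> 'I_(2 * D).+1} * 'I_(2 * D).+1))%type.
pose I2 : finType := ({ffun 'I_p.+1 -> 'I_N} * 'I_p.+1)%type.
pose ok1 (x : I1) := injectiveb x.1 && ((int_of x.2.2 != 0) || [exists s, int_of (x.2.1 s) != 0]).
(* Indices that pose no condition get the constant function 1, which never vanishes. *)
pose c0 (x : I1 + I2) : R := match x with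
  | inl x => if ok1 x then - (int_of x.2.2)%:~R else 1
  | inr x => if injectiveb x.1 then 0 else 1 end.
pose c (x : I1 + I2) : 'rV[R]_p.+1 := match x with
  | inl x => if ok1 x then sol x.1 x.2.1 else 0
  | inr x => if injectiveb x.1 then \row_a cofactor (rowsmx l (fun i => x.1 i)) a x.2 else 0 end.
have unitg (g : {ffun 'I_p.+1 -> 'I_N}) : injectiveb g -> rowsmx l (fun i => g i) \in unitmx.
  move=> /injectiveP gI; rewrite unitmxE unitfE; apply: G1 => // i i' /val_inj; exact: gI.
have [|be [Hb1 Hb2]] := @avoid_hyperplanes R p.+1 (I1 + I2)%type c0 c dl dl0.
  case=> [x|x] /=; case: ifP => Hx; try by left; rewrite oner_eq0.
    have /andP [xI /orP [H|/existsP [s Hs]]] := Hx.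
      by left; rewrite oppr_eq0 intr_eq0.
    right; apply/negP => /eqP E; move/negP: Hs; apply; rewrite -(intr_eq0 R).
    have : (sol x.1 x.2.1 *m rowsmx l (fun i => x.1 i)) 0 s = 0 by rewrite E mul0mx mxE.
    by rewrite /sol mulmxKV ?unitg // mxE => ->.
  right; apply/negP => /eqP E.
  have := unitg _ Hx; rewrite unitmxE unitfE (expand_det_col _ x.2) big1 ?eqxx // => a _.
  by move/rowP/(_ a): E; rewrite !mxE => ->; rewrite mulr0.
exists be; split=> //; set l' := fun i => _.
have l'N : l' N = be by rewrite /l' eqxx.
have l'i i : (i < N)%N -> l' i = l i by move=> Hi; rewrite /l' ltn_eqF.
have ltN (i : nat) : (i < N.+1)%N -> i <> N -> (i < N)%N.
  by rewrite ltnS leq_eqVlt => /orP [/eqP|].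
split.
  move=> f fI fN.
  have [[i1 Ei1]|nN] := pselect (exists i, f i = N); last first.
    have fN' i : (f i < N)%N by apply: ltN => // E; apply: nN; exists i.
    suff -> : rowsmx l' f = rowsmx l f by apply: G1.
    by apply/matrixP => a s; rewrite !mxE l'i.
  have fN' i : i != i1 -> (f i < N)%N.
    by move=> ne; apply: ltN => // E; case/negP: ne; apply/eqP/fI; rewrite E.
  (* The cofactors along column [i1] do not see that column, so an old row not yet in use can stand
     in for the new one and makes [g] an injection. *)
  have [t Ht] : exists t : 'I_N, forall i, i != i1 -> f i != t.
    have [t Ht] : exists t : 'I_N, forall i : 'I_p, t \notin [set t : 'I_N | f (lift i1 i) == t]%SET.
      apply: exists_uncovered; rewrite card_ord; apply: leq_ltn_trans pN.
      rewrite -[leqRHS](card_ord p) -sum1_card; apply: leq_sum => i _.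
      have fl : (f (lift i1 i) < N)%N by apply: fN'; rewrite eq_sym neq_lift.
      rewrite -[leqRHS](cards1 (Ordinal fl)).
      by apply: subset_leq_card; apply/fintype.subsetP => t; rewrite !finset.inE -val_eqE eq_sym.
    exists t => i; rewrite eq_sym => /unlift_some [i' -> _].
    by have := Ht i'; rewrite finset.inE.
  have gN i : ((if i == i1 then t : nat else f i) < N)%N by case: eqP => // /eqP /fN'.
  pose g : {ffun 'I_p.+1 -> 'I_N} := [ffun i => Ordinal (gN i)].
  have gI : injectiveb g.
    apply/injectiveP => i i'; rewrite !ffunE => -[]; case: eqP => [->|/eqP ne]; case: eqP => [->|/eqP ne'] //.
    - by move=> E; have := Ht _ ne'; rewrite E eqxx.
    - by move=> E; have := Ht _ ne; rewrite E eqxx.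
    - exact: fI.
  have := Hb2 (inr (g, i1)); rewrite /= gI add0r; congr (_ != 0).
  rewrite (expand_det_col _ i1); apply: eq_bigr => a _; rewrite !mxE Ei1 l'N; congr (_ * _).
  rewrite /cofactor; congr (_ * \det _); apply/matrixP => a' s; rewrite !mxE ffunE /=.
  have ne : lift i1 s != i1 by rewrite eq_sym neq_lift.
  by rewrite (negbTE ne) l'i // fN'.
move=> f d z fI fN dD Hz.
have [[i1 Ei1]|nN] := pselect (exists i, f i = N); last first.
  have fN' i : (f i < N)%N by apply: ltN => // E; apply: nN; exists i.
  by apply: (G2 f d z) => // i; rewrite -Hz l'i.
have fN' i : (f (lift i1 i) < N)%N.
  by apply: ltN => // E; have := neq_lift i1 i; rewrite -E in Ei1; move/fI: Ei1 => <-; rewrite eqxx.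
pose g : {ffun 'I_p.+1 -> 'I_N} := [ffun i => Ordinal (fN' i)].
have gI : injectiveb g.
  by apply/injectiveP => i i'; rewrite !ffunE => -[/fI /lift_inj].
have dD' i : (`|(d i + D%:Z)%R| < (2 * D).+1)%N by have := dD i; lia.
have dE i : int_of (Ordinal (dD' i)) = d i by rewrite /int_of /=; have := dD i; lia.
pose dd : {ffun 'I_p.+1 -> 'I_(2 * D).+1} := [ffun i => Ordinal (dD' (lift i1 i))].
apply: contrapT => Hd.
have Hok : ok1 (g, (dd, Ordinal (dD' i1))).
  rewrite /ok1 gI /= dE; case: eqP => //= d10; apply/existsP.
  apply: contrapT => Hn; apply: Hd => i; apply/eqP/negPn/negP => di; apply: Hn.
  have : i1 != i by apply/eqP => E; rewrite -E d10 eqxx in di.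
  by move=> /unlift_some [s E _]; exists s; rewrite ffunE dE -E.
have := Hb2 (inl (g, (dd, Ordinal (dD' i1)))); rewrite /c0 /c Hok /= dE => /negP; apply.
suff -> : sol g dd = z.
  have := Hz i1; rewrite Ei1 l'N /dotp => <-; rewrite addrC subr_eq0; apply/eqP.
  by apply: eq_bigr => a _; rewrite mulrC.
rewrite /sol; have -> : \row_s (int_of (dd s))%:~R = z *m rowsmx l (fun i => g i) :> 'rV[R]_p.+1.
  apply/rowP => s; have -> := rowsmxE l (fun i : 'I_p.+1 => nat_of_ord (g i)) z s.
  by rewrite !mxE !ffunE dE -Hz /= l'i.
by rewrite mulmxK ?unitg.
Qed.

Lemma general_rows_exist D N (dl : R) : 0 < dl -> dl <= 1 -> (p < N)%N -> exists l : nat -> 'rV[R]_p.+1,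
  [/\ general_rows D N l, forall i : 'I_p.+1, l i = delta_mx 0 i,
     forall i a, `|l i 0 a| <= 1 & forall i a, (p < i)%N -> (i < N)%N -> `|l i 0 a| <= dl].
Proof.
move=> dl0 dl1; elim: N => [//|N IH]; rewrite ltnS leq_eqVlt => /orP [/eqP <-|pN].
  exists (fun i => delta_mx 0 (inord i)); split=> [|i|i a|i a h1 h2].
  - exact: general_rows_base.
  - by rewrite inord_val.
  - by rewrite mxE ger0_norm ?lern1 ?leq_b1.
  - by move: h1; rewrite ltnNge -ltnS h2.
have [l [Gl l1 l2 l3]] := IH pN.
have [be [b1 b2]] := general_rows_step dl0 pN Gl.
exists (fun i => if i == N then be else l i); split=> // [i|i a|i a h1 h2].
- by rewrite ltn_eqF // (leq_trans (ltn_ord i)).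
- case: eqP => // _; exact: le_trans (b1 a) dl1.
- case: eqP => [_|/eqP ne]; first exact: b1.
  by apply: l3 => //; rewrite ltn_neqAle ne -ltnS.
Qed.

(** Only finitely many choices of rows and integers occur, so both clauses hold with a uniform
    margin: [C] bounds the inverses, and [zt] allows values that are merely close to integers. *)
Lemma general_rows_quantitative D N l : general_rows D N l -> (forall i a, `|l i 0 a| <= 1) ->
  exists C : R, 0 < C /\
  (forall (f : 'I_p.+1 -> nat) z e, injective f -> (forall i, f i < N)%N ->
     (forall i, `|dotp (l (f i)) z| <= e) -> forall a, `|z 0 a| <= C * e) /\
  exists zt : R, 0 < zt /\
  (forall (f : 'I_p.+2 -> nat) (d : 'I_p.+2 -> int) z, injective f -> (forall i, f i < N)%N ->
     (forall i, `|d i| <= D)%N -> (forall i, `|dotp (l (f i)) z - (d i)%:~R| <= zt) -> forall i, d i = 0).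
Proof.
move=> [G1 G2] l1.
have Hdp i (z : 'rV[R]_p.+1) (e : R) : (forall a, `|z 0 a| <= e) -> `|dotp (l i) z| <= p.+1%:R * e.
  move=> Hz; apply: le_trans (ler_norm_sum _ _ _) _.
  have -> : p.+1%:R * e = \sum_(i < p.+1) e by rewrite sumr_const card_ord mulr_natl.
  apply: ler_sum => a _; rewrite normrM -[leRHS]mulr1; apply: ler_pM => //; exact: Hz.
have P0 : 0 < p.+1%:R :> R by rewrite ltr0n.
have [c [c0 Hc]] : exists c : R, 0 < c /\ forall g : {ffun 'I_p.+1 -> 'I_N}, g \in enum {: {ffun 'I_p.+1 -> 'I_N}} ->
    forall c', 0 < c' -> c' <= c -> injective g -> forall (z : 'rV[R]_p.+1) (e : R), (forall i, `|dotp (l (g i)) z| <= e) -> forall a, `|z 0 a| * c' <= e.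
  apply: seq_uniform => g _; have [gI|ngI] := pselect (injective g); last first.
    by exists 1; split=> // d _ _ /ngI.
  have dM : \det (rowsmx l (fun i => g i)) != 0 by apply: G1 => // i i' /val_inj; exact: gI.
  have dM0 : 0 < `|\det (rowsmx l (fun i => g i))| by rewrite normr_gt0.
  have q0 : 0 < p`!%:R * 1 ^+ p :> R by rewrite expr1n mulr1 ltr0n fact_gt0.
  exists (`|\det (rowsmx l (fun i => g i))| / (p`!%:R * 1 ^+ p * p.+1%:R)); split.
    by rewrite divr_gt0 // mulr_gt0.
  move=> c' c'0 Hc' _ z e Hz a; rewrite mulrC.
  apply: le_trans (ler_wpM2r (normr_ge0 _) Hc') _; rewrite mulrAC ler_pdivrMr ?mulr_gt0 //.
  have HB (i s : 'I_p.+1) : `|rowsmx l (fun i => g i) i s| <= 1 by rewrite mxE.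
  apply: le_trans (@mulmx_lower_bound _ p _ 1 _ z a HB dM0 (lexx _) ler01) _.
  have -> : e * (p`!%:R * 1 ^+ p * p.+1%:R) = p`!%:R * 1 ^+ p * (p.+1%:R * e) by ring.
  rewrite ler_pM2l //.
  have -> : p.+1%:R * e = \sum_(i < p.+1) e by rewrite sumr_const card_ord mulr_natl.
  by apply: ler_sum => s _; rewrite rowsmxE.
have {}Hc (f : 'I_p.+1 -> nat) (z : 'rV[R]_p.+1) (e : R) : injective f -> (forall i, f i < N)%N ->
     (forall i, `|dotp (l (f i)) z| <= e) -> forall a, `|z 0 a| <= c^-1 * e.
  move=> fI fN Hz a; pose g : {ffun 'I_p.+1 -> 'I_N} := [ffun i => Ordinal (fN i)].
  rewrite -ler_pdivrMl ?invr_gt0 // invrK mulrC.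
  apply: (Hc g (mem_enum _ _) c c0 (lexx _)) => [i i'|i]; first by rewrite !ffunE => -[/fI].
  by rewrite ffunE; exact: Hz.
exists c^-1; rewrite invr_gt0; split=> //; split=> //.
pose int_of (x : 'I_(2 * D).+1) : int := (x : nat)%:Z - D%:Z.
pose I : finType := ({ffun 'I_p.+2 -> 'I_N} * {ffun 'I_p.+2 -> 'I_(2 * D).+1})%type.
have [zt [zt0 Hzt]] : exists zt : R, 0 < zt /\ forall x : I, x \in enum I -> forall zt', 0 < zt' -> zt' <= zt ->
   injective x.1 -> forall z : 'rV[R]_p.+1, (forall i, `|dotp (l (x.1 i)) z - (int_of (x.2 i))%:~R| <= zt') ->
   forall i, int_of (x.2 i) = 0.
  apply: seq_uniform => -[f d] _ /=.
  have [fI|nfI] := pselect (injective f); last by exists 1; split=> // zt _ _ /nfI.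
  have [Hd|Hd] := pselect (forall i, int_of (d i) = 0); first by exists 1; split.
  pose M := rowsmx l (fun i => f (lift ord0 i)).
  have gI : injective (fun i : 'I_p.+1 => f (lift ord0 i) : nat).
    by move=> i i' /val_inj /fI /lift_inj.
  have uM : M \in unitmx by rewrite unitmxE unitfE; apply: G1.
  pose z1 := (\row_s (int_of (d (lift ord0 s)))%:~R) *m invmx M.
  have Hz1 s : dotp (l (f (lift ord0 s))) z1 = (int_of (d (lift ord0 s)))%:~R.
    by rewrite -(rowsmxE l (fun i => f (lift ord0 i))) -/M /z1 mulmxKV // mxE.
  pose om := `|dotp (l (f ord0)) z1 - (int_of (d ord0))%:~R|.
  have om0 : 0 < om.
    rewrite normr_gt0 subr_eq0; apply/negP => /eqP E; apply: Hd.
    apply: (G2 (fun i => f i) (fun i => int_of (d i)) z1) => // [i i' /val_inj /fI //|i|i].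
      by rewrite /int_of; have := ltn_ord (d i); lia.
    by case: (unliftP ord0 i) => [s ->|->]; [exact: Hz1|].
  pose K : R := 2 * (1 + p.+1%:R * c^-1).
  have K0 : 0 < K by rewrite mulr_gt0 // addr_gt0 // mulr_gt0 // invr_gt0.
  exists (om / K); split; first by rewrite divr_gt0.
  move=> zt zt0; rewrite ler_pdivlMr // => Hzt _ z Hz; exfalso.
  have dB i (z' z'' : 'rV[R]_p.+1) : dotp (l i) (z' - z'') = dotp (l i) z' - dotp (l i) z''.
    by rewrite /dotp -sumrB; apply: eq_bigr => a _; rewrite !mxE mulrBl.
  have H1 : forall a, `|(z - z1) 0 a| <= c^-1 * zt.
    apply: Hc gI _ _ => // s; rewrite dB Hz1; exact: Hz.
  have H2 := Hdp (f ord0) _ _ H1; rewrite dB in H2.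
  have H3 := Hz ord0.
  have : om <= zt + p.+1%:R * (c^-1 * zt).
    rewrite /om; move: H2 H3; move: (dotp _ z) (dotp _ z1) (_%:~R) => A B E.
    rewrite !ler_norml; move: (p.+1%:R * _) => F; rewrite opprD; lra.
  have E : zt * K = 2 * (zt + p.+1%:R * (c^-1 * zt)) by rewrite /K; ring.
  by rewrite E in Hzt; lra.
exists zt; split=> // f d z fI fN dD Hz i.
have dD' i' : (`|(d i' + D%:Z)%R| < (2 * D).+1)%N by have := dD i'; lia.
have dE i' : int_of (Ordinal (dD' i')) = d i' by rewrite /int_of /=; have := dD i'; lia.
pose x : I := ([ffun i => Ordinal (fN i)], [ffun i => Ordinal (dD' i)]).
have := Hzt x (mem_enum _ _) zt zt0 (lexx _) _ z _ i; rewrite /= ffunE dE; apply.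
  by move=> i1 i2; rewrite !ffunE => -[/fI].
by move=> i'; rewrite !ffunE dE; exact: Hz.
Qed.

End Rows.

(** * Collapsing onto a cubical skeleton *)

Lemma subset_of_card (T : finType) (S D : {set T}) p : S \subset D -> (#|S| <= p)%N -> (p <= #|D|)%N ->
  exists2 S' : {set T}, S \subset S' /\ S' \subset D & #|S'| = p.
Proof.
move=> SD; elim: p => [|p IH] Sp pD.
  by exists S; [split | apply/eqP; rewrite -leqn0].
move: Sp; rewrite leq_eqVlt => /orP [/eqP E|Sp]; first by exists S; [split | ].
have [S' [SS' S'D] S'p] := IH Sp (ltnW pD).
have [x xD xS'] : exists2 x, x \in D & x \notin S'.
  apply/subsetPn; apply/negP => /subset_leq_card; rewrite S'p; lia.
exists (x |: S')%SET; last by rewrite cardsU1 xS' S'p.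
split; last by rewrite finset.subUset finset.sub1set xD.
by apply: fintype.subset_trans SS' _; exact: finset.subsetUr.
Qed.

(** Selects the smallest indices, which will be those with the narrowest windows. *)
Lemma initial_subset n (S : {set 'I_n}) p : (p <= #|S|)%N -> exists2 T : {set 'I_n}, T \subset S /\ #|T| = p &
  forall i i', i \in S -> i \notin T -> i' \in T -> (i' < i)%N.
Proof.
move: {2}(#|S|) (leqnn #|S|) => q; elim: q S => [|q IH] S Sq pS.
  by exists S; [split=> //; lia | move=> i i' ->].
have [Ep|ne] := eqVneq p #|S|; first by exists S; [split | move=> i i' ->].
have /card_gt0P [i0 Hi0] : (0 < #|S|)%N by lia.
have [i1 Hi1' Hmax] := arg_maxnP (fun i : 'I_n => i : nat) Hi0; have Hi1 : i1 \in S := Hi1'.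
have cS : #|S| = #|(S :\ i1)%SET|.+1 by rewrite (cardsD1 i1) Hi1.
have [||T [TS Tp] HT] := IH (S :\ i1)%SET; [lia | lia |].
exists T; first by split=> //; apply: fintype.subset_trans TS _; exact: finset.subD1set.
move=> i i' iS iT i'T; have := fintype.subsetP TS _ i'T; rewrite finset.in_setD1 => /andP [ne' i'S].
have [E|ni] := eqVneq i i1.
  have Hle : (i' <= i1)%N := Hmax _ i'S.
  by rewrite E ltn_neqAle Hle andbT; apply: contra ne' => /eqP/val_inj ->.
by apply: HT => //; rewrite finset.in_setD1 ni.
Qed.

Section CollapseR.
Variable R : realType.

(** Constant on [m, m + 1 - zt] for each integer m, then of slope [1 / zt] up to m + 1. This last
    stretch, of length [zt], is the window. *)
Definition collapse (zt t : R) : R :=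
  (Num.floor t)%:~R + Num.max 0 (1 - ((Num.floor t)%:~R + 1 - t) / zt).

Lemma floorP (t : R) : (Num.floor t)%:~R <= t < (Num.floor t)%:~R + 1.
Proof. by have := floor_itv t; rewrite intrD. Qed.

Lemma collapse_bounds zt t : 0 < zt -> zt <= 1 ->
  (Num.floor t)%:~R <= collapse zt t <= t.
Proof.
move=> zt0 zt1; have /andP [h1 h2] := floorP t; rewrite /collapse lerDl le_max lexx /=.
have : Num.max 0 (1 - ((Num.floor t)%:~R + 1 - t) / zt) <= t - (Num.floor t)%:~R.
  rewrite ge_max subr_ge0 h1 /= lerBlDr -lerBlDl ler_pdivlMr //; nra.
lra.
Qed.

Lemma collapse_lip zt t t' : 0 < zt -> zt <= 1 -> `|collapse zt t - collapse zt t'| <= `|t - t'| / zt.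
Proof.
move=> zt0 zt1.
suff H x y : x <= y -> `|collapse zt y - collapse zt x| <= (y - x) / zt.
  case: (lerP t t') => Htt; first by rewrite distrC; exact: H.
  by apply: H; exact: ltW.
move=> xy; have /andP [x1 x2] := floorP x; have /andP [y1 y2] := floorP y.
have /andP [cx1 cx2] := collapse_bounds x zt0 zt1; have /andP [cy1 cy2] := collapse_bounds y zt0 zt1.
have Hfl := le_floor xy.
have Ux (w : R) : collapse zt w >= (Num.floor w)%:~R + 1 - ((Num.floor w)%:~R + 1 - w) / zt.
  by rewrite /collapse -addrA lerD2l le_max lexx orbT.
have [E|ne] := eqVneq (Num.floor x) (Num.floor y).
  rewrite /collapse -E; move: (Num.floor x)%:~R => f.
  have Eq : (1 - (f + 1 - y) / zt) - (1 - (f + 1 - x) / zt) = (y - x) / zt by field; rewrite gt_eqF.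
  have : 0 <= (y - x) / zt by rewrite divr_ge0 ?subr_ge0 // ltW.
  have M (A B : R) : A <= B -> `|Num.max 0 B - Num.max 0 A| <= B - A.
    by move=> AB; rewrite ler_norml; case: (lerP 0 A) => hA; case: (lerP 0 B) => hB; lra.
  move: Eq; move: ((f + 1 - y) / zt) ((f + 1 - x) / zt) ((y - x) / zt) => A B C Eq C0.
  have -> : f + Num.max 0 (1 - A) - (f + Num.max 0 (1 - B)) = Num.max 0 (1 - A) - Num.max 0 (1 - B) by ring.
  by rewrite -Eq; apply: M; lra.
have Hf1 : (Num.floor x)%:~R + 1 <= (Num.floor y)%:~R :> R.
  have : Num.floor x + 1 <= Num.floor y by rewrite lezD1 lt_neqAle ne.
  by rewrite -(@ler_int R) intrD.
have cxfl : collapse zt x <= (Num.floor x)%:~R + 1 by lra.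
have := Ux x.
have h1 : (y - ((Num.floor x)%:~R + 1)) <= (y - ((Num.floor x)%:~R + 1)) / zt.
  rewrite ler_pdivlMr // ler_piMr //; lra.
have Eq : (y - x) / zt = (y - ((Num.floor x)%:~R + 1)) / zt + ((Num.floor x)%:~R + 1 - x) / zt by rewrite -mulrDl; congr (_ / _); ring.
rewrite Eq ler_norml; lra.
Qed.

Lemma collapse_window zt t : 0 < zt -> zt <= (Num.floor t)%:~R + 1 - t -> collapse zt t = (Num.floor t)%:~R.
Proof.
move=> zt0 h; rewrite /collapse max_l ?addr0 // subr_le0 ler_pdivlMr // mul1r //.
Qed.

(** Parities distinguish close points as well as floors do, but keep the number of keys independent
    of the size of the domain. *)
Lemma floor_eq_parity (t t' : R) : `|t - t'| < 1 -> odd `|Num.floor t| = odd `|Num.floor t'| ->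
  Num.floor t = Num.floor t'.
Proof.
move=> Ht Hp; have /andP [x1 x2] := floorP t; have /andP [y1 y2] := floorP t'.
move: Ht; rewrite ltr_norml => /andP [h1 h2].
have H1 : Num.floor t < Num.floor t' + 2 by rewrite -(@ltr_int R) intrD; lra.
have H2 : Num.floor t' < Num.floor t + 2 by rewrite -(@ltr_int R) intrD; lra.
lia.
Qed.

End CollapseR.

Definition in_box (R : realType) n (W : R) (x : 'rV[R]_n) := forall i, 0 <= x 0 i <= W.

Definition mid_range n j l : {set 'I_n} := [set i : 'I_n | (j <= i < l)%N]%SET.

Lemma card_mid_range n j l : (l <= n)%N -> #|mid_range n j l| = (l - j)%N.
Proof.
move=> ln; have -> : (l - j)%N = (\sum_(j <= i < l) 1)%N by rewrite sum_nat_const_nat muln1.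
rewrite (big_nat_widenl _ 0) // (big_nat_widen _ _ _ _ _ ln) big_mkord sum1dep_card.
by apply: eq_card => i; rewrite !finset.in_set andbC.
Qed.

(* [exc] are the points where more than [k - j] coordinates lie in windows; [key] records the windows and the parities. *)
Lemma collapse_exists (R : realType) n j k l (W eta : R) : (j < k)%N -> (k <= l)%N -> (l <= n.+1)%N ->
  0 <= W -> 0 < eta ->
  exists (G : 'rV[R]_n.+1 -> 'rV[R]_n.+1) (LG : R) (exc : 'rV[R]_n.+1 -> Prop)
    (key : 'rV[R]_n.+1 -> {set 'I_n.+1} * {set 'I_n.+1}),
  [/\ 0 <= LG,
   forall x z e, in_box W x -> in_box W z -> cnear e x z -> cnear (LG * e) (G x) (G z),
   forall x, in_box W x -> forall i, `|G x 0 i - x 0 i| <= 2,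
   forall x (i : 'I_n.+1), ~~ (j <= i < l)%N -> G x 0 i = x 0 i &
   (forall x, ~ exc x -> exists S : {set 'I_n.+1}, [/\ S \subset mid_range n.+1 j l, #|S| = (k - j)%N &
      forall i, i \in mid_range n.+1 j l -> i \notin S -> exists m : int, G x 0 i = m%:~R]) /\
   (forall K, exists S : {set 'I_n.+1}, [/\ S \subset mid_range n.+1 j l, #|S| = (k - j)%N &
      forall x x', in_box W x -> in_box W x' -> exc x -> exc x' -> key x = K -> key x' = K ->
      (forall i : 'I_n.+1, (k <= i)%N -> x 0 i = x' 0 i) ->
      forall i, i \in mid_range n.+1 j l -> `|G x 0 i - G x' 0 i| <= if i \in S then 1 else eta])].
Proof.
move=> jk kl ln W0 eta0.
have [p Ep] : exists p, (k - j)%N = p.+1 by exists (k - j).-1; lia.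
set N := (l - j)%N; have pN : (p < N)%N by rewrite /N; lia.
have P0 : 0 < p.+1%:R :> R by rewrite ltr0n.
(* Slopes so small that the tilt moves a coordinate by at most 1 on the box of side [W]. *)
pose dl : R := (p.+1%:R * W + 1)^-1.
have q0 : 0 < p.+1%:R * W + 1 by rewrite ltr_wpDl // mulr_ge0 // ltW.
have dl0 : 0 < dl by rewrite invr_gt0.
have dl1 : dl <= 1 by rewrite invf_le1 // lerDr mulr_ge0 // ltW.
(* For two points of a slice in the same window, the floors differ by at most [p.+1%:R * W + 1]. *)
pose D := (Num.truncn (p.+1%:R * W)).+2.
have [r [Gr r1 r2 r3]] := @general_rows_exist R p D N dl dl0 dl1 pN.
have [C [C0 [HC [zt0 [zt00 Hzt]]]]] := general_rows_quantitative Gr r2.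
pose K0 : R := p.+1%:R * C + 1.
have K00 : 0 < K0 by rewrite ltr_wpDl // mulr_ge0 // ltW.
pose th : R := Num.min 1 (Num.min eta (1/2) / K0).
have th0 : 0 < th by rewrite lt_min ltr01 divr_gt0 // lt_min eta0 divr_gt0.
have th1 : th <= 1 by rewrite ge_min lexx.
have thK : p.+1%:R * (C * th) <= Num.min eta (1/2).
  apply: (@le_trans _ _ (th * K0)).
    by rewrite /K0 mulrDr mulr1 mulrA [_ * th]mulrC lerDl ltW.
  by rewrite -ler_pdivlMr // ge_min lexx orbT.
pose zt1 : R := Num.min zt0 1.
have zt10 : 0 < zt1 by rewrite lt_min zt00 ltr01.
(* The widths grow by the factor [1 / th] with the index, so earlier windows are negligible compared
   with later ones. *)
pose zt (i : 'I_n.+1) : R := zt1 * th ^+ (n.+1 - i).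
have ztp i : 0 < zt i by rewrite mulr_gt0 // exprn_gt0.
have ztle i : zt i <= zt1 by rewrite /zt ler_piMr ?(ltW zt10) // exprn_ile1 // ltW.
have zt_1 i : zt i <= 1 by apply: le_trans (ztle i) _; rewrite ge_min lexx orbT.
have zt_0 i : zt i <= zt0 by apply: le_trans (ztle i) _; rewrite ge_min lexx.
have zth (i i' : 'I_n.+1) : (i' < i)%N -> zt i' <= th * zt i.
  move=> ii; rewrite /zt mulrCA ler_pM2l // -exprS ler_wiXn2l ?(ltW th0) //.
  by move: (ltn_ord i) ii; clear; lia.
pose zp (x : 'rV[R]_n.+1) : 'rV[R]_p.+1 := \row_a x 0 (inord (j + a)).
(* For [j <= i < k] the row is a basis vector and [X x i] is [x 0 i]; for [k <= i < l] it is [x 0 i]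
   tilted by a small linear form in [zp x]. Along a slice, where the coordinates from [k] on are
   fixed, every difference of [X] is thus a value of a row in general position. *)
pose X (x : 'rV[R]_n.+1) (i : 'I_n.+1) : R := (if (i < k)%N then 0 else x 0 i) + dotp (r (i - j)%N) (zp x).
pose G (x : 'rV[R]_n.+1) : 'rV[R]_n.+1 := \row_i (if (j <= i < l)%N then collapse (zt i) (X x i) else x 0 i).
pose win (x : 'rV[R]_n.+1) : {set 'I_n.+1} :=
  [set i in mid_range n.+1 j l | (Num.floor (X x i))%:~R + 1 - X x i < zt i]%SET.
pose par (x : 'rV[R]_n.+1) : {set 'I_n.+1} := [set i : 'I_n.+1 | odd `|Num.floor (X x i)|]%SET.
have dotB i (z z' : 'rV[R]_p.+1) : dotp (r i) (z - z') = dotp (r i) z - dotp (r i) z'.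
  by rewrite /dotp -sumrB; apply: eq_bigr => a _; rewrite !mxE mulrBl.
have dot_le i (z : 'rV[R]_p.+1) (e : R) : (forall a, `|z 0 a| <= e) -> `|dotp (r i) z| <= p.+1%:R * e.
  move=> Hz; apply: le_trans (ler_norm_sum _ _ _) _.
  have -> : p.+1%:R * e = \sum_(i < p.+1) e by rewrite sumr_const card_ord mulr_natl.
  by apply: ler_sum => a _; rewrite normrM -[leRHS]mulr1; apply: ler_pM.
have zpB (x x' : 'rV[R]_n.+1) (e : R) : (forall i, `|x 0 i - x' 0 i| <= e) -> forall a, `|(zp x - zp x') 0 a| <= e.
  by move=> H a; rewrite !mxE.
have Xx x (i : 'I_n.+1) : in_box W x -> (j <= i < l)%N -> `|X x i - x 0 i| <= 1.
  move=> Hx /andP [ji il]; rewrite /X; case: ifP => ik.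
    have Hi : (i - j < p.+1)%N by clear -Ep ik ji; lia.
    have -> : (i - j)%N = Ordinal Hi by [].
    rewrite r1 /dotp (bigD1 (Ordinal Hi)) //= big1 ?addr0; last first.
      by move=> a na; rewrite [delta_mx _ _ _ _]mxE (negbTE na) andbF mulr0.
    rewrite !mxE !eqxx mulr1 add0r.
    have -> : inord (j + (i - j)) = i by apply: val_inj; rewrite /= inordK subnKC.
    by rewrite subrr normr0 ler01.
  rewrite addrAC subrr add0r; have := ltn_ord i => Hi.
  apply: le_trans (ler_norm_sum _ _ _) _.
  have -> : 1 = \sum_(a < p.+1) (p.+1%:R)^-1 :> R by rewrite sumr_const card_ord -[RHS]mulr_natl divff // gt_eqF.
  apply: ler_sum => a _; rewrite normrM; apply: (@le_trans _ _ (W * dl)).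
    apply: ler_pM => //; last by apply: r3; rewrite /N; move/negbT: ik => ik; clear -Ep ik ji il jk; lia.
    by rewrite mxE ger0_norm; have /andP [] := Hx (inord (j + a)).
  rewrite /dl ler_pdivrMr // mulrDr mulrA mulVf ?gt_eqF // mul1r mulr1.
  by rewrite lerDl invr_ge0 ltW.
have zp_box (x x' : 'rV[R]_n.+1) : in_box W x -> in_box W x' -> forall i, `|x 0 i - x' 0 i| <= W.
  by move=> h1 h2 i; have := h1 i; have := h2 i; rewrite ler_norml; lra.
have XB (x x' : 'rV[R]_n.+1) (i : 'I_n.+1) : (k <= i)%N -> x 0 i = x' 0 i -> X x i - X x' i = dotp (r (i - j)%N) (zp x - zp x').
  by rewrite /X dotB ltnNge => -> /= ->; rewrite opprD addrACA subrr add0r.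
have XB' (x x' : 'rV[R]_n.+1) (i : 'I_n.+1) : (i < k)%N -> X x i - X x' i = dotp (r (i - j)%N) (zp x - zp x').
  by rewrite /X dotB => ->; rewrite !add0r.
have ip1 : 0 <= 1 + p.+1%:R :> R by rewrite addr_ge0 // ltW.
pose LG : R := 1 + (1 + p.+1%:R) / (zt1 * th ^+ n.+1).
have ztmin0 : 0 < zt1 * th ^+ n.+1 by rewrite mulr_gt0 // exprn_gt0.
have ztmin i : zt1 * th ^+ n.+1 <= zt i.
  by rewrite /zt ler_pM2l // ler_wiXn2l ?(ltW th0) // leq_subr.
have LG0 : 0 <= LG by rewrite /LG addr_ge0 // divr_ge0 // ltW.
exists G, LG, (fun x => (p.+1 < #|win x|)%N), (fun x => (win x, par x)); split=> //.
- move=> x z e Hx Hz Hn i.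
  have e0 : 0 <= e by apply: le_trans (Hn i).
  rewrite /G !mxE; case: ifP => ji; last first.
    by apply: le_trans (Hn i) _; rewrite /LG mulrDl mul1r lerDl mulr_ge0 // divr_ge0 // ltW.
  apply: le_trans (collapse_lip _ _ (ztp i) (zt_1 i)) _.
  have HX : `|X z i - X x i| <= (1 + p.+1%:R) * e.
    have Hd : `|dotp (r (i - j)%N) (zp z - zp x)| <= p.+1%:R * e by apply: dot_le; exact: zpB Hn.
    have [ik|ki] := ltnP i k.
      by rewrite XB' //; apply: le_trans Hd _; rewrite mulrDl mul1r lerDr.
    rewrite /X ltnNge ki /= opprD addrACA -dotB mulrDl mul1r.
    by apply: le_trans (ler_normD _ _) _; apply: lerD.
  rewrite /LG mulrDl mul1r; apply: ler_wpDl => //.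
  rewrite mulrAC; apply: ler_pM => //; first by rewrite invr_ge0 ltW.
  by rewrite lef_pV2 // posrE.
- move=> x Hx i; rewrite /G mxE; case: ifP => ji; last by rewrite subrr normr0.
  have := Xx x i Hx ji; have := collapse_bounds (X x i) (ztp i) (zt_1 i).
  have := floorP (X x i); rewrite !ler_norml; lra.
- by move=> x i /negbTE ji; rewrite /G mxE ji.
have cmid : #|mid_range n.+1 j l| = N by exact: card_mid_range.
split.
  move=> x /negP; rewrite -leqNgt => Hw.
  have [|||S [S1 S2] S3] := @subset_of_card _ (win x) (mid_range n.+1 j l) p.+1 => //.
  - by apply/fintype.subsetP => i; rewrite finset.in_set => /andP [].
  - by rewrite cmid.
  exists S; split=> //; first by rewrite Ep.
  move=> i im iS; exists (Num.floor (X x i)); rewrite /G mxE.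
  have := im; rewrite /mid_range finset.in_set => ->; apply: collapse_window => //.
  rewrite leNgt; apply/negP => Hlt; case/negP: iS; apply: (fintype.subsetP S1).
  by rewrite finset.in_set im.
move=> [S Pr]; have [HS|nHS] := boolP ((S \subset mid_range n.+1 j l) && (p.+1 < #|S|)%N); last first.
  have [|||S' [_ S2] S3] := @subset_of_card _ finset.set0 (mid_range n.+1 j l) p.+1.
  - exact: finset.sub0set.
  - by rewrite cards0.
  - by rewrite cmid.
  exists S'; split=> //; first by rewrite Ep.
  move=> x x' _ _ ex _ [Ew _]; case/negP: nHS; rewrite -Ew ex andbT.
  by apply/fintype.subsetP => i; rewrite finset.in_set => /andP [].
have /andP [Smid Sp] := HS.
have [T [TS Tp] HT] := initial_subset (ltnW Sp).
exists T; split=> //; [exact: fintype.subset_trans TS Smid | by rewrite Ep |].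
move=> x x' Hx Hx' ex ex' [Ewx Epx] [Ewx' Epx'] Hsl.
have Xdot (i : 'I_n.+1) : X x i - X x' i = dotp (r (i - j)%N) (zp x - zp x').
  by have [ik|ki] := ltnP i k; [exact: XB' | apply: XB => //; exact: Hsl].
have Smid' (i : 'I_n.+1) : i \in S -> (j <= i < l)%N.
  by move=> /(fintype.subsetP Smid); rewrite finset.in_set.
have winP (y : 'rV[R]_n.+1) (i : 'I_n.+1) : win y = S -> i \in S ->
    0 <= (Num.floor (X y i))%:~R + 1 - X y i <= zt i.
  move=> <-; rewrite /win finset.in_set => /andP [_ h]; have := floorP (X y i).
  by rewrite (ltW h) andbT => /andP [_ /ltW h']; rewrite subr_ge0.
(* The rows of [T] and [i1] number [p.+2] and take nearly integral values, so general position makes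
   these integers 0. The [p.+1] rows of [T], whose windows are narrower than that of [i1], then
   confine [zp x - zp x'] to a small multiple of [zt i1], small enough to survive the slope
   [1 / zt i1] of the collapse. *)
have step (i1 : 'I_n.+1) : i1 \in S -> i1 \notin T ->
   (forall i, i \in i1 :: enum T -> Num.floor (X x i) = Num.floor (X x' i)) /\
   forall i, `|X x i - X x' i| <= Num.min eta (1/2) * zt i1.
  move=> i1S i1T.
  pose ff (i : 'I_p.+2) := nth i1 (i1 :: enum T) i.
  have szT : size (i1 :: enum T) = p.+2 by rewrite /= -cardE Tp.
  have ffm i : ff i \in i1 :: enum T by apply: mem_nth; rewrite szT.
  have ffS i : ff i \in S.
    by have := ffm i; rewrite inE mem_enum => /orP [/eqP ->//|/(fintype.subsetP TS)].
  have ffI : injective ff.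
    move=> i i' /eqP; rewrite nth_uniq ?szT // => [/eqP/val_inj //|].
    by rewrite /= mem_enum i1T enum_uniq.
  pose f i := (ff i - j)%N.
  have fI : injective f.
    move=> i i' E; apply: ffI; apply: val_inj => /=.
    by have := Smid' _ (ffS i); have := Smid' _ (ffS i'); rewrite /f in E; clear -E; lia.
  have fN i : (f i < N)%N by have := Smid' _ (ffS i); rewrite /f /N; clear; lia.
  have fz i : `|dotp (r (f i)) (zp x - zp x') - (Num.floor (X x (ff i)) - Num.floor (X x' (ff i)))%:~R| <= zt (ff i).
    rewrite -Xdot intrB; have := winP x (ff i) Ewx (ffS i); have := winP x' (ff i) Ewx' (ffS i).
    rewrite ler_norml; lra.
  have fD i : (`|(Num.floor (X x (ff i)) - Num.floor (X x' (ff i)))%R| <= D)%N.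
    have h1 : `|dotp (r (f i)) (zp x - zp x')| <= p.+1%:R * W.
      by apply: dot_le; apply: zpB; exact: zp_box.
    have h2 := truncnS_gt (p.+1%:R * W).
    have h4 : p.+1%:R * W + 1 <= D%:R by rewrite /D -[leRHS]natr1 lerD2r ltW.
    have h3 : `|(Num.floor (X x (ff i)) - Num.floor (X x' (ff i)))%:~R| <= D%:R :> R.
      move: (fz i) (zt_1 (ff i)) h1 h4; move: (dotp _ _) (_%:~R) (zt _) (_ * W) (D%:R : R) => A B E F d.
      by clear; rewrite !ler_norml; lra.
    by rewrite -(@ler_nat R) natr_absz intr_norm.
  have d0 := Hzt f _ (zp x - zp x') fI fN fD (fun i => le_trans (fz i) (zt_0 _)).
  split.
    move=> i Hi; have Hidx : (index i (i1 :: enum T) < p.+2)%N by rewrite -szT index_mem.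
    have := d0 (Ordinal Hidx); rewrite /ff /= nth_index // => /eqP; rewrite subr_eq0 => /eqP //.
  have Hz : forall a, `|(zp x - zp x') 0 a| <= C * (th * zt i1).
    apply: (HC (fun s : 'I_p.+1 => f (lift ord0 s))) => [s s' /fI /lift_inj //|//|s].
    have := fz (lift ord0 s); rewrite (d0 _) subr0 => h; apply: le_trans h _; apply: zth.
    apply: HT => //; rewrite /ff /= -mem_enum; apply: mem_nth.
    by rewrite -cardE Tp; exact: ltn_ord.
  move=> i; rewrite Xdot; apply: le_trans (dot_le _ _ _ Hz) _.
  have -> : p.+1%:R * (C * (th * zt i1)) = p.+1%:R * (C * th) * zt i1 by ring.
  by rewrite ler_pM2r.
have [i0 i0S i0T] : exists2 i, i \in S & i \notin T.
  by apply/subsetPn; apply/negP => /subset_leq_card; rewrite Tp; clear -Sp; lia.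
have [F0 X0] := step i0 i0S i0T.
move=> i im; have jil : (j <= i < l)%N by move: im; rewrite finset.in_set.
rewrite /G !mxE jil.
case: (boolP (i \in T)) => iT.
  have iS : i \in S by apply: (fintype.subsetP TS).
  have E := F0 i; rewrite inE mem_enum iT orbT in E.
  have h1 := winP x i Ewx iS; have h2 := winP x' i Ewx' iS.
  have := collapse_bounds (X x i) (ztp i) (zt_1 i); have := collapse_bounds (X x' i) (ztp i) (zt_1 i).
  move: h1 h2; have := floorP (X x i); have := floorP (X x' i); rewrite (E isT) ler_norml; lra.
have [iS|iS] := boolP (i \in S).
  apply: le_trans (collapse_lip _ _ (ztp i) (zt_1 i)) _; rewrite ler_pdivrMr //.
  have [_ h] := step i iS iT; apply: le_trans (h i) _.
  by rewrite ler_pM2r // ge_min lexx.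
have nw (y : 'rV[R]_n.+1) : win y = S -> zt i <= (Num.floor (X y i))%:~R + 1 - X y i.
  move=> Ey; rewrite leNgt; apply/negP => h; case/negP: iS; rewrite -Ey /win finset.in_set im.
  exact: h.
rewrite !collapse_window //; try exact: nw.
suff -> : Num.floor (X x i) = Num.floor (X x' i) by rewrite subrr normr0 ltW.
apply: floor_eq_parity.
  apply: le_lt_trans (X0 i) _; apply: (@le_lt_trans _ _ (1/2 * 1)); last lra.
  by apply: ler_pM => //; rewrite ?le_min ?(ltW eta0) ?(ltW (ztp _)) ?divr_ge0 // ge_min lexx orbT.
have : (i \in par x) = (i \in par x') by rewrite Epx Epx'.
by rewrite !finset.in_set.
Qed.

(** * Choosing the labels *)

Section Cells.
Variables (R : realType) (n j k l : nat) (rho : 'I_n -> R) (g : nat).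
Hypotheses (jk : (j < k)%N) (kl : (k <= l)%N) (ln : (l <= n)%N) (g0 : (0 < g)%N).
Hypothesis rho_lo : forall i : 'I_n, (i < j)%N -> rho i <= 1.
Hypothesis rho_hi : forall i : 'I_n, (j <= i < l)%N -> 1 <= rho i.

Definition in_range (x : 'rV[R]_n) := forall i, 4 <= x 0 i <= 4 + rho i.

Definition on_skeleton (S : {set 'I_n}) (x : 'rV[R]_n) :=
  forall i, i \in mid_range n j l -> i \notin S -> exists m : int, x 0 i = m%:~R.

(** Scale [1 / g] in the [k] directions along which a cell extends, integer levels in the other
    collapsed directions, nothing from [l] on, where the slice fixes the coordinate. The offset 4 is
    the corner of the normalised domain. *)
Definition cell_coord (S : {set 'I_n}) (x : 'rV[R]_n) (i : 'I_n) : nat :=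
  if (i < j)%N || (i \in S) then Num.truncn ((x 0 i - 4) * g%:R)
  else if (i < l)%N then Num.truncn (x 0 i - 4) else 0%N.

Definition cell_len (S : {set 'I_n}) (i : 'I_n) : nat :=
  if (i < j)%N then g else if i \in S then Num.truncn (rho i * g%:R)
  else if (i < l)%N then Num.truncn (rho i) else 0%N.

Lemma cell_coord_len S x i : in_range x -> (cell_coord S x i <= cell_len S i)%N.
Proof.
move=> /(_ i) /andP [h1 h2]; have gR : 0 < g%:R :> R by rewrite ltr0n.
rewrite /cell_coord /cell_len; have [ij|ij] /= := ltnP i j.
  rewrite -ltnS truncn_lt_nat; last by rewrite mulr_ge0 ?subr_ge0 // ltW.
  apply: (@le_lt_trans _ _ (1 * g%:R)); last by rewrite mul1r ltr_nat.
  by rewrite ler_pM2r //; have := rho_lo ij; lra.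
case: ifP => _; first by apply: le_truncn; rewrite ler_pM2r //; lra.
by case: ifP => // _; apply: le_truncn; lra.
Qed.

Lemma cell_len_real (S : {set 'I_n}) i : S \subset mid_range n j l ->
  (cell_len S i).+1%:R <= 2 * (if (i < j)%N || (i \in S) then g%:R else 1) *
    (if (j <= i < l)%N then rho i else 1).
Proof.
move=> SM; have g1 : 1 <= g%:R :> R by rewrite ler1n.
have tr (x : R) : 1 <= x -> (Num.truncn x).+1%:R <= 2 * x.
  move=> x1; have : (Num.truncn x)%:R <= x by rewrite truncn_le; lra.
  by rewrite -natr1; lra.
rewrite /cell_len; case: ifP => [ij|/negbT ij] /=.
  by rewrite leqNgt ij /= mulr1 -natr1; lra.
rewrite -leqNgt in ij; case: ifP => [iS|iS].
  have := fintype.subsetP SM i iS; rewrite finset.in_set => H; rewrite H.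
  rewrite -mulrA [g%:R * _]mulrC; apply: tr; have := rho_hi H; nra.
rewrite ij /= mulr1; case: ifP => il; last by rewrite mulr1 ler1n.
by apply: tr; apply: rho_hi; rewrite ij il.
Qed.

(** One factor [2 ^+ n] of the count is for the choice of [S], another for rounding up the numbers
    of subdivisions. *)
Lemma cells_exist : exists (Cell : finType) (cell : {set 'I_n} -> 'rV[R]_n -> Cell) (V : {set Cell}),
  [/\ #|V|%:R <= 4 ^+ n * g%:R ^+ k * \prod_(i < n | (j <= i < l)%N) rho i,
   forall (S : {set 'I_n}) x, S \subset mid_range n j l -> #|S| = (k - j)%N -> in_range x -> cell S x \in V,
   forall S x S' x', cell S x = cell S' x' -> S = S' &
   forall S x x', cell S x = cell S x' -> in_range x -> in_range x' -> on_skeleton S x -> on_skeleton S x' ->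
     forall i : 'I_n, (i < l)%N -> `|x 0 i - x' 0 i| <= if (i < j)%N || (i \in S) then g%:R^-1 else 0].
Proof.
have gR : 0 < g%:R :> R by rewrite ltr0n.
pose P := (\sum_(S : {set 'I_n}) \sum_i cell_len S i)%N.
have lenP S i : (cell_len S i < P.+1)%N.
  by rewrite ltnS /P (bigD1 S) //= (bigD1 i) //= -addnA leq_addr.
pose Cell : finType := ({set 'I_n} * {ffun 'I_n -> 'I_P.+1})%type.
pose cell (S : {set 'I_n}) x : Cell := (S, [ffun i => inord (cell_coord S x i)]).
pose okS (S : {set 'I_n}) := (S \subset mid_range n j l) && (#|S| == k - j)%N.
pose V : {set Cell} := [set c : Cell | okS c.1 && [forall i, (c.2 i <= cell_len c.1 i)%N]]%SET.
have cE S x i : in_range x -> ((cell S x).2 i : nat) = cell_coord S x i.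
  by move=> Hx; rewrite ffunE inordK // (leq_ltn_trans (cell_coord_len S i Hx) (lenP S i)).
exists Cell, cell, V; split.
- have cV : (#|V| <= \sum_(S | okS S) \prod_i (cell_len S i).+1)%N.
    rewrite -sum1_card (eq_bigl (fun c : Cell => okS c.1 && [forall i, (c.2 i <= cell_len c.1 i)%N])); last first.
      by move=> c; rewrite finset.in_set.
    rewrite -(pair_big_dep okS (fun S (c : {ffun 'I_n -> 'I_P.+1}) => [forall i, (c i <= cell_len S i)%N]) (fun _ _ => 1%N)) /=.
    apply: leq_sum => S _; rewrite sum1dep_card.
    pose F i : pred 'I_P.+1 := fun x => (x <= cell_len S i)%N.
    have -> : #|[set c : {ffun 'I_n -> 'I_P.+1} | [forall i, (c i <= cell_len S i)%N]]%SET| = #|family F|.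
      apply: eq_card => b; rewrite finset.in_set; apply/forallP/familyP => H s; have := H s; by rewrite unfold_in.
    rewrite card_family foldrE big_map big_enum /=; apply: leq_prod => i _.
    rewrite -[leqRHS](card_ord (cell_len S i).+1) -(@card_in_image _ _ (fun x : 'I_P.+1 => inord x : 'I_(cell_len S i).+1)) ?max_card //.
    move=> x y; rewrite -!topredE /= /F => hx hy E; apply: val_inj => /=.
    by rewrite -(@inordK (cell_len S i) x) // -(@inordK (cell_len S i) y) // E.
  apply: (@le_trans _ _ (\sum_(S | okS S) (2 ^+ n * g%:R ^+ k * \prod_(i < n | (j <= i < l)%N) rho i))).
    apply: (@le_trans _ _ (\sum_(S | okS S) \prod_i (cell_len S i).+1)%:R); first by rewrite ler_nat.
    rewrite natr_sum; apply: ler_sum => S /andP [SM /eqP Sc]; rewrite natr_prod.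
    apply: (@le_trans _ _ (\prod_(i < n) (2 * (if (i < j)%N || (i \in S) then g%:R else 1) *
        (if (j <= i < l)%N then rho i else 1)))).
      by apply: ler_prod => i _; rewrite ler0n /=; exact: cell_len_real.
    rewrite !big_split /= prodr_const card_ord -big_mkcond -[in X in _ * X]big_mkcond /= prodr_const.
    suff -> : #|[pred i : 'I_n | (i < j)%N || (i \in S)]| = k by [].
    rewrite (eq_card (B := (mid_range n 0 j :|: S)%SET)); last by move=> i; rewrite !finset.inE.
    rewrite cardsU card_mid_range; last by lia.
    suff -> : (mid_range n 0 j :&: S)%SET = finset.set0 by rewrite cards0 Sc; lia.
    apply/setP => i; rewrite !finset.inE; case: (boolP (i \in S)) => iS; last by rewrite andbF.
    by have := fintype.subsetP SM i iS; rewrite finset.in_set => /andP [h _]; rewrite ltnNge h.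
  rewrite sumr_const -[leLHS]mulr_natl !mulrA ler_wpM2r //.
    by apply: prodr_ge0 => i /rho_hi; lra.
  rewrite ler_wpM2r ?exprn_ge0 // -[4]/((2 * 2)%:R) natrM exprMn ler_wpM2r ?exprn_ge0 //.
  rewrite -natrX ler_nat; apply: leq_trans (max_card _) _.
  by rewrite -cardsT -powersetT card_powerset cardsT card_ord.
- move=> S x SM Sc Hx; rewrite finset.in_set /okS /= SM Sc eqxx /=; apply/forallP => i.
  by rewrite -/(cell S x) -[X in (nat_of_ord X)]/((cell S x).2 i) cE // cell_coord_len.
- by move=> S x S' x' [].
move=> S x x' Ecell Hx Hx' Sx Sx' i il.
have Ec : cell_coord S x i = cell_coord S x' i by rewrite -!cE // Ecell.
have x4 : 0 <= x 0 i - 4 by have := Hx i; lra.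
have x4' : 0 <= x' 0 i - 4 by have := Hx' i; lra.
move: Ec; rewrite /cell_coord; case: ifP => [_|/negbT]; last first.
  rewrite negb_or il -leqNgt => /andP [ji iS].
  have im : i \in mid_range n j l by rewrite finset.in_set ji il.
  have [z Ez] := Sx i im iS; have [z' Ez'] := Sx' i im iS.
  have tz (y : R) (z0 : int) : 0 <= y - 4 -> y = z0%:~R -> (Num.truncn (y - 4))%:R = y - 4.
    move=> y4 Ey; apply: truncnK; rewrite natrEint y4 andbT Ey.
    by rewrite rpredB // ?intr_int // rpred_nat.
  by move=> E; have := tz _ _ x4 Ez; have := tz _ _ x4' Ez'; rewrite E => -> h; rewrite ler_norml; lra.
move=> E; have := truncn_itv (mulr_ge0 x4 (ltW gR)); have := truncn_itv (mulr_ge0 x4' (ltW gR)).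
rewrite E; move: (Num.truncn _) => t; rewrite -natr1 => /andP [a1 a2] /andP [b1 b2].
have : `|(x 0 i - x' 0 i) * g%:R| <= 1.
  have -> : (x 0 i - x' 0 i) * g%:R = (x 0 i - 4) * g%:R - (x' 0 i - 4) * g%:R by ring.
  rewrite ler_norml; lra.
by rewrite normrM normr_nat => h; rewrite -[leRHS]mul1r ler_pdivlMr.
Qed.

End Cells.

(** The margins make the box number stable when [v] moves by at most 1/8. *)
Definition inside_box (R : realType) (be : nat) (v : R) := be%:R + 1/8 <= v <= be%:R + 7/8.

Lemma inside_box_inj (R : realType) be be' (v v' : R) : inside_box be v -> inside_box be' v' ->
  `|v - v'| <= 1/8 -> be = be'.
Proof.
rewrite /inside_box ler_norml => /andP [a1 a2] /andP [b1 b2] /andP [c1 c2].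
have h1 : (be < be'.+1)%N by rewrite -(@ltr_nat R) -natr1; lra.
have h2 : (be' < be.+1)%N by rewrite -(@ltr_nat R) -natr1; lra.
lia.
Qed.

(** The directions taken by the edge path before step [s], without those below [c], which the labels
    do not see. *)
Definition later n (c : nat) (tau : 'S_n) (s : 'I_n) : seq 'I_n :=
  enum [set i : 'I_n | (c <= i)%N && (tau i < s)%N]%SET.

(** Random box numbers fit a given cell in [l] components with probability at most one over the
    product of the [N s], and by the volume hypothesis the number of cells is at most a constant
    times this product times [g ^+ k]. So more than [A * g ^+ k] fitting cells are improbable, and
    [lattice_labels] excludes this for all [w] and [tau] at once. *)
Lemma box_labels (R : realType) n j k l (CN : R) : (j < k)%N -> (k <= l)%N -> (l <= n)%N -> 0 < CN ->
  exists A : R, 0 < A /\ forall (rho : 'I_n -> R) (g : nat) (N : 'I_n -> nat) (cr : 'rV[R]_n -> Prop)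
    (phi : 'rV[R]_n -> 'I_n -> R),
  (0 < g)%N -> (forall i : 'I_n, (i < j)%N -> rho i <= 1) -> (forall i : 'I_n, (j <= i < l)%N -> 1 <= rho i) ->
  (forall s, 0 < N s)%N ->
  (forall T : {set 'I_n}, #|T| = l -> \prod_(i < n | (j <= i < l)%N) rho i <= CN * \prod_(i in T) (N i)%:R) ->
  (forall x, cr x -> in_range rho x) ->
  (forall x x', cr x -> cr x' -> cnear (g%:R^-1) x x' -> forall s, `|phi x s - phi x' s| <= 1/8) ->
  exists (Cell : finType) (cell : {set 'I_n} -> 'rV[R]_n -> Cell),
  [/\ forall S x S' x', cell S x = cell S' x' -> S = S',
   forall S x x', cell S x = cell S x' -> in_range rho x -> in_range rho x' ->
     on_skeleton j l S x -> on_skeleton j l S x' ->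
     forall i : 'I_n, (i < l)%N -> `|x 0 i - x' 0 i| <= if (i < j)%N || (i \in S) then g%:R^-1 else 0 &
   forall H (dl : R), exists box : torus n H -> 'I_n -> nat, (forall u s, box u s < N s)%N /\
     forall (w : torus n H) (tau : 'S_n), exists Q : {set Cell}, #|Q|%:R <= A * g%:R ^+ k /\
     forall (S : {set 'I_n}) x, S \subset mid_range n j l -> #|S| = (k - j)%N -> cr x -> on_skeleton j l S x ->
       (forall i : 'I_n, (l <= i)%N -> x 0 i = dl * (w i)%:R) ->
       (forall a : 'I_n, (a < l)%N ->
          inside_box (box (vtx (@tsh n H) w (later l tau (tau a))) (tau a)) (phi x (tau a))) ->
       cell S x \in Q].
Proof.
move=> jk kl ln CN0; have [q [q0 Hq]] := lattice_labels n.
have qR : 0 < q%:R :> R by rewrite ltr0n.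
have p4 : 0 < 4 ^+ n :> R by rewrite exprn_gt0.
exists (q%:R * 4 ^+ n * CN); split; first by rewrite !mulr_gt0.
move=> rho g N cr phi g0 rlo rhi N0 Hvol Hcr Hosc.
have gR : 0 < g%:R :> R by rewrite ltr0n.
have [Cell [cell [V [cV HV HS Hcl]]]] := cells_exist jk kl ln g0 rlo rhi.
exists Cell, cell; split=> // H dl.
pose T1 := Num.truncn (q%:R * 4 ^+ n * CN * g%:R ^+ k).
have A0 : 0 <= q%:R * 4 ^+ n * CN * g%:R ^+ k by rewrite ltW // !mulr_gt0 // exprn_gt0.
pose Q0 := (\prod_s N s)%N.
have Q00 : (0 < Q0)%N by rewrite prodn_gt0.
pose meets (w : torus n H) (tau : 'S_n) (b : {ffun 'I_n -> 'I_Q0}) (c : Cell) : bool :=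
  `[< exists (S : {set 'I_n}) x, [/\ S \subset mid_range n j l /\ #|S| = (k - j)%N, cr x /\ on_skeleton j l S x,
     forall i : 'I_n, (l <= i)%N -> x 0 i = dl * (w i)%:R,
     forall a : 'I_n, (a < l)%N -> inside_box (b (tau a) %% N (tau a))%N (phi x (tau a)) &
     cell S x = c] >].
have [|w tau|f Hf] := Hq l H 'I_Q0 (fun w tau => [set b | T1 < #|[set c | meets w tau b c]%SET|]%SET)%N.
- by rewrite card_ord.
- pose Jt : {set 'I_n} := (tau @: mid_range n 0 l)%SET.
  have cJt : #|Jt| = l by rewrite card_imset ?card_mid_range ?subn0 //; exact: perm_inj.
  have HJt s : s \in Jt -> exists2 a : 'I_n, (a < l)%N & s = tau a.
    by move=> /imsetP [a]; rewrite finset.in_set => /andP [_ h] ->; exists a.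
  (* The map varies by at most 1/8 on a cell, so all labels that fit the cell have the same
     residues. *)
  have Hres c : (#|[set b | meets w tau b c]%SET| * \prod_(s in Jt) N s <= Q0 ^ n)%N.
    have [->|[b0]] := finset.set_0Vmem [set b | meets w tau b c]%SET; first by rewrite cards0.
    rewrite finset.in_set => /asboolP [S0 [x0 [[S01 S02] [C0 K0] W0 I0 E0]]].
    apply: leq_trans (residue_count Jt (fun s => b0 s %% N s)%N _ N0); last first.
      by move=> s; rewrite /Q0 (bigD1 s) //= dvdn_mulr.
    rewrite leq_mul2r; apply/orP; right; apply: subset_leq_card; apply/fintype.subsetP => b.
    rewrite !finset.in_set => /asboolP [S [x [[S1 S2] [C K] W I E]]]; apply/forall_inP => s /HJt [a al ->].
    have ES : S = S0 by apply: (HS S x S0 x0); rewrite E E0.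
    rewrite ES in K E; apply/eqP; apply: (inside_box_inj (I a al) (I0 a al)); apply: Hosc => // i.
    have [il|li] := ltnP i l; last by rewrite W // W0 // subrr normr0 invr_ge0 ltW.
    rewrite distrC; apply: le_trans (Hcl S0 x x0 _ (Hcr _ C) (Hcr _ C0) K K0 i il) _; first by rewrite E E0.
    by case: ifP => // _; rewrite invr_ge0 ltW.
  have HM := @markov_count {ffun 'I_n -> 'I_Q0} Cell (meets w tau) V (\prod_(s in Jt) N s) (Q0 ^ n) T1 _ Hres.
  have {}HM := HM (fun b c => _); rewrite card_ord.
  have HN0 : (0 < \prod_(s in Jt) N s)%N by rewrite prodn_cond_gt0.
  have H1 : (#|V| * q < T1.+1 * \prod_(s in Jt) N s)%N.
    rewrite -(@ltr_nat R) !natrM natr_prod.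
    have NR0 : 0 < \prod_(s in Jt) (N s)%:R :> R by rewrite prodr_gt0 // => s _; rewrite ltr0n.
    apply: (@le_lt_trans _ _ (q%:R * 4 ^+ n * CN * g%:R ^+ k * \prod_(s in Jt) (N s)%:R)); last first.
      by rewrite ltr_pM2r // truncnS_gt.
    apply: (@le_trans _ _ (4 ^+ n * g%:R ^+ k * (CN * \prod_(s in Jt) (N s)%:R) * q%:R)).
      rewrite ler_pM2r //; apply: le_trans cV _; rewrite ler_pM2l ?mulr_gt0 ?exprn_gt0 //.
      exact: Hvol.
    rewrite le_eqVlt; apply/orP; left; apply/eqP.
    by move: (4 ^+ n) (g%:R ^+ k) (\prod_(s in Jt) _) => X Y Z; ring.
  have PP : (0 < T1.+1 * \prod_(s in Jt) N s)%N by rewrite muln_gt0.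
  have QQ : (0 < Q0 ^ n)%N by rewrite expn_gt0 Q00.
  rewrite -(ltn_pmul2r PP) mulnAC; apply: leq_ltn_trans (leq_mul (HM _) (leqnn q)) _.
    move=> b c /asboolP [S [x [[S1 S2] [C K] W I <-]]]; apply: HV => //; exact: Hcr.
  by rewrite mulnAC [ltnRHS]mulnC ltn_pmul2r.
exists (fun u s => f u s %% N s)%N; split; first by move=> u s; rewrite ltn_mod.
move=> w tau; have := Hf w tau; rewrite finset.in_set -leqNgt => HT.
exists [set c | meets w tau [ffun s => f (vtx (@tsh n H) w (later l tau s)) s] c]%SET; split.
  by apply: (@le_trans _ _ T1%:R); [rewrite ler_nat | rewrite truncn_le].
move=> S x S1 S2 C K W I; rewrite finset.in_set; apply/asboolP; exists S, x; split=> // a al.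
by rewrite ffunE; exact: I.
Qed.

(** Labels that depend only on the coordinates from [c] on are obtained by evaluation at
    [low c u]. *)
Definition low n H (c : nat) (u : torus n H) : torus n H := [ffun i : 'I_n => if (i < c)%N then ord0 else u i].

Lemma truncn_close (R : realType) (y y' g : R) : 0 < g -> 0 <= y -> 0 <= y' ->
  Num.truncn (y * g) = Num.truncn (y' * g) -> `|y - y'| <= g^-1.
Proof.
move=> g0 y0 y0' E; have := truncn_itv (mulr_ge0 y0 (ltW g0)); have := truncn_itv (mulr_ge0 y0' (ltW g0)).
rewrite E; move: (Num.truncn _) => t; rewrite -natr1 => /andP [a1 a2] /andP [b1 b2].
have : `|(y - y') * g| <= 1 by rewrite mulrBl ler_norml; lra.
by rewrite normrM (gtr0_norm g0) => h; rewrite -[leRHS]mul1r ler_pdivlMr.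
Qed.

Lemma rows_of_set n j k l (S : {set 'I_n.+1}) : (j < k)%N -> (k <= l)%N -> (l <= n.+1)%N ->
  S \subset mid_range n.+1 j l -> #|S| = (k - j)%N ->
  exists f : 'I_k -> 'I_n.+1, [/\ injective f, forall i, (exists a, f a = i) <-> (i < j)%N || (i \in S) &
     forall a, (f a < l)%N].
Proof.
move=> jk kl ln SM Sc; pose D := (mid_range n.+1 0 j :|: S)%SET.
have cD : #|D| = k.
  rewrite /D cardsU card_mid_range; last by lia.
  suff -> : (mid_range n.+1 0 j :&: S)%SET = finset.set0 by rewrite cards0 Sc; lia.
  apply/setP => i; rewrite !finset.inE; case: (boolP (i \in S)) => iS; last by rewrite andbF.
  by have := fintype.subsetP SM i iS; rewrite finset.in_set => /andP [h _]; rewrite ltnNge h.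
have DP i : (i \in D) = (i < j)%N || (i \in S) by rewrite !finset.inE.
have fD (a : 'I_k) : nth ord0 (enum D) a \in D.
  by rewrite -mem_enum mem_nth // -cardE cD ltn_ord.
exists (fun a : 'I_k => nth ord0 (enum D) a); split.
- by move=> a a' /eqP; rewrite nth_uniq ?enum_uniq // -?cardE ?cD ?ltn_ord // => /eqP/val_inj.
- move=> i; rewrite -DP; split=> [[a <-]|]; first exact: fD.
  rewrite -mem_enum => iD; have Hi : (index i (enum D) < k)%N by rewrite -cD cardE index_mem.
  by exists (Ordinal Hi); rewrite /= nth_index.
- move=> a; have := fD a; rewrite DP => /orP [h|h]; first by lia.
  by have := fintype.subsetP SM _ h; rewrite finset.in_set => /andP [].
Qed.

Lemma card_cover_le (T I : finType) (A : {set T}) (Q : {set I}) (F : I -> {set T}) :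
  (forall b, b \in A -> exists2 i, i \in Q & b \in F i) -> (#|A| <= \sum_(i in Q) #|F i|)%N.
Proof.
move=> H; have -> : (\sum_(i in Q) #|F i| = \sum_b \sum_(i in Q) (b \in F i : nat))%N.
  rewrite exchange_big; apply: eq_bigr => i _; rewrite -sum1_card big_mkcond.
  by apply: eq_bigr => b _; case: (b \in F i).
rewrite -sum1_card big_mkcond; apply: leq_sum => b _; case: ifP => // /H [i iQ bF].
by rewrite (bigD1 i) //= bF.
Qed.

Lemma union_count (R : realType) n k M (Pi : finType) (Q : {set Pi}) (g : 'I_k -> 'I_n) (E : Pi -> {set {ffun 'I_k -> 'I_M}})
  (Bad : {set {ffun 'I_n -> 'I_M}}) (h bnd : R) : injective g -> 0 <= h ->
  (forall pi, #|E pi|%:R * h ^+ k <= bnd) ->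
  (forall b, b \in Bad -> exists2 pi, pi \in Q & [ffun a => b (g a)] \in E pi) ->
  #|Bad|%:R * (M%:R * h) ^+ k <= #|Q|%:R * bnd * M%:R ^+ n.
Proof.
move=> gI h0 HE HB.
have HN : (#|Bad| * M ^ k <= \sum_(pi in Q) #|E pi| * M ^ n)%N.
  apply: (@leq_trans (\sum_(pi in Q) #|[set b : {ffun 'I_n -> 'I_M} | [ffun a => b (g a)] \in E pi]%SET| * M ^ k)%N).
    rewrite -big_distrl /= leq_mul2r; apply/orP; right.
    by apply: card_cover_le => b /HB [pi piQ bE]; exists pi => //; rewrite finset.in_set.
  apply: leq_sum => pi _; have := card_restrict (E pi) gI; rewrite !card_ord => ->.
  by [].
rewrite exprMn mulrA; apply: (@le_trans _ _ ((\sum_(pi in Q) #|E pi| * M ^ n)%:R * h ^+ k)).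
  by rewrite ler_wpM2r ?exprn_ge0 // -natrX -natrM ler_nat.
rewrite natr_sum mulr_suml -mulrA [bnd * _]mulrC mulr_natl -sumr_const; apply: ler_sum => pi _.
by rewrite natrM natrX mulrAC [leLHS]mulrC ler_wpM2l ?exprn_ge0.
Qed.

(* [cr] is the part of the domain mapped deep into the target, [phi] the map in units of the boxes and [Jm] its derivative;
   [eps] bounds the minors, [ea] the error of the affine approximation at scale [1 / g]. *)
Record chart_bounds (R : realType) (n j k l g : nat) (rho : 'I_n -> R) (N : 'I_n -> nat)
    (cr : 'rV[R]_n -> Prop) (phi : 'rV[R]_n -> 'I_n -> R) (Jm : 'rV[R]_n -> 'M[R]_n) (CN B eps ea : R) := ChartBounds {
  cb_g : (0 < g)%N;
  cb_lo : forall i : 'I_n, (i < j)%N -> rho i <= 1;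
  cb_hi : forall i : 'I_n, (j <= i < l)%N -> 1 <= rho i;
  cb_N : forall s, (0 < N s)%N;
  cb_vol : forall T : {set 'I_n}, #|T| = l ->
    \prod_(i < n | (j <= i < l)%N) rho i <= CN * \prod_(i in T) (N i)%:R;
  cb_range : forall x, cr x -> in_range rho x;
  cb_osc : forall x x', cr x -> cr x' -> cnear (g%:R^-1) x x' -> forall s, `|phi x s - phi x' s| <= 1/8;
  cb_entry : forall x, cr x -> forall i s, `|Jm x i s| <= B;
  cb_affine : forall x0 x, cr x0 -> cr x -> cnear (g%:R^-1) x0 x ->
    forall s, `|phi x s - phi x0 s - ((x - x0) *m Jm x0) 0 s| <= ea;
  cb_minor : forall x, cr x -> forall f h : 'I_k -> 'I_n, injective f -> injective h ->
    (forall i : 'I_n, (i < j)%N -> exists a, f a = i) -> (forall a, f a < l)%N ->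
    `|\det (mxsub f h (Jm x))| <= eps }.

Record collapse_bounds_for (R : realType) (n j k l : nat) (W eta : R) (G : 'rV[R]_n -> 'rV[R]_n) (exc : 'rV[R]_n -> Prop)
    (key : 'rV[R]_n -> {set 'I_n} * {set 'I_n}) := CollapseBounds {
  co_id : forall x (i : 'I_n), ~~ (j <= i < l)%N -> G x 0 i = x 0 i;
  co_skel : forall x, ~ exc x -> exists S : {set 'I_n}, [/\ S \subset mid_range n j l, #|S| = (k - j)%N &
      on_skeleton j l S (G x)];
  co_key : forall K, exists S : {set 'I_n}, [/\ S \subset mid_range n j l, #|S| = (k - j)%N &
      forall x x', in_box W x -> in_box W x' -> exc x -> exc x' -> key x = K -> key x' = K ->
      (forall i : 'I_n, (k <= i)%N -> x 0 i = x' 0 i) ->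
      forall i, i \in mid_range n j l -> `|G x 0 i - G x' 0 i| <= if i \in S then 1 else eta] }.

(** Labels are chosen in two rounds. The boxes, seeing the coordinates from [l] on, leave about
    [g ^+ k] cells over each slice; the positions inside the boxes, seeing those from [k] on, avoid
    the images of these cells and of the exceptional pieces. Each image has volume about
    [eps / g ^+ k] plus a boundary layer, so the quantity compared with [c] is the total volume. *)
Lemma labels_exist (R : realType) n j k l (CN : R) : (j < k)%N -> (k <= l)%N -> (l <= n.+1)%N -> 0 < CN ->
  exists c : R, 0 < c /\ forall rho g N cr phi Jm (eps e B eta ea e2 W : R) M G exc key,
  @chart_bounds R n.+1 j k l g rho N cr phi Jm CN B eps ea ->
  @collapse_bounds_for R n.+1 j k l W eta G exc key ->
  0 <= eta -> eta <= g%:R^-1 -> 0 <= B -> 0 <= eps -> (0 < M)%N -> (2 * M%:R)^-1 <= e ->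
  ea + n.+1%:R * (B * eta) + e2 <= e ->
  eps + g%:R ^+ k * (e * (B * g%:R^-1 + e) ^+ k.-1) < c ->
  forall H (dl : R), 0 <= dl -> dl * H%:R <= W ->
  exists (box pos : torus n.+1 H -> 'I_n.+1 -> nat), (forall u s, box u s < N s)%N /\ (forall u s, pos u s < M)%N /\
  forall (u : torus n.+1 H) (tau : 'S_n.+1), let x := G (tpos dl u) in
    let be a := box (vtx (@tsh n.+1 H) (low l u) (later l tau (tau a))) (tau a) in
    cr x -> (forall a : 'I_n.+1, (a < l)%N -> inside_box (be a) (phi x (tau a))) ->
    (forall a : 'I_n.+1, (a < k)%N -> `|phi x (tau a) - ((be a)%:R + 1/4 + (2 * M%:R)^-1 *
        (pos (vtx (@tsh n.+1 H) (low k u) (later k tau (tau a))) (tau a))%:R)| <= e2) -> False.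
Proof.
move=> jk kl ln CN0; have [A [A0 HA]] := box_labels jk kl ln CN0.
have [q [q0 Hq]] := lattice_labels n.+1; have [C [C0 HC]] := piece_count R k.
have qR : 0 < q%:R :> R by rewrite ltr0n.
(* The second summand counts exceptional pieces: [4 ^+ n.+1] keys, each with [(2 * g).+1 ^ k], at
   most [(3 * g) ^ k], small cubes. *)
pose A2 : R := A + 4 ^+ n.+1 * 3 ^+ k.
have A20 : 0 < A2 by rewrite addr_gt0 // mulr_gt0 // exprn_gt0.
have p2 : 0 < 2 ^+ k :> R by rewrite exprn_gt0.
pose cc : R := 2 ^+ k * A2 * C * q%:R.
have cc0 : 0 < cc by rewrite !mulr_gt0.
exists cc^-1; rewrite invr_gt0; split=> //.
move=> rho g N cr phi Jm eps e B eta ea e2 W M G exc key HC1 HC2 eta0 etag B0 eps0 M0 Me Hea Hc H dl dl0 HdlW.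
have gR : 0 < g%:R :> R by rewrite ltr0n; exact: cb_g HC1.
have gi0 : 0 <= g%:R^-1 :> R by rewrite invr_ge0 ltW.
have MR : 0 < M%:R :> R by rewrite ltr0n.
have h0 : 0 < (2 * M%:R)^-1 :> R by rewrite invr_gt0 mulr_gt0.
have e0 : 0 <= e := le_trans (ltW h0) Me.
have [Cell [cell [cS Hcell Hbox]]] := HA rho g N cr phi (cb_g HC1) (cb_lo HC1) (cb_hi HC1) (cb_N HC1) (cb_vol HC1)
  (cb_range HC1) (cb_osc HC1).
have [box [boxN HQ]] := Hbox H dl.
pose be (u : torus n.+1 H) (tau : 'S_n.+1) (s : 'I_n.+1) := box (vtx (@tsh n.+1 H) (low l u) (later l tau s)) s.
have kn : (k <= n.+1)%N := leq_trans kl ln.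
pose gg (tau : 'S_n.+1) (a : 'I_k) := tau (widen_ord kn a).
have ggI tau : injective (gg tau) by move=> a a' /perm_inj [] /val_inj.
pose bnd : R := C * (eps * g%:R^-1 ^+ k + e * (B * g%:R^-1 + e) ^+ k.-1).
have Be0 : 0 <= B * g%:R^-1 + e by rewrite addr_ge0 // mulr_ge0.
have bnd0 : 0 <= bnd by rewrite mulr_ge0 ?(ltW C0) // addr_ge0 // mulr_ge0 ?exprn_ge0.
have inW (u : torus n.+1 H) : in_box W (tpos dl u).
  move=> i; rewrite mxE mulr_ge0 ?ler0n //= (le_trans _ HdlW) // ler_wpM2l // ler_nat -ltnS; exact: ltn_ord.
have same (w u : torus n.+1 H) : (forall i : 'I_n.+1, (k <= i)%N -> u i = w i) ->
    forall i : 'I_n.+1, (l <= i)%N -> G (tpos dl u) 0 i = dl * (w i)%:R.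
  move=> Hu i li; rewrite (co_id HC2) ?mxE ?Hu //; [exact: leq_trans li | by rewrite negb_and -!leqNgt li orbT].
pose good (w : torus n.+1 H) tau (u : torus n.+1 H) :=
  [/\ forall i : 'I_n.+1, (k <= i)%N -> u i = w i, cr (G (tpos dl u)) &
     forall a : 'I_n.+1, (a < l)%N -> inside_box (be w tau (tau a)) (phi (G (tpos dl u)) (tau a))].
pose fit (w : torus n.+1 H) tau x (t : {ffun 'I_k -> 'I_M}) := forall a : 'I_k,
  `|phi x (gg tau a) - ((be w tau (gg tau a))%:R + 1/4 + (2 * M%:R)^-1 * (t a)%:R)| <= e2.
have Hpiece w (tau : {perm _}) (f : 'I_k -> 'I_n.+1) (S : {set 'I_n.+1}) (Pc : 'rV[R]_n.+1 -> Prop) (E : {set {ffun 'I_k -> 'I_M}}) :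
    injective f -> (forall i, (exists a, f a = i) <-> (i < j)%N || (i \in S)) -> (forall a, f a < l)%N ->
    (forall x, Pc x -> cr x) ->
    (forall x x', Pc x -> Pc x' -> forall i, `|x 0 i - x' 0 i| <= if (i < j)%N || (i \in S) then g%:R^-1 else eta) ->
    (forall t, t \in E -> exists2 x, Pc x & fit w tau x t) ->
    #|E|%:R * (2 * M%:R)^-1 ^+ k <= bnd.
  move=> fI fD fl Pcr Pcl HE.
  have [->|[t0 /HE [x0 Px0 _]]] := finset.set_0Vmem E; first by rewrite cards0 mul0r.
  have HJ := cb_minor HC1 (Pcr _ Px0) fI (ggI tau) (fun i ij => iffRL (fD i) (introT orP (or_introl ij))) fl.
  apply: le_trans (HC n.+1 M (Jm x0) f (gg tau) phi Pc g%:R^-1 eta ea e2 e _ B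
     (fun s => (be w tau s)%:R + 1/4) x0 E fI h0 Me gi0 eta0 B0 _ _ _ _ Hea HE) _.
  - exact: cb_entry HC1 _ (Pcr _ Px0).
  - move=> x Px a; have := Pcl x x0 Px Px0 (f a).
    by have -> : (f a < j)%N || (f a \in S) by apply/fD; exists a.
  - move=> x Px i Hi; have := Pcl x x0 Px Px0 i; case: ifP => // /fD [a fa]; by have := Hi a; rewrite fa eqxx.
  - move=> x Px s; apply: (cb_affine HC1); [exact: Pcr | exact: Pcr | move=> i].
    by apply: le_trans (Pcl x x0 Px Px0 i) _; case: ifP.
  rewrite /bnd ler_pM2l // lerD ?ler_wpM2r ?exprn_ge0 //.
  by rewrite (leq_ltn_trans (leq0n j) jk) mul1r.
pose Pi : finType := (Cell + ({set 'I_n.+1} * {set 'I_n.+1}) * {ffun 'I_k -> 'I_(2 * g).+1})%type.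
pose excl w tau K x := exists u : torus n.+1 H, [/\ good w tau u, exc (tpos dl u), key (tpos dl u) = K & x = G (tpos dl u)].
have Hcover w (tau : 'S_n.+1) : exists (Q : {set Pi}) (Pc : Pi -> 'rV[R]_n.+1 -> Prop),
  [/\ #|Q|%:R <= A2 * g%:R ^+ k,
   forall pi, exists (f : 'I_k -> 'I_n.+1) (S : {set 'I_n.+1}), [/\ injective f, forall i, (exists a, f a = i) <-> (i < j)%N || (i \in S),
      forall a, (f a < l)%N &
      (forall x, Pc pi x -> cr x) /\ (forall x x', Pc pi x -> Pc pi x' -> forall i,
         `|x 0 i - x' 0 i| <= if (i < j)%N || (i \in S) then g%:R^-1 else eta)] &
   forall u, good w tau u -> exists2 pi, pi \in Q & Pc pi (G (tpos dl u))].
  have [Q1 [cQ1 HQ1]] := HQ (low l w) tau.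
  have /choice [SK HSK] := co_key HC2.
  have /choice [fK HfK] : forall K, exists f : 'I_k -> 'I_n.+1, [/\ injective f,
      forall i, (exists a, f a = i) <-> (i < j)%N || (i \in SK K) & forall a, (f a < l)%N].
    by move=> K; have [h1 h2 _] := HSK K; exact: rows_of_set.
  (* A reference point for each key: in the directions of [SK K] all exceptional points of the slice
     with this key are within 1 of it. The value 0 is a placeholder for keys that do not occur. *)
  have /choice [rep Hrep] : forall K, exists x0, forall x, excl w tau K x -> excl w tau K x0.
    move=> K; have [[x0 Hx0]|Hn] := pselect (exists x0, excl w tau K x0); first by exists x0.
    by exists 0 => x Hx; exfalso; apply: Hn; exists x.
  pose base K (i : 'I_n.+1) : R := if (i < j)%N then 4 else rep K 0 i - 1.
  pose Q : {set Pi} := [set pi : Pi | match pi with inl c => c \in Q1 | inr _ => true end]%SET.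
  pose Pc (pi : Pi) x := match pi with
    | inl c => exists (u : torus n.+1 H) (S : {set 'I_n.+1}),
       [/\ good w tau u, x = G (tpos dl u), S \subset mid_range n.+1 j l /\ #|S| = (k - j)%N, on_skeleton j l S x & cell S x = c]
    | inr (K, t) => excl w tau K x /\ forall a, t a = inord (Num.truncn ((x 0 (fK K a) - base K (fK K a)) * g%:R)) end.
  exists Q, Pc; split.
  - rewrite -sum1_card big_mkcond big_sumType /= natrD mulrDl; apply: lerD.
      apply: le_trans cQ1; rewrite ler_nat -sum1_card [leqRHS]big_mkcond /=.
      by apply: leq_sum => c _; rewrite finset.in_set.
    rewrite (eq_bigr (fun=> 1%N)); last by move=> x _; rewrite finset.in_set.
    rewrite sum1_card card_prod card_prod -!cardsT -!powersetT !card_powerset !cardsT card_ffun !card_ord.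
    have h3 : (2 * g).+1%:R <= 3 * g%:R :> R.
      by rewrite -natrM ler_nat; have := cb_g HC1; clear; lia.
    have h4 : (2 ^ n.+1 * 2 ^ n.+1)%:R = 4 ^+ n.+1 :> R by rewrite -expnMn natrX.
    rewrite natrM h4 natrX -mulrA ler_pM2l ?exprn_gt0 // -exprMn.
    by apply: lerXn2r => //; rewrite nnegrE ?ler0n // mulr_ge0 // ltW.
  - case=> [c|[K t]].
      have [[x0 [u0 [S0 [gd0 Ex0 [S01 S02] Kx0 Cx0]]]]|Hn] := pselect (exists x, Pc (inl c) x); last first.
        have [f1 f2 f3] := HfK (finset.set0, finset.set0).
        exists (fK (finset.set0, finset.set0)), (SK (finset.set0, finset.set0)); split=> //.
        by split=> [x Hx|x x' Hx]; exfalso; apply: Hn; exists x.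
      have [f [f1 f2 f3]] := rows_of_set jk kl ln S01 S02.
      exists f, S0; split=> //; split=> [x [u [S [[_ gu _] -> _ _ _]]] //|].
      move=> x x' [u [S [gu Ex _ Kx Cx]]] [u' [S' [gu' Ex' _ Kx' Cx']]] i.
      have ES : S = S0 by apply: (cS S x S0 x0); rewrite Cx Cx0.
      have ES' : S' = S0 by apply: (cS S' x' S0 x0); rewrite Cx' Cx0.
      rewrite ES in Kx Cx; rewrite ES' in Kx' Cx'.
      have [G1 G2 _] := gu; have [G1' G2' _] := gu'; rewrite -Ex in G2; rewrite -Ex' in G2'.
      have [il|li] := ltnP i l.
        apply: le_trans (Hcell S0 x x' _ (cb_range HC1 G2) (cb_range HC1 G2') Kx Kx' i il) _; first by rewrite Cx Cx'.
        by case: ifP.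
      by rewrite Ex Ex' (same w u G1 i li) (same w u' G1' i li) subrr normr0; case: ifP.
    have [f1 f2 f3] := HfK K; have [SK1 SK2 SK3] := HSK K.
    exists (fK K), (SK K); split=> //; split=> [x [[u [[_ gu _] _ _ ->]] _] //|].
    move=> x x' [Hx Ht] [Hx' Ht'] i.
    have Hcl y y' : excl w tau K y -> excl w tau K y' -> forall i, i \in mid_range n.+1 j l ->
        `|y 0 i - y' 0 i| <= if i \in SK K then 1 else eta.
      move=> [v [[v1 _ _] v2 v3 ->]] [v' [[v1' _ _] v2' v3' ->]]; apply: SK3 => // i' ki.
      by rewrite !mxE v1 // v1'.
    have Hb y a : excl w tau K y -> 0 <= y 0 (fK K a) - base K (fK K a) <= 2.
      move=> Hy; rewrite /base; case: ifP => ij.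
        have [v [[_ gv _] _ _ Ey]] := Hy; rewrite -Ey in gv.
        by have := cb_range HC1 gv (fK K a); have := cb_lo HC1 ij; clear; lra.
      have aS : fK K a \in SK K by have /f2 : exists a', fK K a' = fK K a by [exists a]; rewrite ij.
      have := Hcl _ _ Hy (Hrep K _ Hy) _ (fintype.subsetP SK1 _ aS); rewrite aS ler_norml; clear; lra.
    case: ifP => Hi.
      have [a Ea] : exists a, fK K a = i by apply/f2.
      have := Ht a; rewrite Ht' -Ea; have /andP [b1 b2] := Hb x a Hx; have /andP [b1' b2'] := Hb x' a Hx'.
      have tr (y : R) : y <= 2 -> (Num.truncn (y * g%:R) < (2 * g).+1)%N.
        move=> y2; rewrite ltnS truncn_le_nat -natr1 natrM.
        by apply: (@le_lt_trans _ _ (2 * g%:R)); [rewrite ler_pM2r | rewrite ltrDl].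
      move=> /(congr1 (@nat_of_ord _)); rewrite !inordK ?tr // => Etr.
      have := truncn_close gR b1 b1' (esym Etr); by rewrite opprB addrA addrNK.
    have [im|im] := boolP (i \in mid_range n.+1 j l).
      by have := Hcl _ _ Hx Hx' i im; move/negbT: Hi; rewrite negb_or => /andP [_ /negbTE ->].
    have li : (l <= i)%N.
      move: im; rewrite finset.in_set negb_and -!ltnNge ltnS => /orP [h|//].
      by rewrite h in Hi.
    move: Hx Hx' => [v [[v1 _ _] _ _ ->]] [v' [[v1' _ _] _ _ ->]].
    by rewrite (same w v v1 i li) (same w v' v1' i li) subrr normr0.
  - move=> u gu; have [G1 G2 G3] := gu.
    have [ex|nex] := pselect (exc (tpos dl u)).
      exists (inr (key (tpos dl u), [ffun a => inord (Num.truncn ((G (tpos dl u) 0 (fK (key (tpos dl u)) a) -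
        base (key (tpos dl u)) (fK (key (tpos dl u)) a)) * g%:R))])).
        by rewrite finset.in_set.
      split; first by exists u.
      by move=> a; rewrite ffunE.
    have [S [S1 S2 S3]] := co_skel HC2 nex.
    exists (inl (cell S (G (tpos dl u)))); last by exists u, S.
    rewrite finset.in_set; apply: HQ1 => // i li.
    by rewrite (same w u G1 i li) ffunE ltnNge li.
have [|w tau|f Hf] := Hq k H 'I_M (fun w tau =>
    [set b : {ffun 'I_n.+1 -> 'I_M} | `[< exists u, good w tau u /\ fit w tau (G (tpos dl u)) [ffun a => b (gg tau a)] >]]%SET).
- by rewrite card_ord.
- have [Q [Pc [cQ HP HG]]] := Hcover w tau; rewrite card_ord.
  pose E pi : {set {ffun 'I_k -> 'I_M}} := [set t | `[< exists2 x, Pc pi x & fit w tau x t >]]%SET.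
  have HE pi : #|E pi|%:R * (2 * M%:R)^-1 ^+ k <= bnd.
    have [f [S [f1 f2 f3 [P1 P2]]]] := HP pi.
    by apply: (Hpiece w tau f S (Pc pi)) => // t; rewrite finset.in_set => /asboolP.
  set Bad := [set b | _]%SET.
  have HU : #|Bad|%:R * (M%:R * (2 * M%:R)^-1) ^+ k <= #|Q|%:R * bnd * M%:R ^+ n.+1.
    apply: (union_count (ggI tau) (ltW h0) HE) => b; rewrite finset.in_set => /asboolP [u [gu fu]].
    have [pi piQ Hpi] := HG u gu; exists pi => //; rewrite finset.in_set; apply/asboolP.
    by exists (G (tpos dl u)).
  (* The positions fill half of the box in each component, whence the factor [2 ^+ k] in [cc]. *)
  have EM : M%:R * (2 * M%:R)^-1 = 2^-1 :> R by rewrite invfM mulrCA divff ?mulr1 // gt_eqF.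
  rewrite EM exprVn ler_pdivrMr // in HU.
  rewrite -(@ltr_nat R) natrM natrX.
  have Mn : 0 < M%:R ^+ n.+1 :> R by rewrite exprn_gt0.
  have gk : g%:R ^+ k * g%:R^-1 ^+ k = 1 :> R by rewrite -exprMn divff ?expr1n // gt_eqF.
  have Hb : #|Q|%:R * bnd <= A2 * C * (eps + g%:R ^+ k * (e * (B * g%:R^-1 + e) ^+ k.-1)).
    apply: le_trans (ler_wpM2r bnd0 cQ) _; rewrite /bnd.
    have E3 (X Y Z : R) : A2 * X * (C * (eps * Y + Z)) = A2 * C * (eps * (X * Y) + X * Z) by ring.
    by rewrite E3 gk mulr1.
  apply: (@le_lt_trans _ _ (#|Q|%:R * bnd * M%:R ^+ n.+1 * 2 ^+ k * q%:R)); first by rewrite ler_pM2r.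
  apply: (@le_lt_trans _ _ (cc * (eps + g%:R ^+ k * (e * (B * g%:R^-1 + e) ^+ k.-1)) * M%:R ^+ n.+1)).
    have E4 (X Y Z T : R) : X * Y * Z * T = X * (Z * T) * Y by ring.
    have E5 (Y Z : R) : A2 * C * Y * (Z * q%:R) = Z * A2 * C * q%:R * Y by ring.
    by rewrite E4 ler_pM2r //; apply: le_trans (ler_wpM2r _ Hb) _; [rewrite mulr_ge0 // ltW | rewrite E5].
  rewrite -[ltRHS]mul1r ltr_pM2r // mulrC -ltr_pdivlMr // mul1r //.
exists box, (fun u s => f u s : nat); split; first exact: boxN.
split; first by move=> u s; exact: ltn_ord.
move=> u tau x b Cx Hin Hfit.
have lowl : low l (low k u) = low l u.
  apply/ffunP => i; rewrite !ffunE; case: ifP => // /negbT; rewrite -leqNgt => li.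
  by rewrite ltnNge (leq_trans kl li).
have := Hf (low k u) tau; rewrite finset.in_set => /negP; apply; apply/asboolP; exists u; split.
  split=> // [i ki|a al]; first by rewrite ffunE ltnNge ki.
  by rewrite /be lowl; exact: Hin.
move=> a; rewrite /be lowl !ffunE; exact: (Hfit (widen_ord kn a) (ltn_ord a)).
Qed.

(** * From normalised charts and labels to a lower bound for the minors *)

Lemma positive_bounds (R : realType) n (f : 'I_n -> R) : (forall i, 0 < f i) ->
  exists lo hi : R, [/\ 0 < lo, 0 < hi & forall i, lo <= f i <= hi].
Proof.
move=> f0; pose lo : R := (1 + \sum_i (f i)^-1)^-1; pose hi : R := 1 + \sum_i f i.
have i0 i : 0 <= (f i)^-1 by rewrite invr_ge0 ltW.
have p0 : 0 < 1 + \sum_i (f i)^-1 by rewrite ltr_pwDl // sumr_ge0.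
exists lo, hi; split; first by rewrite invr_gt0.
  by rewrite ltr_pwDl // sumr_ge0 // => i _; exact: ltW.
move=> i; apply/andP; split.
  rewrite -[leRHS]invrK lef_pV2 ?posrE ?invr_gt0 //.
  by rewrite (bigD1 i) //= addrCA lerDl addr_ge0 // sumr_ge0.
by rewrite /hi (bigD1 i) //= addrCA lerDl addr_ge0 // sumr_ge0 // => j _; exact: ltW.
Qed.

Section LatticeSteps.
Variables (n H : nat) (u : torus n H) (tau : 'S_n).
Hypothesis Hu : forall i, (u i < H)%N.

Definition step_before (i : 'I_n) : torus n H := [ffun j => inord (u j + (tau j < i))%N].
Definition step_after (i : 'I_n) : torus n H := [ffun j => inord (u j + (tau j <= i))%N].

Lemma step_beforeE i j : step_before i j = (u j + (tau j < i))%N :> nat.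
Proof. by rewrite ffunE inordK // ltnS; have := Hu j; case: (tau j < i)%N => /=; rewrite ?addn0 ?addn1 // => /ltnW. Qed.

Lemma step_afterE i j : step_after i j = (u j + (tau j <= i))%N :> nat.
Proof. by rewrite ffunE inordK // ltnS; have := Hu j; case: (tau j <= i)%N => /=; rewrite ?addn0 ?addn1 // => /ltnW. Qed.

Lemma low_step_before c i : low c (step_before i) = vtx (@tsh n H) (low c u) (later c tau i).
Proof.
apply/ffunP => j; apply: val_inj; rewrite /= vtx_val; first last.
- move=> x; rewrite /later mem_enum finset.in_set => /andP [cx _].
  by rewrite /low ffunE [(x < c)%N]ltnNge cx /=.
- exact: enum_uniq.
rewrite !ffunE /later mem_enum finset.in_set; have [jc|cj] := ltnP j c; first by rewrite addn0.
by have := step_beforeE i j; rewrite ffunE.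
Qed.

(** The step number [tau a] runs in direction [a], which is invisible to labels that ignore the
    coordinates below [c]. *)
Lemma low_step_after c (a : 'I_n) : (a < c)%N -> low c (step_after (tau a)) = low c (step_before (tau a)).
Proof.
move=> ac; apply/ffunP => j; apply: val_inj; rewrite /= /low !ffunE; have [jc|cj] := ltnP j c => //.
have -> : (tau j <= tau a)%N = (tau j < tau a)%N; last by [].
rewrite [LHS]leq_eqVlt; case: eqP => // /val_inj /perm_inj E; by rewrite E leqNgt ac in cj.
Qed.

Lemma in_cell_before i : in_cell u (step_before i).
Proof. by move=> j; have := step_beforeE i j; case: (tau j < i)%N => -> /=; lia. Qed.

Lemma in_cell_after i : in_cell u (step_after i).
Proof. by move=> j; have := step_afterE i j; case: (tau j <= i)%N => -> /=; lia. Qed.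

End LatticeSteps.

Lemma pbit_neq (R : realType) (x y : R) : pbit x != pbit y -> (0 < x /\ y <= 0) \/ (x <= 0 /\ 0 < y).
Proof.
have [x0|x0] := ltP 0 x; have [y0|y0] := ltP 0 y; rewrite ?(pbit_pos x0) ?(pbit_pos y0) ?(pbit_neg x0) ?(pbit_neg y0) ?eqxx //.
  by left.
by right.
Qed.

Lemma jump_close (R : realType) (pv pw pu tv tw lo hi om : R) :
  pbit (pw - tw) != pbit (pv - tv) -> `|pv - pu| <= om -> `|pw - pu| <= om ->
  lo <= tv <= hi -> lo <= tw <= hi -> lo - om <= pu <= hi + om.
Proof. by move=> /pbit_neq; rewrite !ler_norml; case=> -[h1 h2]; lra. Qed.

(** Labels stay in the middle half of their box, which leaves room for the depth required of labels
    and for the oscillation of the map. *)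
Lemma lattice_label_bounds (R : realType) (be N M p : nat) (b side m2 : R) : (be < N)%N -> (p < M)%N -> 0 < side ->
  m2 <= side / 4 ->
  b + m2 <= b + side * (be%:R + 1/4 + (2 * M%:R)^-1 * p%:R) <= b + side * N%:R - m2 /\
  b + side * (be%:R + 1/4) <= b + side * (be%:R + 1/4 + (2 * M%:R)^-1 * p%:R) <= b + side * (be%:R + 3/4).
Proof.
move=> bN pM s0 m2s; have M0 : 0 < M%:R :> R by rewrite ltr0n; lia.
have h1 : be%:R + 1 <= N%:R :> R by rewrite natr1 ler_nat.
have b0 : 0 <= be%:R :> R by [].
have h2 : 0 <= (2 * M%:R)^-1 * p%:R :> R by rewrite mulr_ge0 // invr_ge0 mulr_ge0 // ltW.
have h3 : (2 * M%:R)^-1 * p%:R <= 1/2 :> R.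
  rewrite mulrC ler_pdivrMr ?mulr_gt0 // mulrA [1/2 * 2]mulfVK //.
  by rewrite mul1r ler_nat ltnW.
move: ((2 * M%:R)^-1 * p%:R) h2 h3 => z h2 h3; split; nra.
Qed.

Section Core.
Variables (R : realType) (n j k l : nat) (CN : R).
Variables (a b : 'rV[R]_n.+1) (r s kap : 'I_n.+1 -> R) (N : 'I_n.+1 -> nat).
Variables (U : set 'rV[R]_n.+1) (Phi : 'rV[R]_n.+1 -> 'rV[R]_n.+1) (eps : R).
Hypotheses (jk : (j < k)%N) (kl : (k <= l)%N) (ln : (l <= n.+1)%N).
Hypotheses (oU : open U) (UR : U `<=` rectangle a r) (HPhi : map_of_pairs U (rectangle b s) Phi).
Hypotheses (r0 : forall i, 0 < r i) (s0 : forall i, 0 < s i) (k0 : forall i, 0 < kap i) (N0 : forall i, (0 < N i)%N).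
Hypothesis Hlo : forall i : 'I_n.+1, (i < j)%N -> r i <= kap i.
Hypothesis Hhi : forall i : 'I_n.+1, (j <= i < l)%N -> kap i <= r i.
Hypothesis Hvol : forall T : {set 'I_n.+1}, #|T| = l ->
  \prod_(i < n.+1 | (j <= i < l)%N) (r i / kap i) <= CN * \prod_(i in T) (N i)%:R.
Hypothesis Hminor : forall x, U x -> forall f h : 'I_k -> 'I_n.+1, injective f -> injective h ->
  (forall i : 'I_n.+1, (i < j)%N -> exists c, f c = i) -> (forall c, f c < l)%N ->
  `|\det (mxsub f h (jacobian Phi x))| * \prod_c kap (f c) <= eps * \prod_c (s (h c) / (N (h c))%:R).

(** The offset puts the domain at distance 4 from the seam, while the collapse moves points by at
    most 2; the homotopy to the identity therefore meets [U] only away from the seam. *)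
Let o i := a 0 i - 4 * kap i.
Let side i := s i / (N i)%:R.
Let pt := rescale o kap.
Let phi x i := (Phi (pt x) 0 i - b 0 i) / side i.
Let Jm x : 'M[R]_n.+1 := \matrix_(i, c) (kap i * jacobian Phi (pt x) i c * (side c)^-1).
Let rho i := r i / kap i.

Lemma side_gt0 i : 0 < side i. Proof. by rewrite divr_gt0 // ltr0n. Qed.

Lemma pt_range x : U (pt x) -> in_range rho x.
Proof.
move=> /UR Hx i; have := Hx i; rewrite /pt mxE /o /rho => /andP [h1 h2].
have h3 : 0 <= kap i * (x 0 i - 4) by lra.
have h4 : kap i * (x 0 i - 4) <= r i by lra.
rewrite pmulr_rge0 // subr_ge0 in h3; rewrite h3 /=.
have : x 0 i - 4 <= r i / kap i by rewrite ler_pdivlMr // mulrC.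
lra.
Qed.

Lemma pt_sub x z i : pt z 0 i - pt x 0 i = kap i * (z 0 i - x 0 i).
Proof. by rewrite /pt ![rescale _ _ _ _ _]mxE; ring. Qed.

Lemma phi_sub x z i : phi x i - phi z i = (Phi (pt x) 0 i - Phi (pt z) 0 i) / side i.
Proof. by rewrite /phi -mulrBl; congr (_ / _); ring. Qed.

Lemma norm_div_side z i : `|z / side i| = `|z| / side i.
Proof. by rewrite normrM normfV (gtr0_norm (side_gt0 i)). Qed.

(** The error is taken as [e = e1 / g]. Then the boundary term [g ^+ k * (e * (B / g + e) ^+ k.-1)]
    equals [e1 * (B + e1) ^+ k.-1]: it is made small by [e1] alone, after which [g] can be taken as
    large as the affine approximation requires. *)
Lemma chart_bounds_exist (smin m dl : R) : 0 < smin -> (forall i, smin <= side i) -> m = smin / 8 -> 0 < dl ->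
  exists g B e : R, exists g' : nat, [/\ g = g'%:R, 0 <= B, 0 < e, e <= g^-1 &
    chart_bounds j k l g' rho N (fun x => core b s U Phi m (pt x)) phi Jm CN B eps (e / 3)] /\
    g ^+ k * (e * (B * g^-1 + e) ^+ k.-1) < dl.
Proof.
move=> sm0 Hsm Em dl0.
have m0 : 0 < m by rewrite Em divr_gt0.
have [klo [K [_ K0 HK]]] := positive_bounds k0.
have {HK} kK i : kap i <= K by have /andP [] := HK i.
have cK := core_compact UR HPhi m0.
have KU := @core_sub _ _ b s U Phi m.
have [Lb Lb0 HL] := jacobian_bounded oU (mp_smooth HPhi) cK KU.
pose B : R := K * Lb / smin.
have B0 : 0 <= B by rewrite divr_ge0 ?mulr_ge0 // ltW.
have B10 : 0 < B + 1 by rewrite ltr_wpDl.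
pose e1 : R := Num.min 1 (dl / 2 / (B + 1) ^+ k.-1).
have p0 : 0 < (B + 1) ^+ k.-1 by rewrite exprn_gt0.
have e10 : 0 < e1 by rewrite lt_min ltr01 !divr_gt0.
have e11 : e1 <= 1 by rewrite ge_min lexx.
have He1 : e1 * (B + 1) ^+ k.-1 < dl.
  apply: (@le_lt_trans _ _ (dl / 2)); last lra.
  by rewrite -ler_pdivlMr // ge_min lexx orbT.
have n0 : 0 < n.+1%:R :> R by rewrite ltr0n.
pose ef : R := e1 * smin / (6 * (n.+1%:R * K)).
have q0 : 0 < 6 * (n.+1%:R * K) by apply: mulr_gt0 => //; exact: mulr_gt0.
have ef0 : 0 < ef by rewrite divr_gt0 // mulr_gt0.
have [da [da0 Hda]] := uniform_affine oU (mp_smooth HPhi) cK KU ef0.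
have [do_ [do0 Hdo]] := uniform_osc oU UR HPhi m0 m0.
pose dd : R := Num.min da do_; have dd0 : 0 < dd by rewrite lt_min da0.
pose g := (Num.truncn (K / dd)).+1.
have g0 : 0 < g%:R :> R by rewrite ltr0n.
have Kg : K * g%:R^-1 <= dd.
  by rewrite ler_pdivrMr // mulrC -ler_pdivrMr // ltW // truncnS_gt.
have gi0 : 0 < g%:R^-1 :> R by rewrite invr_gt0.
exists g%:R, B, (e1 * g%:R^-1), g; split; last first.
  have -> : B * g%:R^-1 + e1 * g%:R^-1 = (B + e1) * g%:R^-1 by rewrite mulrDl.
  have Ek : g%:R ^+ k = g%:R * g%:R ^+ k.-1 :> R by rewrite -exprS prednK // (leq_ltn_trans _ jk).
  have Eg : g%:R ^+ k.-1 * g%:R^-1 ^+ k.-1 = 1 :> R by rewrite -exprMn divff ?expr1n // gt_eqF.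
  have E3 (X Y Z T F E : R) : F * Z * (E * T * (X * Y)) = E * X * (F * T) * (Z * Y) by ring.
  rewrite exprMn Ek E3.
  rewrite Eg divff ?gt_eqF // !mulr1; apply: le_lt_trans He1; rewrite ler_pM2l // lerXn2r ?nnegrE //.
  - by rewrite addr_ge0 // ltW.
  - exact: ltW.
  - by rewrite lerD2l.
have Knear x z : cnear (g%:R^-1) x z -> cnear (K * g%:R^-1) (pt x) (pt z).
  by move=> H i; rewrite pt_sub normrM gtr0_norm //; apply: ler_pM => //; exact: ltW.
split=> //.
- by rewrite mulr_gt0.
- by rewrite -[leRHS]mul1r ler_pM2r.
split=> //.
- by move=> i ij; rewrite /rho ler_pdivrMr // mul1r; exact: Hlo.
- by move=> i ij; rewrite /rho ler_pdivlMr // mul1r; exact: Hhi.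
- by move=> x [Ux _]; exact: pt_range.
- move=> x x' Cx Cx' Hn i.
  have [|_ H] := Hdo _ Cx (pt x').
    by move=> c; apply: le_trans (Knear _ _ Hn c) _; apply: le_trans Kg _; rewrite ge_min lexx orbT.
  rewrite distrC phi_sub norm_div_side ler_pdivrMr ?side_gt0 //.
  apply: le_trans (H i) _; rewrite Em; have := Hsm i; lra.
- move=> x Cx i c; rewrite mxE norm_div_side normrM (gtr0_norm (k0 i)) /B.
  apply: ler_pM; [apply: mulr_ge0 => //; exact: ltW | by rewrite invr_ge0 ltW ?side_gt0 | |].
    by apply: ler_pM => //; [exact: ltW | exact: HL].
  by rewrite lef_pV2 // posrE ?side_gt0.
- move=> x0 x C0 Cx Hn i; have [U0 _] := C0.
  have Ha : affine_near U Phi ef (K * g%:R^-1) (pt x0).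
    have [xc Uxc Hxc] := Hda _ C0; exists xc => // z Hz.
    have Kda : K * g%:R^-1 <= da by apply: le_trans Kg _; rewrite ge_min lexx.
    have Hz' : cnear da (pt x0) z by move=> c; apply: le_trans (Hz c) Kda.
    have [uz1 uz2 uz3] := Hxc z Hz'; split=> // w Hw; apply: uz3 => c.
    by apply: le_trans (Hw c) Kda.
  have := affine_at U0 Ha (ltW (mulr_gt0 K0 gi0)) (Knear _ _ Hn) i.
  have E1 : ((x - x0) *m Jm x0) 0 i = ((pt x - pt x0) *m jacobian Phi (pt x0)) 0 i / side i.
    rewrite /Jm; move: (jacobian Phi (pt x0)) => A; rewrite !mxE mulr_suml; apply: eq_bigr => c _.
    have Ec : (pt x - pt x0) 0 c = kap c * (x - x0) 0 c by rewrite !mxE -pt_sub !mxE.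
    by rewrite Ec mxE; ring.
  rewrite E1; move: (((pt x - pt x0) *m _) 0 i) => z Hz.
  rewrite phi_sub -mulrBl norm_div_side ler_pdivrMr ?side_gt0 //.
  apply: le_trans Hz _; apply: (@le_trans _ _ (e1 * g%:R^-1 / 3 * smin)).
    rewrite le_eqVlt; apply/orP; left; apply/eqP; rewrite /ef.
    by field; rewrite -/(n.+1%:R) !gt_eqF.
  by rewrite ler_pM2l ?divr_gt0 ?mulr_gt0.
- move=> x [Ux _] f h fI hI Hf1 Hf2.
  have -> : Jm x = \matrix_(i, c) (kap i * jacobian Phi (pt x) i c * (side c)^-1) by [].
  rewrite det_mxsub_scale !normrM.
  have P1 : 0 < \prod_c kap (f c) by apply: prodr_gt0.
  have P2 : 0 < \prod_c side (h c) by apply: prodr_gt0 => c _; exact: side_gt0.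
  rewrite (gtr0_norm P1) prodfV normfV (gtr0_norm P2) ler_pdivrMr // [leLHS]mulrC.
  exact: (Hminor Ux fI hI Hf1 Hf2).
Qed.

End Core.

Lemma inside_box_of_bounds (R : realType) (z : nat) (S p b w : R) : 0 < S -> w <= S / 8 ->
  b + S * (z%:R + 1/4) - w <= p <= b + S * (z%:R + 3/4) + w -> inside_box z ((p - b) / S).
Proof.
move=> S0 wS /andP [h1 h2]; rewrite /inside_box ler_pdivlMr // ler_pdivrMr //.
by apply/andP; split; nra.
Qed.

Lemma near_label_of_bounds (R : realType) (S p b w z e : R) : 0 < S -> w <= e * S ->
  b + S * z - w <= p <= b + S * z + w -> `|(p - b) / S - z| <= e.
Proof.
move=> S0 wS /andP [h1 h2].
have -> : (p - b) / S - z = (p - b - z * S) / S by rewrite [RHS]mulrBl mulfK // gt_eqF.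
by rewrite normrM normfV (gtr0_norm S0) ler_pdivrMr // ler_norml; lra.
Qed.

(** With units [kap] in the domain and [s / N] in the target, the last hypothesis bounds the
    normalised minors by [eps]. If [eps] were below [c], the labels of [labels_exist] would be
    contradicted by the vertex that [degree_jumps] finds for them. *)
Lemma minors_lower_bound (R : realType) n j k l (CN : R) : (j < k)%N -> (k <= l)%N -> (l <= n.+1)%N -> 0 < CN ->
  exists c : R, 0 < c /\ forall (a b : 'rV[R]_n.+1) (r s kap : 'I_n.+1 -> R) (N : 'I_n.+1 -> nat)
    (U : set 'rV[R]_n.+1) (Phi : 'rV[R]_n.+1 -> 'rV[R]_n.+1) (D : int) (eps : R),
  open U -> U `<=` rectangle a r -> map_of_pairs U (rectangle b s) Phi ->
  has_degree U (rectangle b s) Phi D -> D != 0 ->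
  (forall i, 0 < r i) -> (forall i, 0 < s i) -> (forall i, 0 < kap i) -> (forall i, (0 < N i)%N) ->
  (forall i : 'I_n.+1, (i < j)%N -> r i <= kap i) ->
  (forall i : 'I_n.+1, (j <= i < l)%N -> kap i <= r i) ->
  (forall T : {set 'I_n.+1}, #|T| = l ->
    \prod_(i < n.+1 | (j <= i < l)%N) (r i / kap i) <= CN * \prod_(i in T) (N i)%:R) ->
  0 <= eps ->
  (forall x, U x -> forall f h : 'I_k -> 'I_n.+1, injective f -> injective h ->
    (forall i : 'I_n.+1, (i < j)%N -> exists c, f c = i) -> (forall c, f c < l)%N ->
    `|\det (mxsub f h (jacobian Phi x))| * \prod_c kap (f c) <= eps * \prod_c (s (h c) / (N (h c))%:R)) ->
  c <= eps.
Proof.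
move=> jk kl ln CN0; have [c [c0 Hc]] := labels_exist jk kl ln CN0; exists c; split=> //.
move=> a b r s kap N U Phi D eps oU UR HPhi HD D0 r0 s0 k0 N0 Hlo Hhi Hvol eps0 Hminor.
rewrite leNgt; apply/negP => eps_c.
pose side i : R := s i / (N i)%:R.
have sd0 i : 0 < side i by rewrite divr_gt0 // ltr0n.
have [smin [smax [sm0 _ Hsm']]] := positive_bounds sd0.
have Hsm i : smin <= side i by have /andP [] := Hsm' i.
pose m : R := smin / 8; have m0 : 0 < m by rewrite divr_gt0.
have dl0 : 0 < c - eps by rewrite subr_gt0.
have [_ [B [e [g [[-> B0 e0 eg HC1] Hsmall]]]]] := @chart_bounds_exist R n j k l CN a b r s kap N U Phi eps jk
  oU UR HPhi s0 k0 N0 Hlo Hhi Hvol Hminor smin m _ sm0 Hsm erefl dl0.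
have g0 : 0 < g%:R :> R by rewrite ltr0n; exact: cb_g HC1.
have gi0 : 0 < g%:R^-1 :> R by rewrite invr_gt0.
have n0 : 0 < n.+1%:R :> R by rewrite ltr0n.
have [klo [K [_ K0 HK]]] := positive_bounds k0.
have {HK} kK i : kap i <= K by have /andP [] := HK i.
pose rho i : R := r i / kap i.
have rho0 i : 0 < rho i by rewrite divr_gt0.
pose o i : R := a 0 i - 4 * kap i.
(* The error [e] is shared equally between the affine approximation, the thickness [eta] of the
   pieces and the inaccuracy [e2] of the jumps. *)
pose eta : R := Num.min g%:R^-1 (e / 3 / (n.+1%:R * (B + 1))).
have B10 : 0 < B + 1 by rewrite ltr_wpDl.
have eta0 : 0 < eta.
  by rewrite lt_min gi0; apply: divr_gt0; [exact: divr_gt0 | exact: mulr_gt0].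
have etag : eta <= g%:R^-1 by rewrite ge_min lexx.
have etaB : n.+1%:R * (B * eta) <= e / 3.
  apply: (@le_trans _ _ (eta * (n.+1%:R * (B + 1)))).
    by rewrite [leRHS]mulrCA ler_pM2l // mulrC ler_pM2l // lerDl.
  by rewrite -ler_pdivlMr ?mulr_gt0 // ge_min lexx orbT.
pose e2 : R := Num.min (1/8) (e / 3).
have e20 : 0 < e2 by rewrite lt_min !divr_gt0.
have e28 : e2 <= 1/8 by rewrite ge_min lexx.
have e2e : e2 <= e / 3 by rewrite ge_min lexx orbT.
pose M := (Num.truncn (e^-1)).+1.
have M0 : 0 < M%:R :> R by rewrite ltr0n.
have Me : (2 * M%:R)^-1 <= e.
  rewrite -[leRHS]invrK lef_pV2 ?posrE ?mulr_gt0 ?invr_gt0 //.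
  by apply: le_trans (ltW (truncnS_gt _)) _; rewrite -/M ler_peMl ?(ltW M0) // ler1n.
pose W : R := 8 + \sum_i rho i.
have W0 : 0 < W by rewrite ltr_wpDr // sumr_ge0 // => i _; exact: ltW.
have rhoW i : rho i <= W - 8.
  by rewrite /W addrC addKr (bigD1 i) //= lerDl sumr_ge0 // => c' _; exact: ltW.
have [G [LG [exc [key [LG0 GL Gid Goff [Gsk Gkey]]]]]] := collapse_exists jk kl ln (ltW W0) eta0.
have HC2 : collapse_bounds_for j k l W eta G exc key by split.
have Hrange x : U (rescale o kap x) -> in_range rho x.
  exact: (@pt_range R n a r kap U UR k0).
pose om : R := e2 * smin; have om0 : 0 < om by rewrite mulr_gt0.
have [dw [dw0 Hdw]] := uniform_osc oU UR HPhi m0 om0.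
pose el : R := dw / (K * (LG + 1)).
have LG1 : 0 < LG + 1 by rewrite ltr_wpDl.
have el0 : 0 < el by rewrite divr_gt0 // mulr_gt0.
have Hs5 i : 5 * m <= s i.
  have h1 : side i <= s i by rewrite /side ler_pdivrMr ?ltr0n // ler_peMr ?ler1n // ltW.
  by have := Hsm i; have := sd0 i; rewrite /m; clear -h1 sm0; lra.
have HW (z : 'rV[R]_n.+1) : U (rescale o kap z) -> forall i, 1 <= z 0 i <= W - 1.
  by move=> /Hrange Hz i; have := Hz i; have := rhoW i; have := rho0 i; clear; lra.
have Hex (q : R) (x : 'rV[R]_n.+1) : 0 <= q <= 1 -> in_box W x -> U (rescale o kap ((1 - q) *: G x + q *: x)) ->
    forall i, 1 <= x 0 i <= W - 1.
  move=> /andP [q0 q1] Hx /Hrange Hz i; have := Hz i; have := Gid x Hx i; have := rhoW i; rewrite mxE.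
  have -> : ((1 - q) *: G x) 0 i + (q *: x) 0 i = x 0 i + (1 - q) * (G x 0 i - x 0 i).
    by rewrite [((1 - q) *: G x) 0 i]mxE [(q *: x) 0 i]mxE; ring.
  rewrite ler_norml; move: (G x 0 i - x 0 i) => z h1 /andP [h2 h3] h4.
  have h5 : -2 <= (1 - q) * z <= 2 by clear -q0 q1 h2 h3; apply/andP; split; nra.
  by move: h1 h4 h5; clear; lra.
have [H [dl [dl_0 dl_el dlW Hjump]]] := degree_jumps oU UR HPhi HD D0 m0 Hs5 k0 W0 LG0 HW GL Gid Hex el0.
have Hs : eps + g%:R ^+ k * (e * (B * g%:R^-1 + e) ^+ k.-1) < c by move: Hsmall; rewrite ltrBrDl.
have Hea : e / 3 + n.+1%:R * (B * eta) + e2 <= e by move: etaB e2e; clear; lra.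
have dlW' : dl * H%:R <= W by rewrite dlW.
have [box [pos [boxN [posM Hlab]]]] := Hc rho g N _ _ _ eps e B eta (e / 3) e2 W M G exc key HC1 HC2 (ltW eta0) etag B0
  eps0 (ltn0Sn _) Me Hea Hs H dl (ltW dl_0) dlW'.
pose t (u : torus n.+1 H) : 'rV[R]_n.+1 := \row_i (b 0 i + side i * ((box (low l u) i)%:R + 1/4 +
   (2 * M%:R)^-1 * (pos (low k u) i)%:R)).
have tb u i := @lattice_label_bounds R _ _ _ _ (b 0 i) (side i) (2 * m) (boxN (low l u) i) (posM (low k u) i) (sd0 i).
have m2 i : 2 * m <= side i / 4 by rewrite /m; have := Hsm i; clear; lra.
have sN i : side i * (N i)%:R = s i by rewrite divfK // gt_eqF // ltr0n.
have Ht u : deep b s (2 * m) (t u).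
  by move=> i; have [h _] := tb u i (m2 i); rewrite /t mxE -[in X in _ <= _ <= X](sN i).
have [u [tau [Hu Cu Hbits]]] := Hjump t Ht.
have uH i : (u i < H)%N by have /andP [] := Hu i.
have inW (v : torus n.+1 H) : in_box W (tpos dl v).
  move=> i; rewrite mxE mulr_ge0 ?ler0n ?(ltW dl_0) //= -dlW ler_pM2l // ler_nat -ltnS; exact: ltn_ord.
have Hnear v : in_cell u v -> forall i, `|Phi (rescale o kap (G (tpos dl v))) 0 i - Phi (rescale o kap (G (tpos dl u))) 0 i| <= om.
  move=> Hv i; apply: (Hdw _ Cu _ _).2 => i'.
  have Ek : rescale o kap (G (tpos dl v)) 0 i' - rescale o kap (G (tpos dl u)) 0 i' =
     kap i' * (G (tpos dl v) 0 i' - G (tpos dl u) 0 i') by rewrite ![rescale _ _ _ _ _]mxE; ring.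
  rewrite Ek normrM gtr0_norm //.
  have Hc0 : cnear dl (tpos dl u) (tpos dl v) by move=> i1; apply: tpos_cell => //; exact: ltW.
  apply: (@le_trans _ _ (K * (LG * dl))).
    by apply: ler_pM => //; [exact: ltW | exact: GL (inW u) (inW v) Hc0 i'].
  apply: (@le_trans _ _ (el * (K * (LG + 1)))); last by rewrite divfK // gt_eqF // mulr_gt0.
  rewrite [leRHS]mulrC -mulrA ler_pM2l //; apply: ler_pM => //; first exact: ltW.
  by rewrite lerDl.
pose pu := Phi (rescale o kap (G (tpos dl u))).
have Hclose (i : 'I_n.+1) lo hi : lo <= t (step_before u tau i) 0 i <= hi -> lo <= t (step_after u tau i) 0 i <= hi ->
    lo - om <= pu 0 i <= hi + om.
  have := Hbits i _ _ (step_beforeE tau uH i) (step_afterE tau uH i); rewrite /bits => Hb h1 h2.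
  exact: jump_close Hb (Hnear _ (in_cell_before tau uH i) i) (Hnear _ (in_cell_after tau uH i) i) h1 h2.
have omsm i : om <= e2 * side i by rewrite ler_pM2l.
have tE (v : torus n.+1 H) i : t v 0 i = b 0 i + side i * ((box (low l v) i)%:R + 1/4 + (2 * M%:R)^-1 * (pos (low k v) i)%:R).
  by rewrite mxE.
(* Along a step in a direction below [l] the box is unchanged and only the position may vary, so the
   value lies in that box. Below [k] the whole label is unchanged, and the value is within [e2] of
   it. *)
apply: (Hlab u tau) => // [i il|i ik].
  have [_ h1] := tb (step_before u tau (tau i)) (tau i) (m2 _).
  have [_ h2] := tb (step_after u tau (tau i)) (tau i) (m2 _).
  rewrite -tE in h1; rewrite -tE low_step_after // in h2.
  have := Hclose (tau i) _ _ h1 h2; rewrite low_step_before //.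
  apply: inside_box_of_bounds; first exact: sd0.
  apply: le_trans (omsm (tau i)) _; rewrite mulrC ler_pM2l ?sd0 //.
  by apply: le_trans e28 _; rewrite mul1r.
have il : (i < l)%N := leq_trans ik kl.
have := Hclose (tau i) (t (step_before u tau (tau i)) 0 (tau i)) (t (step_before u tau (tau i)) 0 (tau i)).
rewrite !tE !low_step_after // !low_step_before // lexx => /(_ isT isT).
by apply: near_label_of_bounds; [exact: sd0 | exact: omsm].
Qed.

(** * Minors and the dilation *)

Lemma enum_set_increasing n (T : {set 'I_n}) (x0 : 'I_n) a c : (a < c)%N -> (c < #|T|)%N ->
  (nth x0 (enum T) a < nth x0 (enum T) c)%N.
Proof.
move=> ac cT; have tr : transitive (relpre (@nat_of_ord n) ltn) by move=> y x z /=; exact: ltn_trans.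
have Hs : sorted (relpre (@nat_of_ord n) ltn) (enum T).
  rewrite {1}/(enum T) /=; apply: sorted_filter => //; rewrite -sorted_map -enumT val_enum_ord.
  exact: iota_ltn_sorted.
apply: (sorted_ltn_nth tr x0 Hs) => //; rewrite inE -cardE //; exact: ltn_trans cT.
Qed.

Lemma sorted_index k n (f : 'I_k -> 'I_n) : injective f -> exists (I : multi_index k n) (t : 'S_k),
  forall a, f a = val I (t a).
Proof.
case: k f => [|k] f fI.
  have HI : [forall i : 'I_0, forall j : 'I_0, (i < j)%N ==> ([ffun x => f x] i < [ffun x => f x] j)%N].
    by apply/forallP; case.
  by exists (exist _ [ffun x => f x] HI), 1%g; case.
pose T := [set f a | a : 'I_k.+1]%SET.
have cT : #|T| = k.+1 by rewrite card_imset // card_ord.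
pose I : {ffun 'I_k.+1 -> 'I_n} := [ffun a : 'I_k.+1 => nth (f ord0) (enum T) a].
have HI : [forall i : 'I_k.+1, forall j : 'I_k.+1, (i < j)%N ==> (I i < I j)%N].
  apply/forallP => i; apply/forallP => j; apply/implyP => ij; rewrite !ffunE.
  by apply: enum_set_increasing => //; rewrite cT.
have fT a : f a \in enum T by rewrite mem_enum imset_f.
have Ht a : (index (f a) (enum T) < k.+1)%N by have := fT a; rewrite -index_mem -cardE cT.
have tI : injective (fun a => Ordinal (Ht a)).
  by move=> a c [E]; apply: fI; rewrite -(nth_index (f ord0) (fT a)) E nth_index.
exists (exist _ I HI), (perm tI) => a.
by rewrite permE /= ffunE /= nth_index.
Qed.

Section Opnorm.
Variable R : realType.

Lemma enorm_ge N (w : 'rV[R]_N) i : `|w 0 i| <= enorm w.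
Proof.
rewrite /enorm -sqrtr_sqr ler_sqrt; last by rewrite sumr_ge0 // => c _; exact: sqr_ge0.
by rewrite (bigD1 i) //= lerDl sumr_ge0 // => c _; exact: sqr_ge0.
Qed.

Lemma entry_le_opnorm M N (A : 'M[R]_(M, N)) i c : `|A i c| <= opnorm A.
Proof.
pose w : 'rV[R]_M := delta_mx 0 i.
have wA : w *m A = row i A by rewrite /w rowE.
have w1 : enorm w <= 1.
  rewrite /enorm (bigD1 i) //= big1 => [|x xi]; first by rewrite mxE !eqxx addr0 expr1n sqrtr1.
  by rewrite mxE (negbTE xi) andbF expr0n.
apply: (@le_trans _ _ (enorm (w *m A))).
  by have := enorm_ge (w *m A) c; rewrite wA mxE.
apply: ub_le_sup; last by exists w.
(* An upper bound for the set in [opnorm] has to be exhibited, as [sup] dominates the elements only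
   of a bounded set. *)
exists (Num.sqrt (\sum_x (\sum_y `|A y x|) ^+ 2)) => _ [v v1 <-].
rewrite /enorm ler_sqrt; last by rewrite sumr_ge0 // => x _; exact: sqr_ge0.
apply: ler_sum => x _; rewrite -real_normK ?num_real // lerXn2r ?nnegrE //.
  by rewrite sumr_ge0.
rewrite mxE; apply: le_trans (ler_norm_sum _ _ _) _; apply: ler_sum => y _.
rewrite normrM ler_piMl //; exact: le_trans (enorm_ge v y) v1.
Qed.

(** Sorting the rows and columns changes a minor only by a sign and turns it into an entry of
    [ext_power]. *)
Lemma minor_le_opnorm n k (A : 'M[R]_n) (f h : 'I_k -> 'I_n) : injective f -> injective h ->
  `|\det (mxsub f h A)| <= opnorm (ext_power k A).
Proof.
move=> /sorted_index [I [t Et]] /sorted_index [J [t' Et']].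
have -> : mxsub f h A = row_perm t (col_perm t' (mxsub (val I) (val J) A)).
  by apply/matrixP => a c; rewrite !mxE Et Et'.
rewrite row_permE det_mulmx col_permE det_mulmx !det_perm !normrM !normr_sign mul1r mulr1.
by have := entry_le_opnorm (ext_power k A) (enum_rank I) (enum_rank J); rewrite mxE !enum_rankK.
Qed.

End Opnorm.

(** The part of [T] outside the initial segment is as large as the part of the segment outside [T],
    and the last value [v] on the segment separates the two. *)
Lemma prod_first_le (R : realType) n (F : 'I_n -> R) (T : {set 'I_n}) : (forall i, 0 < F i) ->
  (forall i c : 'I_n, (i <= c)%N -> F i <= F c) ->
  \prod_(i < n | (i < #|T|)%N) F i <= \prod_(i in T) F i.
Proof.
move=> F0 Fm; set l := #|T|; have ln : (l <= n)%N by rewrite /l -[leqRHS](card_ord n) max_card.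
pose L := mid_range n 0 l; have cL : #|L| = l by rewrite card_mid_range // subn0.
have -> : \prod_(i < n | (i < l)%N) F i = \prod_(i in L) F i.
  by apply: eq_bigl => i; rewrite finset.in_set.
have [l0|l0] := posnP l.
  have -> : T = finset.set0 by apply/eqP; rewrite -cards_eq0 -/l l0.
  have -> : L = finset.set0 by apply/eqP; rewrite -cards_eq0 cL l0.
  by [].
have ln1 : (l.-1 < n)%N by rewrite prednK.
pose v := F (Ordinal ln1).
rewrite (bigID (mem T)) [leRHS](bigID (mem L)) /=.
have -> : \prod_(i in L | i \in T) F i = \prod_(i in T | i \in L) F i.
  by apply: eq_bigl => i; rewrite andbC.
rewrite ler_pM2l; last by apply: prodr_gt0.
have E : #|L :\: T| = #|T :\: L|.
  by apply/eqP; rewrite -(eqn_add2l #|L :&: T|) cardsID finset.setIC cardsID cL.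
apply: (@le_trans _ _ (v ^+ #|L :\: T|)).
  rewrite -prodr_const [leRHS](eq_bigl (fun i => (i \in L) && (i \notin T))); last first.
    by move=> i; rewrite finset.in_setD andbC.
  apply: ler_prod => i /andP [iL _]; rewrite (ltW (F0 i)) /=; apply: Fm => /=.
  by move: iL; rewrite finset.in_set /=; case: (l) l0.
rewrite E -prodr_const [leLHS](eq_bigl (fun i => (i \in T) && (i \notin L))); last first.
  by move=> i; rewrite finset.in_setD andbC.
apply: ler_prod => i /andP [_ iL]; rewrite (ltW (F0 _)) /=; apply: Fm => /=.
move: iL; rewrite finset.in_set /= -leqNgt; exact: leq_trans (leq_pred _).
Qed.

Lemma prod_codom (R : realType) k n (f : 'I_k -> 'I_n) (F : 'I_n -> R) : injective f ->
  \prod_c F (f c) = \prod_(i in [set f c | c : 'I_k]%SET) F i.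
Proof. by move=> fI; rewrite big_imset //= => x y _ _; exact: fI. Qed.

(** * The dilation estimate *)

Record degree_map (R : realType) (n k : nat) (a b : 'rV[R]_n) (r s : 'I_n -> R) (U : set 'rV[R]_n)
    (Phi : 'rV[R]_n -> 'rV[R]_n) (D : int) (La : R) : Prop := DegreeMap {
  dm_r : rect_dims r; dm_s : rect_dims s; dm_open : open U; dm_sub : U `<=` rectangle a r;
  dm_pairs : map_of_pairs U (rectangle b s) Phi; dm_degree : has_degree U (rectangle b s) Phi D;
  dm_D : D != 0; dm_La : 0 <= La;
  dm_minor : forall x, U x -> forall f h : 'I_k -> 'I_n, injective f -> injective h ->
    `|\det (mxsub f h (jacobian Phi x))| <= La }.

Lemma prod_mid_range_const (R : realType) n j k (F : 'I_n -> R) (v : R) : (j <= k)%N -> (k <= n)%N ->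
  (forall i : 'I_n, (j <= i)%N -> F i = v) ->
  \prod_(i < n | (i < k)%N) F i = \prod_(i < n | (i < j)%N) F i * v ^+ (k - j).
Proof.
move=> jk kn HF; rewrite (bigID (fun i : 'I_n => (i < j)%N)) /=; congr (_ * _).
  by apply: eq_bigl => i; case: (ltnP i j) => ij; rewrite ?andbF ?andbT //; exact: (leq_trans ij jk).
rewrite (eq_bigl (fun i => i \in mid_range n j k)); last first.
  by move=> i; rewrite finset.in_set -leqNgt andbC.
rewrite (eq_bigr (fun=> v)); last by move=> i; rewrite finset.in_set => /andP [ji _]; exact: HF.
by rewrite prodr_const card_mid_range.
Qed.

(** As the first ratio is at most [mu], the unit [sg / mu] fits into side [j] of the domain and
    hence into all later ones. By the choice of [mu] the products of [r i / kap i] and of [s i / sg]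
    over [j <= i < l] agree, which is the volume hypothesis up to rounding. The first [j] directions
    get one box each and their own side as unit. *)
Lemma balanced_case (R : realType) n j k l : (j < k)%N -> (k <= l)%N -> (l <= n.+1)%N ->
  exists c : R, 0 < c /\ forall (a b : 'rV[R]_n.+1) r s U Phi D La (mu : R),
  degree_map k a b r s U Phi D La -> 0 < mu ->
  mu ^+ (l - j) = \prod_(i < n.+1 | (j <= i < l)%N) (s i / r i) ->
  (forall i : 'I_n.+1, i = j :> nat -> s i / r i <= mu) ->
  c * (\prod_(i < n.+1 | (i < j)%N) (s i / r i) * mu ^+ (k - j)) <= La.
Proof.
move=> jk kl ln; have CN0 : 0 < 2 ^+ n.+1 :> R by rewrite exprn_gt0.
have [c [c0 Hc]] := minors_lower_bound jk kl ln CN0; exists c; split=> //.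
move=> a b r s U Phi D La mu [[r0 rm] [s0 sm] oU UR HPhi HD D0 La0 Hm] mu0 Emu Hj.
have jn : (j < n.+1)%N by exact: leq_trans jk (leq_trans kl ln).
pose J := Ordinal jn; pose sg := s J; have sg0 : 0 < sg by exact: s0.
pose sc := sg / mu; have sc0 : 0 < sc by rewrite divr_gt0.
pose kap (i : 'I_n.+1) : R := if (i < j)%N then r i else sc.
pose N (i : 'I_n.+1) : nat := if (i < j)%N then 1%N else Num.truncn (s i / sg).
have k0 i : 0 < kap i by rewrite /kap; case: ifP.
have sgs (i : 'I_n.+1) : (j <= i)%N -> 1 <= s i / sg by move=> ji; rewrite ler_pdivlMr // mul1r; exact: sm.
have N0 i : (0 < N i)%N by rewrite /N; case: (ltnP i j) => // ji; rewrite truncn_gt0 sgs.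
have scr (i : 'I_n.+1) : (j <= i)%N -> sc <= r i.
  move=> ji; apply: (@le_trans _ _ (r J)); last exact: rm.
  rewrite /sc ler_pdivrMr // mulrC -ler_pdivrMr //; exact: Hj.
have trle (x : R) : 1 <= x -> (Num.truncn x)%:R <= x by move=> x1; rewrite truncn_le; apply: le_trans x1.
have tr2 (x : R) : 1 <= x -> x <= 2 * (Num.truncn x)%:R.
  move=> x1; have := truncnS_gt x; rewrite -natr1.
  have : 1 <= (Num.truncn x)%:R :> R by rewrite ler1n truncn_gt0.
  lra.
have Nm (i i' : 'I_n.+1) : (i <= i')%N -> (N i)%:R <= (N i')%:R :> R.
  move=> ii; rewrite ler_nat /N; case: (ltnP i j) => ij.
    by case: (ltnP i' j) => // ji'; rewrite truncn_gt0 sgs.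
  rewrite ltnNge (leq_trans ij ii) /=; apply: le_truncn; rewrite ler_pM2r ?invr_gt0 //; exact: sm.
have Hvol (T : {set 'I_n.+1}) : #|T| = l ->
    \prod_(i < n.+1 | (j <= i < l)%N) (r i / kap i) <= 2 ^+ n.+1 * \prod_(i in T) (N i)%:R.
  move=> cT.
  have E : \prod_(i < n.+1 | (j <= i < l)%N) (r i / kap i) = \prod_(i < n.+1 | (j <= i < l)%N) (s i / sg).
    have -> : \prod_(i < n.+1 | (j <= i < l)%N) (r i / kap i) =
       \prod_(i < n.+1 | (j <= i < l)%N) (mu * ((s i / sg) / (s i / r i))).
      apply: eq_bigr => i /andP [ji _]; rewrite /kap ltnNge ji /= /sc.
      by field; rewrite !gt_eqF.
    rewrite big_split /= prodf_div -Emu (eq_bigl (fun i => i \in mid_range n.+1 j l)); last first.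
      by move=> i; rewrite finset.in_set.
    by rewrite prodr_const card_mid_range // mulrCA divff ?mulr1 // expf_neq0 // gt_eqF.
  rewrite E; apply: (@le_trans _ _ (\prod_(i < n.+1 | (j <= i < l)%N) (2 * (N i)%:R))).
    apply: ler_prod => i /andP [ji _]; rewrite divr_ge0 ?(ltW (s0 _)) ?(ltW sg0) //=.
    by rewrite /N ltnNge ji /=; apply: tr2; exact: sgs.
  have F0 i : 0 < (N i)%:R :> R by rewrite ltr0n.
  have := prod_first_le T F0 Nm; rewrite cT => HT.
  have P2 : \prod_(i < n.+1 | (j <= i < l)%N) (N i)%:R <= \prod_(i in T) (N i)%:R :> R.
    apply: le_trans HT; rewrite (bigID (fun i : 'I_n.+1 => (j <= i)%N) (fun i : 'I_n.+1 => (i < l)%N)) /=.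
    rewrite [X in _ * X]big1; last by move=> i /andP [_ ij]; rewrite /N ltnNge ij.
    by rewrite mulr1 le_eqVlt; apply/orP; left; apply/eqP; apply: eq_bigl => i; rewrite andbC.
  rewrite big_split /= (eq_bigl (fun i => i \in mid_range n.+1 j l)); last by move=> i; rewrite finset.in_set.
  rewrite prodr_const card_mid_range //; apply: ler_pM => //; first by apply: prodr_ge0.
  rewrite ler_weXn2l ?ler1n //; clear -ln; lia.
pose PR := \prod_(i < n.+1 | (i < j)%N) r i; pose PS := \prod_(i < n.+1 | (i < j)%N) s i.
have PR0 : 0 < PR by apply: prodr_gt0.
have PS0 : 0 < PS by apply: prodr_gt0.
pose eps := La * (PR * sc ^+ (k - j)) / (PS * sg ^+ (k - j)).
have q1 : 0 < PR * sc ^+ (k - j) by rewrite mulr_gt0 // exprn_gt0.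
have q2 : 0 < PS * sg ^+ (k - j) by rewrite mulr_gt0 // exprn_gt0.
have eps0 : 0 <= eps by apply: divr_ge0; [apply: mulr_ge0 => //; exact: ltW | exact: ltW].
have kn : (k <= n.+1)%N := leq_trans kl ln.
have : c <= eps.
  apply: (Hc a b r s kap N U Phi D eps oU UR HPhi HD D0 r0 s0 k0 N0 _ _ Hvol eps0).
  - by move=> i ij; rewrite /kap ij.
  - by move=> i /andP [ji _]; rewrite /kap ltnNge ji /=; exact: scr.
  move=> x Ux f h fI hI Hf1 Hf2.
  have Ek : \prod_c kap (f c) = PR * sc ^+ (k - j).
    rewrite prod_codom //; set T := [set _ | _ in _]%SET.
    have cT : #|T| = k by rewrite card_imset // card_ord.
    rewrite (bigID (fun i : 'I_n.+1 => (i < j)%N)) /=; congr (_ * _).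
      rewrite (eq_bigl (fun i : 'I_n.+1 => (i < j)%N)); last first.
        move=> i; case ij: (i < j)%N; rewrite ?andbF // andbT.
        by have [c' <-] := Hf1 i ij; rewrite imset_f.
      by apply: eq_bigr => i ij; rewrite /kap ij.
    rewrite (eq_bigr (fun=> sc)); last by move=> i /andP [_ ij]; rewrite /kap (negbTE ij).
    rewrite (eq_bigl (fun i => i \in T :\: mid_range n.+1 0 j)%SET); last first.
      by move=> i; rewrite finset.in_setD finset.in_set andbC.
    rewrite prodr_const cardsD; congr (_ ^+ _).
    have -> : (T :&: mid_range n.+1 0 j)%SET = mid_range n.+1 0 j.
      apply/finset.setIidPr/fintype.subsetP => i; rewrite finset.in_set => /= ij.
      by have [c' <-] := Hf1 i ij; rewrite imset_f.
    by rewrite cT card_mid_range ?subn0 // ltnW.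
  (* Because [N] is rounded down, boxes have side at least [sg] from direction [j] on, and the
     product over [k] directions is least for the first [k]. *)
  have Es : PS * sg ^+ (k - j) <= \prod_c (s (h c) / (N (h c))%:R).
    rewrite (prod_codom (fun i => s i / (N i)%:R) hI); set T := [set _ | _ in _]%SET.
    have cT : #|T| = k by rewrite card_imset // card_ord.
    pose F (i : 'I_n.+1) : R := if (i < j)%N then s i else sg.
    have F0 i : 0 < F i by rewrite /F; case: ifP.
    have Fm (i i' : 'I_n.+1) : (i <= i')%N -> F i <= F i'.
      move=> ii; rewrite /F; case: (ltnP i j) => ij; case: (ltnP i' j) => ij' //.
      - exact: sm.
      - by apply: sm => /=; exact: ltnW.
      - by have := leq_ltn_trans ii ij'; rewrite ltnNge ij.
    apply: (@le_trans _ _ (\prod_(i in T) F i)).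
      have := prod_first_le T F0 Fm; rewrite cT (@prod_mid_range_const _ _ j k F sg (ltnW jk) kn); last first.
        by move=> i ji; rewrite /F ltnNge ji.
      rewrite (eq_bigr s) // => i ij; by rewrite /F ij.
    apply: ler_prod => i _; rewrite (ltW (F0 i)) /F /N /=; case: (ltnP i j) => ij; first by rewrite divr1.
    have t0 : 0 < (Num.truncn (s i / sg))%:R :> R by rewrite ltr0n truncn_gt0 sgs.
    by rewrite ler_pdivlMr // mulrC -ler_pdivlMr //; apply: trle; exact: sgs.
  rewrite Ek; apply: (@le_trans _ _ (La * (PR * sc ^+ (k - j)))).
    by rewrite ler_pM2r //; exact: Hm.
  have -> : La * (PR * sc ^+ (k - j)) = eps * (PS * sg ^+ (k - j)) by rewrite /eps divfK // gt_eqF.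
  by rewrite ler_wpM2l.
rewrite /eps ler_pdivlMr // => H.
rewrite -(ler_pM2r q1); apply: le_trans H; rewrite le_eqVlt; apply/orP; left; apply/eqP.
have scE : sc ^+ (k - j) * mu ^+ (k - j) = sg ^+ (k - j) by rewrite -exprMn /sc divfK // gt_eqF.
rewrite prodf_div -/PS -/PR -scE.
have E3 (X Y : R) : c * (PS / PR * X) * (PR * Y) = c * (PS * (Y * X)) by field; rewrite gt_eqF.
by rewrite E3.
Qed.

Lemma root_exists (R : realType) (P : R) N : 0 < P -> (0 < N)%N -> exists2 mu : R, 0 < mu & mu ^+ N = P.
Proof.
move=> P0 N0; exists (P `^ N%:R^-1); first exact: powR_gt0.
by rewrite -powR_mulrn ?powR_ge0 // -powRrM mulVf ?powRr1 ?ltW // pnatr_eq0 -lt0n.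
Qed.

(* The first ratio can be absorbed when it exceeds the geometric mean [mu] of the ratios. *)
Lemma mean_after_removal (R : realType) (q mu mu' : R) p N : 0 < mu -> 0 < mu' -> mu <= q -> (p <= N)%N ->
  mu ^+ N.+2 = q * mu' ^+ N.+1 -> mu ^+ p.+2 <= q * mu' ^+ p.+1.
Proof.
move=> mu0 mu'0 muq pN E; have q0 : 0 < q := lt_le_trans mu0 muq.
have H1 : 0 <= q * mu' ^+ p.+1 by apply: mulr_ge0; [exact: ltW | apply: exprn_ge0; exact: ltW].
have H2 : 0 <= mu ^+ p.+2 by apply: exprn_ge0; exact: ltW.
rewrite -(ler_pXn2r (ltn0Sn N)) ?nnegrE //.
have -> : (q * mu' ^+ p.+1) ^+ N.+1 = q ^+ (N - p) * (q * mu' ^+ N.+1) ^+ p.+1.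
  rewrite !exprMn mulrA -exprD -!exprM [(N.+1 * _)%N]mulnC; congr (_ ^+ _ * _).
  by rewrite addnS subnK.
have -> : (mu ^+ p.+2) ^+ N.+1 = mu ^+ (N - p) * (mu ^+ N.+2) ^+ p.+1.
  by rewrite -!exprM -exprD; congr (_ ^+ _); clear -pN; nia.
by rewrite -E ler_pM2r ?exprn_gt0 // lerXn2r ?nnegrE ?(ltW mu0) ?(ltW q0).
Qed.

(** Induction on [k - j]. A first ratio above [mu] is moved to the initial product and [mu] is
    replaced by the mean of the remaining ratios; by [mean_after_removal] this gives a stronger
    bound. For [k = j.+1] there is no room to do so, and the balanced case with [l = k], whose mean
    is the first ratio itself, suffices. *)
Lemma dilation_bound (R : realType) n : exists c : R, 0 < c /\
  forall j k l (a b : 'rV[R]_n.+1) r s U Phi D La (mu : R), (j < k)%N -> (k <= l)%N -> (l <= n.+1)%N ->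
  degree_map k a b r s U Phi D La -> 0 < mu ->
  mu ^+ (l - j) = \prod_(i < n.+1 | (j <= i < l)%N) (s i / r i) ->
  c * (\prod_(i < n.+1 | (i < j)%N) (s i / r i) * mu ^+ (k - j)) <= La.
Proof.
(* The triples (j, k, l) are finite in number, which allows a constant that depends on [n] only. *)
pose P (x : 'I_n.+2 * 'I_n.+2 * 'I_n.+2) (c : R) := (x.1.1 < x.1.2)%N -> (x.1.2 <= x.2)%N ->
  forall (a b : 'rV[R]_n.+1) r s U Phi D La (mu : R),
  degree_map x.1.2 a b r s U Phi D La -> 0 < mu ->
  mu ^+ (x.2 - x.1.1) = \prod_(i < n.+1 | (x.1.1 <= i < x.2)%N) (s i / r i) ->
  (forall i : 'I_n.+1, i = x.1.1 :> nat -> s i / r i <= mu) ->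
  c * (\prod_(i < n.+1 | (i < x.1.1)%N) (s i / r i) * mu ^+ (x.1.2 - x.1.1)) <= La.
have [c [c0 Hc]] : exists c : R, 0 < c /\ forall x, x \in enum {: 'I_n.+2 * 'I_n.+2 * 'I_n.+2} ->
    forall c', 0 < c' -> c' <= c -> P x c'.
  apply: seq_uniform => -[[j k] l] _; have [/andP [jk kl]|H] := boolP ((j < k)%N && (k <= l)%N); last first.
    by exists 1; split=> // c' _ _ /= jk kl; rewrite /= jk kl in H.
  have [c [c0 Hc]] := @balanced_case R n j k l jk kl (ltn_ord l).
  exists c; split=> // c' c'0 c'c _ _ a b r s U Phi D La mu /= H mu0 Emu Hj.
  apply: le_trans (Hc a b r s U Phi D La mu H mu0 Emu Hj); rewrite ler_wpM2r //.
  have [[r0 _] [s0 _] _ _ _ _ _ _ _] := H.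
  by rewrite mulr_ge0 ?exprn_ge0 ?(ltW mu0) // prodr_ge0 // => i _; rewrite divr_ge0 ?ltW.
have {}Hc j k l a b r s U Phi D La mu : (j < k)%N -> (k <= l)%N -> (l <= n.+1)%N ->
    @degree_map R n.+1 k a b r s U Phi D La -> 0 < mu ->
    mu ^+ (l - j) = \prod_(i < n.+1 | (j <= i < l)%N) (s i / r i) ->
    (forall i : 'I_n.+1, i = j :> nat -> s i / r i <= mu) ->
    c * (\prod_(i < n.+1 | (i < j)%N) (s i / r i) * mu ^+ (k - j)) <= La.
  move=> jk kl ln; have ll : (l < n.+2)%N by rewrite ltnS.
  have kk : (k < n.+2)%N by exact: leq_ltn_trans kl ll.
  have jj : (j < n.+2)%N by exact: ltn_trans jk kk.
  by apply: (Hc (Ordinal jj, Ordinal kk, Ordinal ll) (mem_enum _ _) c c0 (lexx _)).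
exists c; split=> // j k l a b r s U Phi D La mu jk kl ln H.
have [[r0 _] [s0 _] _ _ _ _ _ _ _] := H.
have q0 i : 0 < s i / r i by rewrite divr_gt0.
move Ed : (k - j)%N => d; elim: d j jk mu Ed => [|d IH] j jk mu Ed mu0 Emu; first by lia.
have jn : (j < n.+1)%N by lia.
pose J := Ordinal jn.
have [qmu|muq] := lerP (s J / r J) mu.
  rewrite -Ed; apply: (Hc j k l a b r s U Phi D La mu) => // i Ei.
  by have -> : i = J by exact: val_inj.
have PJ : \prod_(i < n.+1 | (i < j.+1)%N) (s i / r i) = \prod_(i < n.+1 | (i < j)%N) (s i / r i) * (s J / r J).
  rewrite (bigD1 J) /= ?leqnn // mulrC; congr (_ * _); apply: eq_bigl => i.
  by rewrite ltnS [in RHS]ltn_neqAle andbC.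
have PJl l' : (j < l')%N -> \prod_(i < n.+1 | (j <= i < l')%N) (s i / r i) =
    s J / r J * \prod_(i < n.+1 | (j.+1 <= i < l')%N) (s i / r i).
  move=> jl; rewrite (bigD1 J) /= ?leqnn //; congr (_ * _); apply: eq_bigl => i.
  by rewrite [in RHS]ltn_neqAle eq_sym -val_eqE /= -!andbA; case: (_ == _); rewrite /= ?andbF ?andbT.
have PP0 : 0 <= \prod_(i < n.+1 | (i < j)%N) (s i / r i) by apply: prodr_ge0 => i _; exact: ltW.
have [Ek|jk1] := eqVneq k j.+1.
  have := Hc j k k a b r s U Phi D La (s J / r J) jk (leqnn k) (leq_trans kl ln) H (q0 J).
  have Ekj : (k - j)%N = 1%N by lia.
  rewrite Ekj expr1 PJl // big_pred0; last by move=> i; rewrite Ek; clear; lia.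
  rewrite mulr1 => /(_ erefl) HH; have d0 : d = 0%N by lia.
  rewrite d0 expr1; apply: le_trans (HH _); last by move=> i Ei; have -> : i = J by exact: val_inj.
  by rewrite ler_pM2l // ler_wpM2l // ltW.
have jk' : (j.+1 < k)%N by lia.
have [mu' mu'0 Emu'] : exists2 mu' : R, 0 < mu' & mu' ^+ (l - j.+1) = \prod_(i < n.+1 | (j.+1 <= i < l)%N) (s i / r i).
  by apply: root_exists; [apply: prodr_gt0 => i _; exact: q0 | lia].
have := IH j.+1 jk' mu' _ mu'0 Emu'; have -> : (k - j.+1)%N = d by lia.
move=> /(_ erefl); apply: le_trans; rewrite ler_pM2l // PJ -mulrA ler_wpM2l //.
have [p Ep] : exists p, d = p.+1 by exists d.-1; lia.
have [N EN] : exists N, (l - j)%N = N.+2 by exists (l - j).-2; lia.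
rewrite Ep; apply: (@mean_after_removal _ _ _ _ p N) => //; [exact: ltW | lia |].
by rewrite -EN Emu PJl; [rewrite -Emu'; congr (_ * _ ^+ _); lia | lia].
Qed.

(* Indices are 0-based: Q_1, ..., Q_n are q 0, ..., q (n - 1). *)
Theorem mainTheorem4 (R : realType) (n : nat) (hn : (1 <= n)%N) :
  exists c : R, 0 < c /\
  forall (k : nat) (a b : 'rV[R]_n) (r s : 'I_n -> R)
    (U : set 'rV[R]_n) (Phi : 'rV[R]_n -> 'rV[R]_n) (D : int) (j l : nat),
    (1 <= k <= n)%N ->
    rect_dims r -> rect_dims s ->
    open U -> U `<=` rectangle a r ->
    map_of_pairs U (rectangle b s) Phi ->
    has_degree U (rectangle b s) Phi D -> 0 < D ->
    (j < k)%N -> (k <= l)%N -> (l <= n)%N ->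
    let q := fun i : 'I_n => s i / r i in
    ((c * \prod_(i < n | (i < j)%N) q i
        * (\prod_(i < n | (j <= i < l)%N) q i)
            `^ ((k%:R - j%:R) / (l%:R - j%:R)))%:E
      <= dil k U Phi)%E.
Proof.
case: n hn => [//|n] _; have [c [c0 Hc]] := dilation_bound R n; exists c; split=> //.
move=> k a b r s U Phi D j l /andP [_ kn] Hr Hs oU UR HPhi HD D0 jk kl ln; cbv zeta.
pose q (i : 'I_n.+1) := s i / r i.
have q0 i : 0 < q i by rewrite /q divr_gt0 //; [have [-> _] := Hs | have [-> _] := Hr].
have lj0 : (0 < l - j)%N by lia.
have [mu mu0 Emu] : exists2 mu : R, 0 < mu & mu ^+ (l - j) = \prod_(i < n.+1 | (j <= i < l)%N) q i.
  by apply: root_exists => //; apply: prodr_gt0 => i _; exact: q0.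
rewrite -Emu -powR_mulrn ?(ltW mu0) // -powRrM.
have -> : (l - j)%:R * ((k%:R - j%:R) / (l%:R - j%:R)) = (k - j)%:R :> R.
  by rewrite -!natrB 1?ltnW // ?(leq_trans jk kl) // mulrCA divff ?mulr1 // pnatr_eq0 -lt0n.
rewrite powR_mulrn ?(ltW mu0) // -mulrA; set RHS := c * _.
have R0 : 0 < RHS.
  by apply: mulr_gt0 => //; apply: mulr_gt0; [apply: prodr_gt0 => i _; exact: q0 | exact: exprn_gt0].
have Hle La : 0 <= La -> (forall x, U x -> opnorm (ext_power k (jacobian Phi x)) <= La) -> RHS <= La.
  move=> La0 HLa; apply: (Hc j k l a b r s U Phi D La mu) => //; split=> //; first by rewrite gt_eqF.
  by move=> x Ux f h fI hI; apply: le_trans (minor_le_opnorm _ fI hI) (HLa x Ux).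
have Hub x : U x -> ((opnorm (ext_power k (jacobian Phi x)))%:E <= dil k U Phi)%E.
  by move=> Ux; apply: ereal_sup_ubound; exists x.
move: Hub; case: (dil k U Phi) => [y| |] Hub.
(* [Hle] asks for a nonnegative bound, hence the maximum with 0; since [RHS] is positive, the
   inequality falls on [y]. *)
- rewrite lee_fin; have := Hle (Num.max 0 y); rewrite le_max lexx => /(_ isT).
  have H x : U x -> opnorm (ext_power k (jacobian Phi x)) <= Num.max 0 y.
    by move=> /Hub; rewrite lee_fin le_max => ->; rewrite orbT.
  by move=> /(_ H); rewrite le_max leNgt R0.
- by rewrite leey.
(* The value -oo would mean that [U] is empty; then 0 would be an admissible bound, against the
   positivity of [RHS]. *)
have := Hle 0 (lexx _); rewrite leNgt R0 => HF; exfalso; suff : false by []; apply: HF => x /Hub.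
by rewrite leeNy_eq.
Qed.
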